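(* Let $F:\mathbb{H}\times\mathbb{R}\times\mathbb{R}^2\times\mathbf{S}^2\to\mathbb{R}$ be continuous and satisfy: (A1) $F(p,r,\xi,A_1)\le F(p,r,\xi,A_2)$ for all $p\in\mathbb{H}$, $r\in\mathbb{R}$, $\xi\in\mathbb{R}^2$ and $A_1,A_2\in\mathbf{S}^2$ with $A_1\ge A_2$; (A2) $F(p,r_1,\xi,A)\ge F(p,r_2,\xi,A)$ for all $p\in\mathbb{H}$, $\xi\in\mathbb{R}^2$, $A\in\mathbf{S}^2$ and $r_1\ge r_2$; (A3)$'$ for any $k\in\mathbb{N}$, $$\sum_{i=1}^kc_iF(p_i,r_i,\xi_i,A_i)\le F\Big(\sum_{i=1}^kc_ip_i,\sum_{i=1}^kc_ir_i,\sum_{i=1}^kc_i\xi_i,\sum_{i=1}^kc_iA_i\Big)$$ for any $c_i\in[0,1]$ with $\sum_ic_i=1$, $p_i\in\mathbb{H}$, $r_i\in\mathbb{R}$, $\xi_i\in\mathbb{R}^2$ and $A_i\in\mathbf{S}^2$ ($i=1,\dots,k$). Let $u$ be a lower semicontinuous viscosity supersolution of $$F(p,u,\nabla_Hu,(\nabla_H^2u)^\star)=0\quad\text{in }\mathbb{H},\qquad( * )$$ and suppose that $u$ is coercive, i.e. $\inf_{|p|\ge R}u(p)/|p|\to\infty$ as $R\to\infty$. Let $\Gamma_Eu$ be the Euclidean convex envelope of $u$, $$(\Gamma_Eu)(p)=\inf\Big\{\sum_{i=1}^4c_iu(p_i):\ c_i\in[0,1],\ p_i\in\mathbb{R}^3\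 (i=1,\dots,4),\ \sum_ic_i=1,\ \sum_ic_ip_i=p\Big\}.$$ Then $\Gamma_Eu$ is also a viscosity supersolution of $( * )$. Moreover, if the comparison principle for $( * )$ holds, then the unique viscosity solution of $( * )$ is convex in $\mathbb{R}^3$ (in the Euclidean sense).
   Context: The Heisenberg group $\mathbb{H}$ is $\mathbb{R}^3$ with the group law $(x_p,y_p,z_p)\cdot(x_q,y_q,z_q)=\left(x_p+x_q,\,y_p+y_q,\,z_p+z_q+\tfrac12(x_py_q-x_qy_p)\right)$. $|\cdot|$ is the Euclidean norm, linear combinations of points are taken in the vector space $\mathbb{R}^3$, and $\mathbf{S}^2$ is the set of symmetric $2\times2$ matrices with its usual order. Left-invariant vector fields: $X=\partial_x-\frac y2\partial_z$, $Y=\partial_y+\frac x2\partial_z$; $\nabla_Hu=(Xu,Yu)$; $(\nabla_H^2u)^\star=\begin{pmatrix}X^2u&\frac12(XYu+YXu)\\ \frac12(XYu+YXu)&Y^2u\end{pmatrix}$. A locally bounded upper (resp. lower) semicontinuous function $u:\mathbb{H}\to\mathbb{R}$ is a viscosity subsolution (resp. supersolution) of $( * )$ if whenever $\varphi\in C^2(\mathbb{H})$ and $u-\varphi$ attains a maximum (resp. minimum) in $\mathbb{H}$ at $p_0$, one has $F(p_0,u(p_0),\nabla_H\varphi(p_0),(\nabla_H^2\varphi)^\star(p_0))\le0$ (resp. $\ge0$). A viscosity solution is a continuous function that is both a subsolution and a supersolution. The comparison principle for $( * )$ states that any subsolution $u$ and any supersolution $v$ of $( * )$ satisfy $u\le v$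 in $\mathbb{H}$. *)

(* Defs.v *)
From HB Require Import structures.
From mathcomp Require Import all_boot all_order all_algebra.
From mathcomp Require Import all_classical all_reals all_analysis.
Set Implicit Arguments.
Unset Strict Implicit.
Unset Printing Implicit Defensive.
Import Order.TTheory GRing.Theory Num.Theory.
Import numFieldNormedType.Exports.

Local Open Scope classical_set_scope.
Local Open Scope ring_scope.

(* A point p = (x, y, z) of the Heisenberg group is a row vector with
   x = p 0 0, y = p 0 1 and z = p 0 2; the topology of 'rV[R]_3 is the usual one,
   but its library norm `|p| is the sup norm, hence the following. *)
Definition euclid_norm (R : realType) (p : 'rV[R]_3) : R :=
  Num.sqrt (\sum_(i < 3) p 0 i ^+ 2).

Definition partial (R : realType) (i : 'I_3) (f : 'rV[R]_3 -> R) : 'rV[R]_3 -> R :=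
  fun p => 'D_(delta_mx 0 i) f p.

Fixpoint class_C (R : realType) (k : nat) (f : 'rV[R]_3 -> R) : Prop :=
  continuous f /\
  if k is k'.+1 then
    forall i : 'I_3, (forall p, derivable f p (delta_mx 0 i)) /\
                     class_C k' (partial i f)
  else True.

Definition vfX (R : realType) (f : 'rV[R]_3 -> R) : 'rV[R]_3 -> R :=
  fun p => partial 0 f p - p 0 1 / 2 * partial 2 f p.

Definition vfY (R : realType) (f : 'rV[R]_3 -> R) : 'rV[R]_3 -> R :=
  fun p => partial 1 f p + p 0 0 / 2 * partial 2 f p.

Definition hgrad (R : realType) (f : 'rV[R]_3 -> R) (p : 'rV[R]_3) : 'rV[R]_2 :=
  \row_(j < 2) if j == 0 then vfX f p else vfY f p.

Definition hhess (R : realType) (f : 'rV[R]_3 -> R) (p : 'rV[R]_3) : 'M[R]_2 :=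
  \matrix_(i < 2, j < 2)
    if i != j then (vfX (vfY f) p + vfY (vfX f) p) / 2
    else if i == 0 then vfX (vfX f) p else vfY (vfY f) p.

Definition sym_mx (R : realType) (A : 'M[R]_2) : Prop := A^T = A.

Definition mx_ge (R : realType) (A B : 'M[R]_2) : Prop :=
  forall v : 'rV[R]_2, 0 <= (v *m (A - B) *m v^T) 0 0.

(* Only the values of an operator F on symmetric matrices are meaningful: every
   condition on F below is restricted to them, and hhess f p is symmetric. *)
Definition operator (R : realType) : Type :=
  'rV[R]_3 -> R -> 'rV[R]_2 -> 'M[R]_2 -> R.

Definition operator_continuous (R : realType) (F : operator R) : Prop :=
  {within [set q : 'rV[R]_3 * R * 'rV[R]_2 * 'M[R]_2 | sym_mx q.2],
    continuous (fun q : 'rV[R]_3 * R * 'rV[R]_2 * 'M[R]_2 =>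
                  F q.1.1.1 q.1.1.2 q.1.2 q.2)}.

Definition degenerate_elliptic (R : realType) (F : operator R) : Prop :=
  forall p r xi A1 A2, sym_mx A1 -> sym_mx A2 -> mx_ge A1 A2 ->
    F p r xi A1 <= F p r xi A2.

Definition monotone_in_r (R : realType) (F : operator R) : Prop :=
  forall p r1 r2 xi A, sym_mx A -> r2 <= r1 -> F p r2 xi A <= F p r1 xi A.

Definition operator_concave (R : realType) (F : operator R) : Prop :=
  forall (k : nat) (c : 'I_k -> R) (p : 'I_k -> 'rV[R]_3) (r : 'I_k -> R)
         (xi : 'I_k -> 'rV[R]_2) (A : 'I_k -> 'M[R]_2),
    (forall i, 0 <= c i <= 1) -> \sum_(i < k) c i = 1 ->
    (forall i, sym_mx (A i)) ->
    \sum_(i < k) c i * F (p i) (r i) (xi i) (A i) <=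
    F (\sum_(i < k) c i *: p i) (\sum_(i < k) c i * r i)
      (\sum_(i < k) c i *: xi i) (\sum_(i < k) c i *: A i).

Definition locally_bounded (R : realType) (u : 'rV[R]_3 -> R) : Prop :=
  forall p : 'rV[R]_3, bounded_near u (nbhs p).

Definition lsc (R : realType) (u : 'rV[R]_3 -> R) : Prop :=
  lower_semicontinuous (fun p => (u p)%:E).

Definition usc (R : realType) (u : 'rV[R]_3 -> R) : Prop :=
  lsc (fun p => - u p).

Definition viscosity_subsolution (R : realType) (F : operator R)
    (u : 'rV[R]_3 -> R) : Prop :=
  [/\ locally_bounded u, usc u &
      forall (phi : 'rV[R]_3 -> R) (p0 : 'rV[R]_3), class_C 2 phi ->
        (forall p, u p - phi p <= u p0 - phi p0) ->
        F p0 (u p0) (hgrad phi p0) (hhess phi p0) <= 0].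

Definition viscosity_supersolution (R : realType) (F : operator R)
    (u : 'rV[R]_3 -> R) : Prop :=
  [/\ locally_bounded u, lsc u &
      forall (phi : 'rV[R]_3 -> R) (p0 : 'rV[R]_3), class_C 2 phi ->
        (forall p, u p0 - phi p0 <= u p - phi p) ->
        0 <= F p0 (u p0) (hgrad phi p0) (hhess phi p0)].

Definition viscosity_solution (R : realType) (F : operator R)
    (u : 'rV[R]_3 -> R) : Prop :=
  [/\ continuous u, viscosity_subsolution F u & viscosity_supersolution F u].

Definition comparison_principle (R : realType) (F : operator R) : Prop :=
  forall u v : 'rV[R]_3 -> R,
    viscosity_subsolution F u -> viscosity_supersolution F v ->
    forall p, u p <= v p.

Definition coercive (R : realType) (u : 'rV[R]_3 -> R) : Prop :=
  ereal_inf [set (u p / euclid_norm p)%:E | p in [set p | rho <= euclid_norm p]]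
    @[rho --> +oo] --> +oo%E.

(* The real infimum is used, so that the envelope is real valued; it is the true
   infimum when u is bounded below, in particular when u is coercive and locally
   bounded. *)
Definition convex_envelope (R : realType) (u : 'rV[R]_3 -> R)
    (p : 'rV[R]_3) : R :=
  inf [set s | exists (c : 'I_4 -> R) (q : 'I_4 -> 'rV[R]_3),
         [/\ forall i, 0 <= c i <= 1, \sum_(i < 4) c i = 1,
             \sum_(i < 4) c i *: q i = p & s = \sum_(i < 4) c i * u (q i)]].

(* Main.v *)
Require Import Defs.
From HB Require Import structures.
From mathcomp Require Import all_boot all_order all_algebra.
From mathcomp Require Import all_classical all_reals all_analysis.
From mathcomp Require Import ring lra.
Import Order.TTheory GRing.Theory Num.Theory.
Import numFieldNormedType.Exports.

(* For a finite concave F, a supersolution of F >= 0 is a supersolution of every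
   affine majorant L of F; choosing L tangent to F at the point where a test
   function touches the envelope reduces the first claim to the linear, left-invariant
   operator L. There Ishii's lemma is replaced by duality: let K average over short
   right translations (random-walk steps along the horizontal fields occurring in L)
   and let v solve v - lambda (K - 1) v / s^2 = phi with phi smooth below
   (1 - lambda c) u - lambda f. Then v is smooth, so it can be tested against u and
   lies below u up to a small error. Right translations are affine maps of R^3, hence
   commute with convex combinations: the discrete minimum principle applied to
   sum_i c_i v(q_i) - Psi(sum_i c_i q_i), for a test function Psi violating L at the
   touching point, bounds this expression below by a positive constant, which
   contradicts that sum_i c_i u(p_i) is almost the envelope at that point.

   For the second claim, comparison without growth condition is so strong that it
   forces F to depend on (p, r) only: otherwise some affine majorant of F has a first-
   or second-order part, and it has smooth subsolutions that are arbitrarily large at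
   a given point. Then subsolutions may be raised, and supersolutions lowered, at a
   single point, and concavity of F makes t w(x) + (1 - t) w(y) an admissible
   lowered value at t x + (1 - t) y. *)

Set Implicit Arguments.
Unset Strict Implicit.
Unset Printing Implicit Defensive.

Local Open Scope classical_set_scope.
Local Open Scope ring_scope.

Section Calculus.
Variable R : realType.
Implicit Types (f g : 'rV[R]_3 -> R) (p q w x y : 'rV[R]_3) (b : R -> R).

Lemma continuous_eps (V : normedModType R) (f : V -> R) (q : V) (e : R) :
  {for q, continuous f} -> 0 < e ->
  exists2 d, 0 < d & forall y : V, `|y - q| < d -> `|f y - f q| < e.
Proof.
move=> cf e0; move/cvgrPdist_lt : cf => /(_ e e0) /nbhs_normP[d /= d0 H].
exists d => // y yd; rewrite distrC; apply: H => /=.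
by rewrite distrC.
Qed.

Lemma is_derive_eps b (a l : R) :
  (forall e : R, 0 < e -> exists2 d : R, 0 < d &
    forall h, h != 0 -> `|h| < d -> `|b (a + h) - b a - h * l| <= e * `|h|) ->
  is_derive a (1 : R) b l.
Proof.
move=> H.
have : h^-1 *: ((b \o shift a) (h *: (1:R)) - b a) @[h --> 0^'] --> l.
  apply/cvgrPdist_le => e e0; have [d d0 Hd] := H e e0.
  apply/nbhs_ballP; exists d => //= h; rewrite /ball /= sub0r normrN => hd h0.
  rewrite /= [h *: 1]mulr1 [h + a]addrC -(ler_pM2r (x := `|h|)) ?normr_gt0//.
  have := Hd h h0 hd; congr (_ <= _); rewrite -normrM distrC; congr `|_|.
  by rewrite /GRing.scale /=; field.
by move=> /[dup] /cvgP dl /cvg_lim <- //; exact: derivableP.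
Qed.

Lemma eps_is_derive b (a l : R) : is_derive a (1 : R) b l ->
  forall e : R, 0 < e -> exists2 d : R, 0 < d &
    forall h, `|h| < d -> `|b (a + h) - b a - h * l| <= e * `|h|.
Proof.
move=> [db <-] e e0.
move: db; rewrite /derivable => /cvgrPdist_le/(_ e e0) /nbhs_ballP[d /= d0 H].
exists d => // h hd; have [->|h0] := eqVneq h 0.
  by rewrite addr0 subrr mul0r subrr normr0 mulr0.
have := H h; rewrite /ball /= sub0r normrN => /(_ hd h0).
rewrite /= [h *: 1]mulr1 [h + a]addrC -(ler_pM2r (x := `|h|)) ?normr_gt0//.
congr (_ <= _); rewrite -normrM distrC; congr `|_|.
rewrite /derive; set D := lim _; rewrite /GRing.scale /=; field.
by [].
Qed.

Definition d1 f p w : R := \sum_(i < 3) w 0 i * partial i f p.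
Definition d2 f p w : R :=
  \sum_(i < 3) \sum_(j < 3) w 0 i * w 0 j * partial j (partial i f) p.

Lemma delta_sum w : w = w 0 0 *: delta_mx 0 0 + w 0 1 *: delta_mx 0 1
                        + w 0 2 *: delta_mx 0 2.
Proof.
by rewrite {1}(row_sum_delta w) !big_ord_recl big_ord0 addr0 !addrA; congr (_ + _ *: _ + _ *: _);
  do ?[congr (w _ _) | congr (delta_mx _ _)]; apply: val_inj.
Qed.

Lemma is_derive_partial f i x : (forall p, derivable f p (delta_mx 0 i)) ->
  forall t : R, is_derive t (1 : R) (fun t => f (x + t *: delta_mx 0 i))
    (partial i f (x + t *: delta_mx 0 i)).
Proof.
move=> df t; set q := x + _.
have [+] : is_derive q (delta_mx 0 i) f (partial i f q) by exact: derivableP.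
rewrite /derivable => H E; apply: is_derive_eps => e e0.
move/cvgrPdist_le : H => /(_ e e0) /nbhs_ballP[d /= d0 H].
exists d => // h h0 hd; have := H h; rewrite /ball /= sub0r normrN => /(_ hd h0).
rewrite -[X in `|X - _|]/(derive f q (delta_mx 0 i)) E.
rewrite -(ler_pM2r (x := `|h|)) ?normr_gt0//.
have -> : h *: delta_mx 0 i + q = x + (t + h) *: delta_mx 0 i.
  by rewrite /q scalerDl addrC addrA.
congr (_ <= _); rewrite -normrM distrC; congr `|_|.
by rewrite /GRing.scale /=; field.
Qed.

Lemma mvt_partial f i x (t : R) : (forall p, derivable f p (delta_mx 0 i)) ->
  exists2 c : R, `|c| <= `|t| &
    f (x + t *: delta_mx 0 i) - f x = t * partial i f (x + c *: delta_mx 0 i).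
Proof.
move=> df; have D := is_derive_partial x df.
have C : forall A : set R, {within A, continuous (fun t => f (x + t *: delta_mx 0 i))}.
  move=> A; apply: continuous_subspaceT => z.
  by apply/differentiable_continuous/derivable1_diffP; case: (D z).
case: (leP 0 t) => t0.
  have [c] := MVT_segment t0 (fun z _ => D z) (C _).
  rewrite in_itv /= scale0r addr0 subr0 => /andP[c0 ct] E.
  by exists c; rewrite ?ger0_norm// E mulrC.
have [c] := MVT_segment (ltW t0) (fun z _ => D z) (C _).
rewrite in_itv /= scale0r addr0 sub0r => /andP[ct c0] E.
exists c; first by rewrite !ler0_norm ?lerN2 // ltW.
by rewrite -opprB E; ring.
Qed.

Lemma ler_mxnorm (n : nat) (w : 'rV[R]_n) i : `|w 0 i| <= `|w|.
Proof.
rewrite [leRHS]/Num.norm /= mx_normrE.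
by apply/bigmax_geP; right => /=; exists (0, i).
Qed.

Lemma mxnorm_le (n : nat) (w : 'rV[R]_n) (e : R) :
  0 <= e -> (forall i, `|w 0 i| <= e) -> `|w| <= e.
Proof.
move=> e0 H; rewrite [leLHS]/Num.norm /= mx_normrE; apply: bigmax_le => //=.
by case=> i j _ /=; rewrite ord1.
Qed.

Lemma norm_delta (i : 'I_3) : `|delta_mx 0 i : 'rV[R]_3| <= 1.
Proof.
apply: mxnorm_le => // j; rewrite mxE eqxx /=.
by case: eqP; rewrite ?normr1 ?normr0.
Qed.

Lemma norm_scale_delta (c : R) (i : 'I_3) : `|c *: delta_mx 0 i : 'rV[R]_3| <= `|c|.
Proof. by rewrite normrZ ler_piMr ?norm_delta. Qed.

Lemma class_C1_partial f i p : class_C 1 f -> derivable f p (delta_mx 0 i).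
Proof. by case=> _ /(_ i)[]. Qed.

Lemma class_C_cont k f : class_C k f -> continuous f.
Proof. by case: k => [|k] []. Qed.

Lemma class_C_partial k f i : class_C k.+1 f -> class_C k (partial i f).
Proof. by case=> _ /(_ i)[]. Qed.

Lemma class_CS k f : class_C k.+1 f -> class_C k f.
Proof.
elim: k f => [|k IH] f [cf H]; split => // i; have [di Ci] := H i; split => //.
exact: IH.
Qed.

Lemma class_C1_diff f p (e : R) : class_C 1 f -> 0 < e ->
  exists2 d : R, 0 < d & forall w, `|w| < d ->
    `|f (p + w) - f p - d1 f p w| <= e * `|w|.
Proof.
move=> C1 e0; have e3 : 0 < e / 3 by lra.
have H i : exists2 d, 0 < d & forall y, `|y - p| < d ->
    `|partial i f y - partial i f p| < e / 3.
  by apply: continuous_eps => //; exact: (class_C_cont (class_C_partial i C1)).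
have [a0 a00 H0] := H 0; have [a1 a10 H1] := H 1; have [a2 a20 H2] := H 2.
pose d := Num.min a0 (Num.min a1 a2) / 3.
have m0 : 0 < Num.min a0 (Num.min a1 a2) by rewrite !lt_min a00 a10.
exists d; first by rewrite divr_gt0.
move=> w wd.
have wd3 : 3 * `|w| < Num.min a0 (Num.min a1 a2) by move: wd; rewrite /d; lra.
move: wd3; rewrite !lt_min => /and3P[w0 w1 w2].
set e0' := w 0 0 *: delta_mx 0 0 : 'rV[R]_3.
set e1' := w 0 1 *: delta_mx 0 1 : 'rV[R]_3.
set e2' := w 0 2 *: delta_mx 0 2 : 'rV[R]_3.
have N0 : `|e0'| <= `|w| by apply: le_trans (norm_scale_delta _ _) (ler_mxnorm _ _).
have N1 : `|e1'| <= `|w| by apply: le_trans (norm_scale_delta _ _) (ler_mxnorm _ _).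
have Ni (c : R) (i : 'I_3) : `|c| <= `|w 0 i| -> `|c *: delta_mx 0 i : 'rV[R]_3| <= `|w|.
  by move=> h; apply: le_trans (norm_scale_delta _ _) (le_trans h (ler_mxnorm _ _)).
have step (i : 'I_3) y (a : R) : 0 < a -> 3 * `|w| < a -> `|y| <= 2 * `|w| ->
    (forall z, `|z - p| < a -> `|partial i f z - partial i f p| < e / 3) ->
    exists2 P, f (p + y + w 0 i *: delta_mx 0 i) - f (p + y) = w 0 i * P
             & `|w 0 i * (P - partial i f p)| <= `|w| * (e / 3).
  move=> a_gt0 wa yw Ha.
  have [c cw E] := @mvt_partial f i (p + y) (w 0 i) (fun q => @class_C1_partial _ i q C1).
  exists (partial i f (p + y + c *: delta_mx 0 i)) => //.
  rewrite normrM ler_pM ?ler_mxnorm // ltW // Ha //.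
  rewrite -[p + y + _]addrA addrAC subrr add0r; apply: le_lt_trans (ler_normD _ _) _.
  by have := Ni c i cw; move: wa yw; clear; lra.
have [] := step 0 0 a0 a00 w0 _ H0; first by rewrite normr0 mulr_ge0.
rewrite addr0 -/e0' => P0 E0 L0.
have [] := step 1 e0' a1 a10 w1 _ H1.
  by apply: le_trans N0 _; rewrite ler_peMl // ler1n.
rewrite -/e1' -addrA => P1 E1 L1.
have [] := step 2 (e0' + e1') a2 a20 w2 _ H2.
  by apply: le_trans (ler_normD _ _) _; rewrite mulr_natl mulr2n lerD.
rewrite -/e2' -addrA -delta_sum => P2 E2 L2.
have -> : f (p + w) - f p - d1 f p w = w 0 0 * (P0 - partial 0 f p)
  + w 0 1 * (P1 - partial 1 f p) + w 0 2 * (P2 - partial 2 f p).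
  rewrite /d1 !big_ord_recl big_ord0.
  rewrite (_ : lift ord0 ord0 = 1); last exact: val_inj.
  rewrite (_ : lift ord0 (lift ord0 ord0) = 2); last exact: val_inj.
  rewrite (_ : ord0 = 0); last exact: val_inj.
  rewrite !mulrBr -E0 -E1 -E2.
  move: (f (p + w)) (f (p + (e0' + e1'))) (f (p + e0')) (f p).
  move: (partial 0 f p) (partial 1 f p) (partial 2 f p) (w 0 0) (w 0 1) (w 0 2).
  by clear => *; ring.
have -> : e * `|w| = `|w| * (e / 3) + `|w| * (e / 3) + `|w| * (e / 3).
  by move: (`|w|); clear => ?; field.
apply: le_trans (ler_normD _ _) (lerD _ L2).
exact: le_trans (ler_normD _ _) (lerD L0 L1).
Qed.


Lemma d1Z f p w (a : R) : d1 f p (a *: w) = a * d1 f p w.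
Proof. by rewrite /d1 mulr_sumr; apply: eq_bigr => i _; rewrite mxE mulrA. Qed.

Lemma d1_line f p w (t : R) : class_C 1 f ->
  is_derive t (1 : R) (fun t => f (p + t *: w)) (d1 f (p + t *: w) w).
Proof.
move=> C1; set q := p + t *: w; apply: is_derive_eps => e e0.
have n1 : 0 < `|w| + 1 by rewrite ltr_wpDl.
have [d d0 H] := class_C1_diff q C1 (divr_gt0 e0 n1).
exists (d / (`|w| + 1)); first exact: divr_gt0.
move=> h _ hd; have -> : p + (t + h) *: w = q + h *: w by rewrite scalerDl addrA.
have hw : `|h *: w| <= `|h| * (`|w| + 1) by rewrite normrZ ler_wpM2l // lerDl.
rewrite -d1Z; apply: le_trans (H _ _) _.
  by apply: le_lt_trans hw _; rewrite -ltr_pdivlMr.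
by rewrite mulrAC ler_pdivrMr // -mulrA ler_wpM2l // ltW.
Qed.

Lemma d2_line f p w (t : R) : class_C 2 f ->
  is_derive t (1 : R) (fun t => d1 f (p + t *: w) w) (d2 f (p + t *: w) w).
Proof.
move=> C2; rewrite /d2 /d1.
set q := p + _.
have H (i : 'I_3) : is_derive t (1 : R) (w 0 i \*: (fun t => partial i f (p + t *: w)))
    (w 0 i *: d1 (partial i f) q w).
  by apply: is_deriveZ; apply: d1_line; apply: class_C_partial.
have := is_derive_sum H.
rewrite (_ : \sum_(i < 3) _ = fun t => \sum_(i < 3) w 0 i * partial i f (p + t *: w)).
  move=> K; apply: is_derive_eq K _; apply: eq_bigr => i _.
  rewrite /GRing.scale /= /d1 mulr_sumr; apply: eq_bigr => j _; by rewrite mulrA.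
by apply/funext => s; rewrite fct_sumE.
Qed.

Lemma rolle_derive b (db : R -> R) (a c : R) : a < c ->
  (forall t, is_derive t (1 : R) b (db t)) -> b a = b c ->
  exists2 t, a < t < c & db t = 0.
Proof.
move=> ac Db bac.
have der t : derivable b t 1 by case: (Db t).
have cb : {within `[a, c], continuous b}.
  apply: continuous_subspaceT => t.
  exact/differentiable_continuous/derivable1_diffP.
have [t tac [_ Dt]] := Rolle ac (fun t _ => der t) cb bac.
exists t; first by move: tac; rewrite in_itv.
by case: (Db t) => _ <-.
Qed.

Lemma taylor2 f p w : class_C 2 f ->
  exists2 c : R, 0 < c < 1 & f (p + w) = f p + d1 f p w + d2 f (p + c *: w) w / 2.
Proof.
move=> C2; have C1 := class_CS C2.
pose A := f (p + w) - f p - d1 f p w.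
pose b t := f (p + t *: w) - (t * d1 f p w + t ^+ 2 * A).
pose db t := d1 f (p + t *: w) w - (d1 f p w + 2 * t * A).
have Db t : is_derive t (1 : R) b (db t).
  apply: is_deriveB; first exact: d1_line.
  have : is_derive t (1 : R) (fun t : R => t * d1 f p w) (d1 f p w).
    apply: is_derive_eq; by rewrite /GRing.scale /=; ring.
  have : is_derive t (1 : R) (fun t : R => t ^+ 2 * A) (2 * t * A).
    apply: is_derive_eq; by rewrite /GRing.scale /=; ring.
  by move=> *; exact: is_deriveD.
have Ddb t : is_derive t (1 : R) db (d2 f (p + t *: w) w - 2 * A).
  apply: is_deriveB; first exact: d2_line.
  have : is_derive t (1 : R) (fun t : R => 2 * t * A) (2 * A).
    apply: is_derive_eq; by rewrite /GRing.scale /=; ring.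
  move=> D; rewrite -[2 * A]add0r; exact: is_deriveD.
have [|c1 /andP[c10 c11] E1] := @rolle_derive b db 0 1 ltr01 Db.
  rewrite /b scale0r scale1r addr0 /A.
  move: (f p) (f (p + w)) (d1 f p w) => *; ring.
have [|c2 /andP[c20 c21] E2] := @rolle_derive db _ 0 c1 c10 Ddb.
  rewrite E1 /db scale0r addr0; ring.
exists c2; first by rewrite c20 (lt_trans c21).
move/eqP : E2; rewrite subr_eq0 => /eqP ->; rewrite /A.
by move: (f p) (f (p + w)) (d1 f p w) => *; field.
Qed.

Lemma partial_val f p i l :
  is_derive 0 (1 : R) (fun t => f (p + t *: delta_mx 0 i)) l ->
  derivable f p (delta_mx 0 i) /\ partial i f p = l.
Proof.
move=> [+ <-].
rewrite /partial /derivable /derive.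
set h1 := fun h => _; set h2 := fun h => h^-1 *: _.
have -> : h1 = h2; last by [].
apply/funext => h; rewrite /h1 /h2 /= addr0 scale0r addr0.
by rewrite [h *: 1]mulr1 [h *: _ + p]addrC.
Qed.

Lemma class_C_S k f (df : 'I_3 -> 'rV[R]_3 -> R) : continuous f ->
  (forall i p, is_derive 0 (1 : R) (fun t => f (p + t *: delta_mx 0 i)) (df i p)) ->
  (forall i, class_C k (df i)) -> class_C k.+1 f.
Proof.
move=> cf D C; split => // i; split=> [p|]; first by case: (partial_val (D i p)).
rewrite (_ : partial i f = df i) //; apply/funext => p.
by case: (partial_val (D i p)).
Qed.

Lemma class_C_cst k (c : R) : class_C k (fun _ : 'rV[R]_3 => c).
Proof.
elim: k c => [|k IH] c; first by split => //; exact: cst_continuous.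
apply: (@class_C_S _ _ (fun _ _ => 0)) => [|i p|_]; [exact: cst_continuous|exact: is_derive_cst|exact: IH].
Qed.

Lemma partial_line f p i : class_C 1 f ->
  is_derive 0 (1 : R) (fun t => f (p + t *: delta_mx 0 i)) (partial i f p).
Proof.
move=> C1; have := is_derive_partial p (fun q => @class_C1_partial f i q C1) 0.
by rewrite scale0r addr0.
Qed.

Lemma class_C_1 k f : class_C k.+1 f -> class_C 1 f.
Proof. by elim: k => // k IH /class_CS. Qed.

Lemma class_CD k f g : class_C k f -> class_C k g -> class_C k (fun p => f p + g p).
Proof.
elim: k f g => [|k IH] f g Cf Cg.
  by split => // x; apply: continuousD; [exact: (class_C_cont Cf)|exact: (class_C_cont Cg)].
apply: (@class_C_S _ _ (fun i p => partial i f p + partial i g p)).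
- by move=> x; apply: continuousD; [exact: (class_C_cont Cf)|exact: (class_C_cont Cg)].
- by move=> i p; apply: is_deriveD; apply: partial_line; apply: class_C_1; eassumption.
- by move=> i; apply: IH; exact: class_C_partial.
Qed.

Lemma class_CM k f g : class_C k f -> class_C k g -> class_C k (fun p => f p * g p).
Proof.
elim: k f g => [|k IH] f g Cf Cg.
  by split => // x; apply: continuousM; [exact: (class_C_cont Cf)|exact: (class_C_cont Cg)].
apply: (@class_C_S _ _ (fun i p => f p * partial i g p + g p * partial i f p)).
- by move=> x; apply: continuousM; [exact: (class_C_cont Cf)|exact: (class_C_cont Cg)].
- move=> i p.
  have Df := partial_line p i (class_C_1 Cf); have Dg := partial_line p i (class_C_1 Cg).
  by apply: is_derive_eq (is_deriveM Df Dg) _; rewrite scale0r addr0.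
- by move=> i; apply: class_CD; apply: IH; solve [exact: class_CS | exact: class_C_partial].
Qed.

Lemma class_CZ k f (c : R) : class_C k f -> class_C k (fun p => c * f p).
Proof. by apply: class_CM; exact: class_C_cst. Qed.

Lemma class_CN k f : class_C k f -> class_C k (fun p => - f p).
Proof.
move=> /(class_CZ (-1)); congr class_C; by apply/funext => p; rewrite mulN1r.
Qed.

Lemma class_CB k f g : class_C k f -> class_C k g -> class_C k (fun p => f p - g p).
Proof. by move=> Cf /class_CN; exact: class_CD. Qed.

Lemma class_C_sum k (I : Type) (r : seq I) (F : I -> 'rV[R]_3 -> R) :
  (forall i, class_C k (F i)) -> class_C k (fun p => \sum_(i <- r) F i p).
Proof.
move=> C; elim: r => [|i r IH].
  by under eq_fun do rewrite big_nil; exact: class_C_cst.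
by under eq_fun do rewrite big_cons; exact: class_CD.
Qed.

Lemma continuous_coord (n : nat) (j : 'I_n) : continuous (fun p : 'rV[R]_n => p 0 j).
Proof. by move=> p; exact: coord_continuous. Qed.

Lemma class_C_coord k (j : 'I_3) : class_C k (fun p : 'rV[R]_3 => p 0 j).
Proof.
case: k => [|k]; first by split => //; exact: continuous_coord.
apply: (@class_C_S _ _ (fun i _ => (i == j)%:R)); first exact: continuous_coord.
  move=> i p.
  have -> : (fun t : R => (p + t *: delta_mx 0 i) 0 j) = fun t => p 0 j + t * (i == j)%:R.
    by apply/funext => t /=; rewrite !mxE eqxx /= eq_sym.
  by apply: is_derive_eq; rewrite /GRing.scale /=; ring.
by move=> i; exact: class_C_cst.
Qed.

Lemma class_C_comp k (b : nat -> R -> R) f :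
  (forall n t, (n < k)%N -> is_derive t (1 : R) (b n) (b n.+1 t)) -> continuous (b k) ->
  class_C k f -> class_C k (fun p => b 0%N (f p)).
Proof.
elim: k b f => [|k IH] b f D bk C.
  split => // p.
  by apply: (@continuous_comp _ _ _ f (b 0%N)); [exact: (class_C_cont C)|exact: bk].
have cb : continuous (b 0%N).
  by move=> t; apply/differentiable_continuous/derivable1_diffP; case: (D 0%N t).
apply: (@class_C_S _ _ (fun i p => partial i f p * b 1%N (f p))).
- move=> p.
  by apply: (@continuous_comp _ _ _ f (b 0%N)); [exact: (class_C_cont C)|exact: cb].
- move=> i p.
  have D1 := partial_line p i (class_C_1 C).
  have D0 := D 0%N (f (p + 0 *: delta_mx 0 i)) isT.
  have := @is_derive1_comp R (b 0%N) (fun t : R => f (p + t *: delta_mx 0 i)) 0 _ _ D0 D1.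
  by rewrite scale0r addr0 mulrC.
- move=> i; apply: class_CM; first exact: class_C_partial.
  by apply: (IH (fun n => b n.+1)); [move=> n t nk; exact: D|exact: bk|exact: class_CS].
Qed.

Lemma class_C_comp_affine k f (A L : 'rV[R]_3 -> 'rV[R]_3) :
  continuous A -> (forall p (t : R) w, A (p + t *: w) = A p + t *: L w) ->
  class_C k f -> class_C k (f \o A).
Proof.
move=> cA AL; elim: k f => [|k IH] f C.
  by split => // x; apply: continuous_comp; [exact: cA|exact: (class_C_cont C)].
apply: (@class_C_S _ _ (fun i p => d1 f (A p) (L (delta_mx 0 i)))).
- by move=> x; apply: continuous_comp; [exact: cA|exact: (class_C_cont C)].
- move=> i p; have := d1_line (A p) (L (delta_mx 0 i)) 0 (class_C_1 C).
  by rewrite scale0r addr0; under eq_fun do rewrite -AL.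
- move=> i; rewrite /d1; apply: class_C_sum => j; apply: class_CZ.
  by apply: IH; exact: class_C_partial.
Qed.

End Calculus.

Section Compactness.
Variable R : realType.
Implicit Types (f u : 'rV[R]_3 -> R) (p q w x y : 'rV[R]_3).

Lemma fin_delta (T : finType) (P : T -> R -> Prop) :
  (forall t a b, 0 < b -> b <= a -> P t a -> P t b) ->
  (forall t, exists2 d, 0 < d & P t d) -> exists2 d, 0 < d & forall t, P t d.
Proof.
move=> mono H; suff [d d0 Hd] : exists2 d, 0 < d & forall t, t \in enum T -> P t d.
  by exists d => // t; apply: Hd; rewrite mem_enum.
elim: (enum T) => [|a s [d d0 Hd]]; first by exists 1.
have [e e0 He] := H a; exists (Num.min d e); first by rewrite lt_min d0.
move=> t; rewrite inE => /orP[/eqP ->|ts].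
  by apply: mono He; rewrite ?lt_min ?d0 // ge_min lexx orbT.
by apply: mono (Hd t ts); rewrite ?lt_min ?d0 // ge_min lexx.
Qed.

Lemma nbhs_norm_sub (V : normedModType R) (x : V) (d : R) :
  0 < d -> nbhs x [set y : V | `|y - x| < d].
Proof. by move=> d0; apply/nbhs_normP; exists d => //= y /=; rewrite distrC. Qed.

Lemma nbhs_norm_ex (V : normedModType R) (x : V) (A : set V) :
  nbhs x A -> exists2 d : R, 0 < d & forall y : V, `|y - x| < d -> A y.
Proof.
by move=> /nbhs_normP[d /= d0 H]; exists d => // y yd; apply: H => /=; rewrite distrC.
Qed.

Lemma ball_cover (rho : R) (P : R -> 'rV[R]_3 -> Prop) :
  (forall a b x, 0 < b -> b <= a -> P a x -> P b x) ->
  (forall x, `|x| <= rho -> exists2 d, 0 < d & forall y, `|y - x| < d -> P d y) ->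
  exists2 d, 0 < d & forall x, `|x| <= rho -> P d x.
Proof.
move=> mono H.
have cK : compact [set x : 'rV[R]_3 | `|x| <= rho].
  apply: bounded_closed_compact.
    exists rho; split; first exact: num_real.
    by move=> M rM x /= xr; exact: le_trans xr (ltW rM).
  have := @preimage_closed _ _ (fun x : 'rV[R]_3 => `|x|) [set z : R | z <= rho].
  by apply; [move=> z _; exact: norm_continuous|exact: closed_le].
have := (compact_near_coveringP _).1 cK R (0 : R)^'+ P _.
case=> [x /= /H[d d0 Hd]|d /= d0 Hd].
  exists ([set y | `|y - x| < d], [set e | 0 < e < d]) => /=.
    split.
      exact: nbhs_norm_sub.
    near=> e; apply/andP; split; near: e; [exact: nbhs_right_gt|exact: nbhs_right_lt].
  by move=> [y e] /= [yd /andP[e0 ed]]; apply: mono (Hd y yd) => //; exact: ltW.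
exists (d / 2); first by rewrite divr_gt0.
move=> x xr; apply: (Hd (d / 2)) => //=; last by rewrite divr_gt0.
by rewrite sub0r normrN gtr0_norm ?divr_gt0// gtr_pMr // invf_lt1 // ltr1n.
Unshelve. all: by end_near. Qed.

Lemma unif_on_ball f (rho e : R) : continuous f -> 0 < e ->
  exists2 d, 0 < d & forall x y, `|x| <= rho -> `|y - x| < d -> `|f y - f x| < e.
Proof.
move=> cf e0.
have [||d d0 H] := @ball_cover rho
  (fun d x => forall y, `|y - x| < d -> `|f y - f x| < e).
- by move=> a b x b0 ba H y yb; apply: H; exact: lt_le_trans yb ba.
- move=> x _; have [d d0 Hd] := continuous_eps (cf x) (divr_gt0 e0 (ltr0n _ 2)).
  exists (d / 2); first by rewrite divr_gt0.
  move=> y yd z zy.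
  have h1 : `|f y - f x| < e / 2.
    by apply: Hd; apply: lt_trans yd _; rewrite gtr_pMr // invf_lt1 // ltr1n.
  have h2 : `|f z - f x| < e / 2.
    apply: Hd; rewrite -(subrKA y) (splitr d).
    by apply: le_lt_trans (ler_normD _ _) (ltrD zy yd).
  rewrite -(subrKA (f x)) (splitr e); apply: le_lt_trans (ler_normD _ _) _.
  by rewrite ltrD // distrC.
by exists d => // x y xr; apply: H.
Qed.

Lemma unif_cst_outside f (rho m e : R) : continuous f ->
  (forall p, rho < `|p| -> f p = m) -> 0 < e ->
  exists2 d, 0 < d & forall x y, `|y - x| < d -> `|f y - f x| < e.
Proof.
move=> cf fm e0; have [d d0 H] := unif_on_ball (rho + 1) cf e0.
exists (Num.min d 1); first by rewrite lt_min d0 /=.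
move=> x y; rewrite lt_min => /andP[yd y1].
have [xr|xr] := leP `|x| (rho + 1); first exact: H.
rewrite !fm ?subrr ?normr0 //; first by apply: lt_trans xr; rewrite ltrDl.
have : `|x| <= `|y| + `|y - x|.
  by rewrite -{1}[x](subKr y); exact: ler_normB.
by move: xr y1; move: (`|x|) (`|y|) (`|y - x|); clear=> *; lra.
Qed.

Lemma bounded_on_ball u (rho : R) : locally_bounded u ->
  exists2 C, 0 < C & forall x, `|x| <= rho -> `|u x| <= C.
Proof.
move=> lu.
have [||d d0 H] := @ball_cover rho (fun d x => `|u x| <= d^-1).
- by move=> a b x b0 ba H; apply: le_trans H _; rewrite lef_pV2 // posrE (lt_le_trans b0).
- move=> x _; have := lu x; rewrite /bounded_near => -[M [_ HM]].
  have M1 : M < Num.max M 0 + 1 by rewrite (le_lt_trans (y := Num.max M 0)) ?ltrDl// le_max lexx.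
  have [d d0 Hd] := nbhs_norm_ex (HM _ M1).
  have m0 : 0 < Num.max M 0 + 1 by rewrite (le_lt_trans (y := Num.max M 0)) ?ltrDl// le_max lexx orbT.
  exists (Num.min d (Num.max M 0 + 1)^-1); first by rewrite lt_min d0 invr_gt0.
  move=> y; rewrite lt_min => /andP[yd _].
  apply: le_trans (Hd y _) _ => //=.
  rewrite -[leLHS]invrK lef_pV2 ?posrE ?lt_min ?d0 ?invr_gt0 //.
  by rewrite ge_min lexx orbT.
by exists d^-1; [rewrite invr_gt0|].
Qed.

Lemma lscP u : lsc u <->
  (forall x a, a < u x -> exists2 d, 0 < d & forall y, `|y - x| < d -> a < u y).
Proof.
split=> H x a au.
  have [|V /nbhs_norm_ex[d d0 Hd] HV] := H x a; first by rewrite lte_fin.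
  by exists d => // y yd; rewrite -lte_fin; apply: HV; exact: Hd.
rewrite lte_fin in au; have [d d0 Hd] := H x a au.
exists [set y | `|y - x| < d].
  exact: nbhs_norm_sub.
by move=> y yd; rewrite lte_fin; exact: Hd.
Qed.

Lemma continuous_lsc u : continuous u -> lsc u.
Proof.
move=> cu; apply/lscP => x a au.
have [|d d0 H] := continuous_eps (e := u x - a) (cu x); first by rewrite subr_gt0.
exists d => // y /H; rewrite ltr_norml => /andP[h _].
by move: h; move: (u x) (u y); clear => *; lra.
Qed.

Lemma continuous_locally_bounded u : continuous u -> locally_bounded u.
Proof.
move=> cu x; rewrite /bounded_near.
have [d d0 H] := continuous_eps (cu x) (@ltr01 R).
near=> M; apply: filterS (nbhs_norm_sub x d0) => y /= /H h.
apply: (@le_trans _ _ (`|u x| + 1)).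
  rewrite -[u y](subrK (u x)) addrC; apply: le_trans (ler_normD _ _) _.
  by rewrite lerD2l ltW.
by near: M; apply: nbhs_pinfty_ge; exact: num_real.
Unshelve. all: by end_near. Qed.

Lemma lscB_continuous u f : lsc u -> continuous f -> lsc (fun x => u x - f x).
Proof.
move=> /lscP lu cf; apply/lscP => x a au.
pose e := (u x - f x - a) / 2.
have e0 : 0 < e by rewrite /e divr_gt0 // subr_gt0.
have [d1 d10 H1] := continuous_eps (cf x) e0.
have [d2 d20 H2] := lu x (u x - e) ltac:(by rewrite ltrBlDr ltrDl).
exists (Num.min d1 d2); first by rewrite lt_min d10.
move=> y; rewrite lt_min => /andP[/H1 + /H2]; rewrite ltr_norml => /andP[_].
rewrite /e; move: (u x) (u y) (f x) (f y); clear => *; lra.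
Qed.

Lemma lsc_min_ball u (rho : R) : 0 <= rho -> lsc u ->
  exists2 x, `|x| <= rho & forall y, `|y| <= rho -> u x <= u y.
Proof.
move=> rho0 /lscP lu; apply: contrapT => nmin.
have H x : `|x| <= rho -> exists2 y, `|y| <= rho & u y < u x.
  move=> xr; apply: contrapT => H; apply: nmin; exists x => // y yr.
  by rewrite leNgt; apply/negP => yx; apply: H; exists y.
have [||d d0 Hd] := @ball_cover rho
  (fun d x => exists2 y, `|y| <= rho & u y + d < u x).
- move=> a b x b0 ba [y yr yx]; exists y => //.
  by apply: le_lt_trans yx; rewrite lerD2l.
- move=> x /H[y yr yx].
  have [d d0 Hd] := lu x ((u x + u y) / 2) ltac:(by move: yx; move: (u x) (u y); clear => *; lra).
  exists (Num.min d ((u x - u y) / 4)).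
    by rewrite lt_min d0 divr_gt0 // subr_gt0.
  move=> z; rewrite lt_min => /andP[/Hd zx _]; exists y => //.
  apply: le_lt_trans zx.
  have : Num.min d ((u x - u y) / 4) <= (u x - u y) / 4 by rewrite ge_min lexx orbT.
  move: (Num.min _ _) yx; move: (u x) (u y); clear => *; lra.
pose A := [set u y | y in [set y | `|y| <= rho]].
have A0 : A !=set0 by exists (u 0); exists 0 => //=; rewrite normr0.
have lb : has_lbound A.
  have [||e e0 He] := @ball_cover rho (fun d x => - d^-1 <= u x).
  - move=> a b x b0 ba; apply: le_trans.
    by rewrite lerN2 lef_pV2 // posrE (lt_le_trans b0).
  - move=> x _; have [d' d'0 Hd'] := lu x (u x - 1) ltac:(by rewrite ltrBlDr ltrDl).
    have m0 : 0 < `|u x - 1| + 1 by rewrite ltr_wpDl.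
    exists (Num.min d' (`|u x - 1| + 1)^-1); first by rewrite lt_min d'0 invr_gt0.
    move=> y; rewrite lt_min => /andP[/Hd' yx _]; apply: le_trans (ltW yx).
    rewrite lerNl; apply: (@le_trans _ _ (`|u x - 1| + 1)).
      by rewrite -normrN ler_wpDr // ler_norm.
    rewrite -[leLHS]invrK lef_pV2 ?posrE ?lt_min ?d'0 ?invr_gt0 //.
    by rewrite ge_min lexx orbT.
  by exists (- e^-1) => _ [y /= yr <-]; exact: He.
have [_ [x /= xr <-] xA] := @inf_adherent R A d d0 (conj A0 lb).
have [y yr yx] := Hd x xr.
have : inf A <= u y by apply: ge_inf => //; exists y.
move: xA yx; move: (u x) (u y) (inf A); clear => *; lra.
Qed.

End Compactness.

Section Horizontal.
Variable R : realType.
Implicit Types (f : 'rV[R]_3 -> R) (p q g w x y : 'rV[R]_3) (eta : 'rV[R]_2).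

Definition row3 (a b c : R) : 'rV[R]_3 :=
  \row_(i < 3) if i == 0 then a else if i == 1 then b else c.

Lemma row3E a b c : (row3 a b c 0 0 = a) * (row3 a b c 0 1 = b) * (row3 a b c 0 2 = c).
Proof. by rewrite !mxE. Qed.

Lemma row3P p q : p 0 0 = q 0 0 -> p 0 1 = q 0 1 -> p 0 2 = q 0 2 -> p = q.
Proof.
move=> h0 h1 h2; rewrite (delta_sum p) (delta_sum q) h0 h1 h2; reflexivity.
Qed.

Lemma ord3 (i : 'I_3) : [\/ i = 0, i = 1 | i = 2].
Proof.
by case: i => -[|[|[|//]]] ilt; [constructor 1|constructor 2|constructor 3]; exact: val_inj.
Qed.

Lemma sum3 (F : 'I_3 -> R) : \sum_(i < 3) F i = F 0 + F 1 + F 2.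
Proof.
rewrite !big_ord_recl big_ord0 addr0 addrA.
by congr (_ + _ + _); congr F; exact: val_inj.
Qed.

Lemma sum2 (F : 'I_2 -> R) : \sum_(i < 2) F i = F 0 + F 1.
Proof.
by rewrite !big_ord_recl big_ord0 addr0; congr (_ + _); congr F; exact: val_inj.
Qed.

Lemma norm_row3 a b c (e : R) : `|a| <= e -> `|b| <= e -> `|c| <= e -> `|row3 a b c| <= e.
Proof.
move=> h0 h1 h2; apply: mxnorm_le; first exact: le_trans h0.
by move=> i; rewrite mxE; case: ifP => // _; case: ifP.
Qed.

(* the value at [p] of the left-invariant field [eta 0 0 X + eta 0 1 Y]; the line
   through [p] in this direction is an integral curve *)
Definition hvec p eta : 'rV[R]_3 :=
  row3 (eta 0 0) (eta 0 1) ((p 0 0 * eta 0 1 - p 0 1 * eta 0 0) / 2).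

(* the right translation [p |-> p . g], which is affine, and its linear part *)
Definition rtr g p : 'rV[R]_3 :=
  row3 (p 0 0 + g 0 0) (p 0 1 + g 0 1)
       (p 0 2 + g 0 2 + (p 0 0 * g 0 1 - p 0 1 * g 0 0) / 2).

Definition drtr g w : 'rV[R]_3 :=
  row3 (w 0 0) (w 0 1) (w 0 2 + (w 0 0 * g 0 1 - w 0 1 * g 0 0) / 2).

Definition hstep eta : 'rV[R]_3 := row3 (eta 0 0) (eta 0 1) 0.

Lemma hvecE p eta : rtr (hstep eta) p = p + hvec p eta.
Proof. by apply: row3P; rewrite /rtr /hvec /hstep !mxE /= ?addr0. Qed.

Lemma hvecZ p eta (s : R) : hvec p (s *: eta) = s *: hvec p eta.
Proof. by apply: row3P; rewrite /hvec !mxE /=; ring. Qed.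

Lemma rtr_line g p w (t : R) : rtr g (p + t *: w) = rtr g p + t *: drtr g w.
Proof. by apply: row3P; rewrite /rtr /drtr !mxE /=; ring. Qed.

Lemma rtr_comp g h p : rtr h (rtr g p) = rtr (rtr h g) p.
Proof. by apply: row3P; rewrite /rtr !mxE /=; ring. Qed.

Lemma rtr0 p : rtr 0 p = p.
Proof. by apply: row3P; rewrite /rtr !mxE /=; ring. Qed.

Lemma drtr_hvec g p eta : drtr g (hvec p eta) =
  row3 (eta 0 0) (eta 0 1)
   ((eta 0 1 * (2 * p 0 0 - (rtr g p) 0 0) - eta 0 0 * (2 * p 0 1 - (rtr g p) 0 1)) / 2).
Proof. by apply: row3P; rewrite /rtr /drtr /hvec !mxE /=; field. Qed.

Lemma rtr_sum n (c : 'I_n -> R) (q : 'I_n -> 'rV[R]_3) g :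
  \sum_(i < n) c i = 1 ->
  \sum_(i < n) c i *: rtr g (q i) = rtr g (\sum_(i < n) c i *: q i).
Proof.
move=> c1.
have S (j : 'I_3) (Q : 'I_n -> 'rV[R]_3) :
    (\sum_(i < n) c i *: Q i) 0 j = \sum_(i < n) c i * Q i 0 j.
  by rewrite summxE; apply: eq_bigr => i _; rewrite mxE.
apply: row3P; rewrite /rtr !(S, mxE) /=.
- rewrite -[g 0 0 in RHS]mul1r -c1 mulr_suml -big_split /=.
  by apply: eq_bigr => i _; rewrite /rtr !mxE /=; ring.
- rewrite -[g 0 1 in RHS]mul1r -c1 mulr_suml -big_split /=.
  by apply: eq_bigr => i _; rewrite /rtr !mxE /=; ring.
- rewrite -[g 0 2 in RHS]mul1r -c1 !mulr_suml -sumrB mulr_suml -!big_split /=.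
  by apply: eq_bigr => i _; rewrite /rtr !mxE /=; ring.
Qed.

Lemma partial_val_line f p i l : is_derive 0 (1 : R) (fun t => f (p + t *: delta_mx 0 i)) l ->
  partial i f p = l.
Proof. by move=> /partial_val[]. Qed.

Lemma partialD f h p i : class_C 1 f -> class_C 1 h ->
  partial i (fun p => f p + h p) p = partial i f p + partial i h p.
Proof.
by move=> Cf Ch; apply: partial_val_line; apply: is_deriveD; exact: partial_line.
Qed.

Lemma partialM f h p i : class_C 1 f -> class_C 1 h ->
  partial i (fun p => f p * h p) p = f p * partial i h p + h p * partial i f p.
Proof.
move=> Cf Ch; apply: partial_val_line.
have Df := partial_line p i Cf; have Dh := partial_line p i Ch.
by apply: is_derive_eq (is_deriveM Df Dh) _; rewrite scale0r addr0.
Qed.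

Lemma partial_cst (c : R) p i : partial i (fun=> c) p = 0.
Proof. by apply: partial_val_line; exact: is_derive_cst. Qed.

Lemma partialZ (c : R) f p i : class_C 1 f ->
  partial i (fun p => c * f p) p = c * partial i f p.
Proof.
by move=> Cf; rewrite partialM ?partial_cst ?mulr0 ?addr0 //; exact: class_C_cst.
Qed.

Lemma partial_coord p i (j : 'I_3) : partial i (fun p => p 0 j) p = (i == j)%:R.
Proof.
apply: partial_val_line.
have -> : (fun t : R => (p + t *: delta_mx 0 i) 0 j) = fun t => p 0 j + t * (i == j)%:R.
  by apply/funext => t; rewrite !mxE eqxx /= eq_sym.
by apply: is_derive_eq; rewrite /GRing.scale /=; ring.
Qed.

Lemma hgrad_d1 f p eta :
  eta 0 0 * hgrad f p 0 0 + eta 0 1 * hgrad f p 0 1 = d1 f p (hvec p eta).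
Proof.
rewrite /d1 sum3 /hvec !row3E /hgrad !mxE /= /vfX /vfY.
by move: (partial 0 f p) (partial 1 f p) (partial 2 f p) (p 0 0) (p 0 1) (eta 0 0)
  (eta 0 1); clear=> *; ring.
Qed.

Lemma vf_combo f (i j : 'I_3) (k : 'I_3) (a : R) p : class_C 2 f ->
  partial k (fun q => partial i f q + a * q 0 j * partial 2 f q) p =
  partial k (partial i f) p +
  (a * p 0 j * partial k (partial 2 f) p + a * (k == j)%:R * partial 2 f p).
Proof.
move=> C; have Ci l : class_C 1 (partial l f) by exact: class_C_partial.
have Cj : class_C 1 (fun q : 'rV[R]_3 => a * q 0 j) by apply/class_CZ/class_C_coord.
rewrite (partialD p k (Ci i) (class_CM Cj (Ci 2))) (partialM p k Cj (Ci 2)).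
rewrite partialZ ?partial_coord; last exact: class_C_coord.
by rewrite [partial 2 f p * _]mulrC.
Qed.

Lemma vfXE f : vfX f = fun q => partial 0 f q + (- 2^-1) * q 0 1 * partial 2 f q.
Proof.
apply/funext => q; rewrite /vfX; move: (partial 0 f q) (partial 2 f q) (q 0 1).
by clear=> *; ring.
Qed.

Lemma vfYE f : vfY f = fun q => partial 1 f q + 2^-1 * q 0 0 * partial 2 f q.
Proof.
apply/funext => q; rewrite /vfY; move: (partial 1 f q) (partial 2 f q) (q 0 0).
by clear=> *; ring.
Qed.

Definition hess f p (i j : 'I_3) : R := partial j (partial i f) p.

Lemma vf_comp f p : class_C 2 f ->
  let P := hess f p in
  let x := p 0 0 in let y := p 0 1 in
  [/\ vfX (vfX f) p = P 0 0 - y / 2 * (P 2 0 + P 0 2) + y ^+ 2 / 4 * P 2 2,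
      vfY (vfY f) p = P 1 1 + x / 2 * (P 2 1 + P 1 2) + x ^+ 2 / 4 * P 2 2 &
      vfX (vfY f) p + vfY (vfX f) p = P 1 0 + P 0 1 + x / 2 * (P 2 0 + P 0 2)
        - y / 2 * (P 2 1 + P 1 2) - x * y / 2 * P 2 2].
Proof.
move=> C P x y.
have XX k : partial k (vfX f) p = P 0 k +
    (- 2^-1 * y * P 2 k + - 2^-1 * (k == 1)%:R * partial 2 f p).
  by rewrite vfXE vf_combo.
have YY k : partial k (vfY f) p = P 1 k +
    (2^-1 * x * P 2 k + 2^-1 * (k == 0)%:R * partial 2 f p).
  by rewrite vfYE vf_combo.
have XE h : vfX h p = partial 0 h p - y / 2 * partial 2 h p by [].
have YE h : vfY h p = partial 1 h p + x / 2 * partial 2 h p by [].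
rewrite !XE !YE !XX !YY /=; clear XE YE XX YY.
move: (P 0 0) (P 0 1) (P 0 2) (P 1 0) (P 1 1) (P 1 2) (P 2 0) (P 2 1) (P 2 2).
move: (partial 2 f p) x y; clear=> *; split; by field.
Qed.

Lemma hhess_d2 f p eta : class_C 2 f ->
  (eta *m hhess f p *m eta^T) 0 0 = d2 f p (hvec p eta).
Proof.
move=> C; have [XX YY XY] := vf_comp p C.
rewrite !mxE sum2 !mxE !sum2 !mxE /= XX YY XY.
have [W0 W1 W2] : [/\ hvec p eta 0 0 = eta 0 0, hvec p eta 0 1 = eta 0 1 &
    hvec p eta 0 2 = (p 0 0 * eta 0 1 - p 0 1 * eta 0 0) / 2].
  by split; rewrite /hvec row3E.
move: (hvec p eta) W0 W1 W2 => W W0 W1 W2.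
rewrite (_ : d2 f p W = \sum_(i < 3) \sum_(j < 3) W 0 i * W 0 j * hess f p i j) //.
move: (hess f p) => P.
rewrite (sum3 (fun i => \sum_j W 0 i * W 0 j * P i j)).
rewrite (sum3 (fun j => W 0 0 * W 0 j * P 0 j)) (sum3 (fun j => W 0 1 * W 0 j * P 1 j)).
rewrite (sum3 (fun j => W 0 2 * W 0 j * P 2 j)) W0 W1 W2.
clear -P.
move: (P 0 0) (P 0 1) (P 0 2) (P 1 0) (P 1 1) (P 1 2) (P 2 0) (P 2 1) (P 2 2).
move: (p 0 0) (p 0 1) (eta 0 0) (eta 0 1); clear=> *; by field.
Qed.

End Horizontal.

Section Translation.
Variable R : realType.
Implicit Types (f h : 'rV[R]_3 -> R) (p q g w x y : 'rV[R]_3) (eta : 'rV[R]_2).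

Lemma is_derive_uniq (b : R -> R) (t l l' : R) :
  is_derive t (1 : R) b l -> is_derive t (1 : R) b l' -> l = l'.
Proof. by move=> [_ <-] [_ <-]. Qed.

Lemma d1_line0 f p w : class_C 1 f ->
  is_derive 0 (1 : R) (fun t => f (p + t *: w)) (d1 f p w).
Proof. by move=> C; have := d1_line p w 0 C; rewrite scale0r addr0. Qed.

Lemma d2_line0 f p w : class_C 2 f ->
  is_derive 0 (1 : R) (fun t => d1 f (p + t *: w) w) (d2 f p w).
Proof. by move=> C; have := d2_line p w 0 C; rewrite scale0r addr0. Qed.

Lemma d1D f h p w : class_C 1 f -> class_C 1 h ->
  d1 (fun p => f p + h p) p w = d1 f p w + d1 h p w.
Proof.
move=> Cf Ch; apply: (@is_derive_uniq _ 0 _ _ (d1_line0 p w (class_CD Cf Ch))).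
by apply: is_deriveD; exact: d1_line0.
Qed.

Lemma d2D f h p w : class_C 2 f -> class_C 2 h ->
  d2 (fun p => f p + h p) p w = d2 f p w + d2 h p w.
Proof.
move=> Cf Ch; apply: (@is_derive_uniq _ 0 _ _ (d2_line0 p w (class_CD Cf Ch))).
rewrite (_ : (fun t : R => _) = (fun t : R => d1 f (p + t *: w) w + d1 h (p + t *: w) w)).
  by apply: is_deriveD; exact: d2_line0.
by apply/funext => t; rewrite d1D //; exact: class_CS.
Qed.

Lemma d1Zl (a : R) f p w : class_C 1 f ->
  d1 (fun p => a * f p) p w = a * d1 f p w.
Proof.
move=> Cf; apply: (@is_derive_uniq _ 0 _ _ (d1_line0 p w (class_CZ a Cf))).
exact: is_deriveZ (d1_line0 p w Cf).
Qed.

Lemma d2Zl (a : R) f p w : class_C 2 f ->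
  d2 (fun p => a * f p) p w = a * d2 f p w.
Proof.
move=> Cf; apply: (@is_derive_uniq _ 0 _ _ (d2_line0 p w (class_CZ a Cf))).
rewrite (_ : (fun t : R => _) = (fun t : R => a * d1 f (p + t *: w) w)).
  exact: is_deriveZ (d2_line0 p w Cf).
by apply/funext => t; rewrite d1Zl //; exact: class_CS.
Qed.

Lemma d2Z f p w (a : R) : d2 f p (a *: w) = a ^+ 2 * d2 f p w.
Proof.
rewrite /d2 mulr_sumr; apply: eq_bigr => i _; rewrite mulr_sumr.
by apply: eq_bigr => j _; rewrite !mxE expr2 !mulrA; congr (_ * _); rewrite -!mulrA; congr (_ * _); rewrite mulrCA.
Qed.

Lemma norm_drtr g w : `|drtr g w| <= (1 + `|g|) * `|w|.
Proof.
have w0 := ler_mxnorm w 0; have w1 := ler_mxnorm w 1; have w2 := ler_mxnorm w 2.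
have g0 := ler_mxnorm g 0; have g1 := ler_mxnorm g 1.
have W : 0 <= `|w| by []. have G : 0 <= `|g| by [].
have gw : `|w| <= (1 + `|g|) * `|w| by rewrite mulrDl mul1r lerDl mulr_ge0.
apply: norm_row3; try exact: le_trans gw.
have h a b c d : `|a| <= `|w| -> `|b| <= `|g| -> `|c| <= `|w| -> `|d| <= `|g| ->
    `|(a * b - c * d) / 2| <= `|g| * `|w|.
  move=> ha hb hc hd; rewrite normrM [`|2^-1|]gtr0_norm ?invr_gt0 //.
  rewrite ler_pdivrMr // mulr_natr mulr2n.
  apply: le_trans (ler_normB _ _) _; rewrite !normrM.
  by apply: lerD; rewrite [`|g| * _]mulrC; apply: ler_pM.
by apply: le_trans (ler_normD _ _) _; rewrite [leRHS]mulrDl mul1r lerD // h.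
Qed.

Lemma lipschitz_cont (V W : normedModType R) (F : V -> W) (K : R) :
  (forall x y : V, `|F y - F x| <= K * `|y - x|) -> continuous F.
Proof.
move=> HF x; apply/cvgrPdist_lt => e e0.
have n0 : 0 < `|K| + 1 by rewrite ltr_wpDl.
apply: filterS (nbhs_norm_sub x (divr_gt0 e0 n0)) => y /= yx.
rewrite distrC; apply: le_lt_trans (HF x y) _.
apply: (@le_lt_trans _ _ ((`|K| + 1) * `|y - x|)).
  by rewrite ler_wpM2r // ler_wpDr // ler_norm.
by rewrite mulrC -ltr_pdivlMr.
Qed.

Lemma rtr_continuous g : continuous (rtr g).
Proof.
apply: (@lipschitz_cont _ _ _ (1 + `|g|)) => x y.
have -> : rtr g y = rtr g x + drtr g (y - x).
  by rewrite -[drtr _ _]scale1r -rtr_line scale1r addrC subrK.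
by rewrite addrC addKr; exact: norm_drtr.
Qed.

Lemma class_C_rtr k f g : class_C k f -> class_C k (f \o rtr g).
Proof.
by apply: (@class_C_comp_affine _ _ _ _ (drtr g)); [exact: rtr_continuous|move=> *; exact: rtr_line].
Qed.

Lemma d1_rtr f g x w : class_C 1 f ->
  d1 (f \o rtr g) x w = d1 f (rtr g x) (drtr g w).
Proof.
move=> C; apply: (@is_derive_uniq _ 0 _ _ (d1_line0 x w (class_C_rtr g C))).
have := d1_line0 (rtr g x) (drtr g w) C.
by under eq_fun do rewrite -rtr_line.
Qed.

Lemma d2_rtr f g x w : class_C 2 f ->
  d2 (f \o rtr g) x w = d2 f (rtr g x) (drtr g w).
Proof.
move=> C; have C1 := class_CS C.
apply: (@is_derive_uniq _ 0 _ _ (d2_line0 x w (class_C_rtr g C))).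
have := d2_line0 (rtr g x) (drtr g w) C.
rewrite (_ : (fun t : R => d1 f _ _) = (fun t : R => d1 (f \o rtr g) (x + t *: w) w)) //.
by apply/funext => t; rewrite d1_rtr // rtr_line.
Qed.

Lemma drtr0 w : drtr 0 w = w.
Proof. by apply: row3P; rewrite /drtr !mxE /=; ring. Qed.

Lemma drtr_comp g k w : drtr k (drtr g w) = drtr (rtr k g) w.
Proof. by apply: row3P; rewrite /rtr /drtr !mxE /=; ring. Qed.

(* The bounds are uniform in the translation [g]: they pass to the right
   translates of [f], hence to the averages built from them. *)
Definition flat (rho r : R) (H : seq 'rV[R]_2) (e : R) f : Prop :=
  class_C 2 f /\ forall g x eta (s : R),
    `|x| <= rho -> eta \in H -> `|s| <= r ->
    let y := rtr g x in let w := drtr g (hvec x eta) in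
    `|d1 f (y + s *: w) w - d1 f y w| <= e /\ `|d2 f (y + s *: w) w - d2 f y w| <= e.

Section flat.
Variables (rho r : R) (H : seq 'rV[R]_2).
Local Notation flat := (flat rho r H).

Lemma flatD e1 e2 f h : flat e1 f -> flat e2 h -> flat (e1 + e2) (fun p => f p + h p).
Proof.
move=> [Cf Ff] [Ch Fh]; split; first exact: class_CD.
move=> g x eta s xr etaH sr y w.
have [f1 f2] := Ff g x eta s xr etaH sr; have [h1 h2] := Fh g x eta s xr etaH sr.
have Cf1 := class_CS Cf; have Ch1 := class_CS Ch.
by split; [rewrite !d1D //|rewrite !d2D //]; rewrite opprD addrACA;
  apply: le_trans (ler_normD _ _) _; exact: lerD.
Qed.

Lemma flatZ a e f : 0 <= a -> flat e f -> flat (a * e) (fun p => a * f p).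
Proof.
move=> a0 [Cf Ff]; split; first exact: class_CZ.
move=> g x eta s xr etaH sr y w.
have [f1 f2] := Ff g x eta s xr etaH sr; have Cf1 := class_CS Cf.
by split; [rewrite !d1Zl //|rewrite !d2Zl //]; rewrite -mulrBr normrM ger0_norm // ler_wpM2l.
Qed.

Lemma flat_sum (I : finType) e (F : I -> 'rV[R]_3 -> R) :
  (forall i, flat e (F i)) -> flat (#|I|%:R * e) (fun p => \sum_i F i p).
Proof.
move=> HF; have <- : size (index_enum I) = #|I| by rewrite -sum1_size -sum1_card.
elim: (index_enum I) => [|i s IH] /=.
  rewrite mul0r; under eq_fun do rewrite big_nil.
  split; first exact: class_C_cst.
  move=> g x eta t _ _ _ y w.
  have P0 i : partial i (fun=> 0 : R) = (fun=> 0) :> ('rV[R]_3 -> R).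
    by apply/funext => z; rewrite partial_cst.
  have D1 z v : d1 (fun=> 0 : R) z v = 0.
    by rewrite /d1 big1 // => i _; rewrite P0 mulr0.
  have D2 z v : d2 (fun=> 0 : R) z v = 0.
    by rewrite /d2 big1 // => i _; rewrite big1 // => j _; rewrite !P0 mulr0.
  by rewrite !D1 !D2 subrr normr0.
by rewrite mulrS mulrDl mul1r; under eq_fun do rewrite big_cons; exact: flatD.
Qed.

Lemma flat_rtr e f k : flat e f -> flat e (f \o rtr k).
Proof.
move=> [Cf Ff]; split; first exact: class_C_rtr.
move=> g x eta s xr etaH sr y w; have Cf1 := class_CS Cf.
rewrite !d1_rtr // !d2_rtr // !rtr_line /y /w !rtr_comp !drtr_comp.
exact: Ff.
Qed.

Lemma flat_cst e (c : R) : 0 <= e -> flat e (fun=> c).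
Proof.
move=> e0; split; first exact: class_C_cst.
move=> g x eta s _ _ _ y w.
have P0 i : partial i (fun=> c) = (fun=> 0) :> ('rV[R]_3 -> R).
  by apply/funext => z; rewrite partial_cst.
have P00 i : partial i (fun=> 0) = (fun=> 0) :> ('rV[R]_3 -> R).
  by apply/funext => z; rewrite partial_cst.
have D1 z v : d1 (fun=> c) z v = 0 by rewrite /d1 big1 // => i _; rewrite P0 mulr0.
have D2 z v : d2 (fun=> c) z v = 0.
  by rewrite /d2 big1 // => i _; rewrite big1 // => j _; rewrite P0 P00 mulr0.
by rewrite !D1 !D2 subrr normr0.
Qed.

Lemma flat_le e e' f : e <= e' -> flat e f -> flat e' f.
Proof.
move=> ee [C F]; split=> // g x eta s xr etaH sr y w.
by have [h1 h2] := F g x eta s xr etaH sr; split; [exact: le_trans h1 ee|exact: le_trans h2 ee].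
Qed.

Lemma flat_diff1 e f x eta (t : R) : flat e f -> `|x| <= rho -> eta \in H -> `|t| <= r ->
  `|f (x + t *: hvec x eta) - f x - t * d1 f x (hvec x eta)| <= `|t| * e.
Proof.
move=> [C F] xr etaH tr; set w := hvec x eta.
have C1 := class_CS C.
have [->|t0] := eqVneq t 0; first by rewrite scale0r addr0 subrr mul0r subrr normr0 mul0r.
have [c ct E] : exists2 c : R, `|c| <= `|t| & f (x + t *: w) - f x = t * d1 f (x + c *: w) w.
  have D z := d1_line x w z C1.
  have cf (A : set R) : {within A, continuous (fun z => f (x + z *: w))}.
    apply: continuous_subspaceT => z.
    by apply/differentiable_continuous/derivable1_diffP; case: (D z).
  case: (leP 0 t) => t0'.
    have [c] := MVT_segment t0' (fun z _ => D z) (cf _).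
    rewrite in_itv /= scale0r addr0 subr0 => /andP[c0 ct] E.
    by exists c; rewrite ?ger0_norm// E mulrC.
  have [c] := MVT_segment (ltW t0') (fun z _ => D z) (cf _).
  rewrite in_itv /= scale0r addr0 sub0r => /andP[ct c0] E.
  exists c; first by rewrite !ler0_norm ?lerN2 // ltW.
  by rewrite -opprB E mulrN opprK mulrC.
rewrite E -mulrBr normrM ler_wpM2l //.
have [+ _] := F 0 x eta c xr etaH (le_trans ct tr).
by rewrite rtr0 drtr0.
Qed.

Lemma flat_diff2 e f x eta (s : R) : flat e f -> `|x| <= rho -> eta \in H -> `|s| <= r ->
  `|f (x + s *: hvec x eta) + f (x - s *: hvec x eta) - 2 * f x
     - s ^+ 2 * d2 f x (hvec x eta)| <= s ^+ 2 * e.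
Proof.
move=> [C F] xr etaH sr; set w := hvec x eta.
have B c : 0 < c < 1 -> forall a, `|a| = `|s| -> `|d2 f (x + c *: (a *: w)) w - d2 f x w| <= e.
  move=> /andP[c0 c1] a as_; rewrite scalerA.
  have [|_] := F 0 x eta (c * a) xr etaH; last by rewrite rtr0 drtr0.
  by rewrite normrM as_ ger0_norm ?(ltW c0) //; apply: le_trans sr; rewrite ler_piMl // ltW.
have [c1 /B B1 ->] := taylor2 x (s *: w) C.
rewrite -scaleNr; have [c2' /B B2' ->] := taylor2 x (- s *: w) C.
have := B1 s erefl; have := B2' (- s) (normrN s).
rewrite !d2Z !d1Z sqrrN.
move: (d2 f (x + c1 *: _) w) (d2 f (x + c2' *: _) w) (d2 f x w) (d1 f x w) (f x) => A B' D E G h2 h1.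
have -> : G + s * E + s ^+ 2 * A / 2 + (G + - s * E + s ^+ 2 * B' / 2) - 2 * G - s ^+ 2 * D
   = s ^+ 2 * ((A - D) / 2 + (B' - D) / 2) by field.
rewrite normrM [`|s ^+ 2|]ger0_norm ?sqr_ge0 // ler_wpM2l ?sqr_ge0 //.
apply: le_trans (ler_normD _ _) _; rewrite !normrM [`|2^-1|]gtr0_norm ?invr_gt0 //.
move: h1 h2; move: (`|A - D|) (`|B' - D|); clear => *; lra.
Qed.

End flat.

End Translation.

Section Extremum.
Variable R : realType.
Implicit Types (f h : 'rV[R]_3 -> R) (p q g w x y : 'rV[R]_3) (eta : 'rV[R]_2).

Lemma d2_continuous f w : class_C 2 f -> continuous (fun p => d2 f p w).
Proof.
move=> C; apply: (@class_C_cont _ 0); do 2![apply: class_C_sum => ?].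
by apply: class_CZ; do 2!apply: class_C_partial.
Qed.

Opaque d1 d2 partial hhess hgrad.

Lemma d1_max f p0 w : class_C 1 f -> (forall p, f p <= f p0) -> d1 f p0 w = 0.
Proof.
move=> C M; apply: (@is_derive_uniq _ _ 0 _ _ (d1_line0 p0 w C)).
apply: (@derive1_at_max R _ (- 1) 1) => //.
- by move=> t _; case: (d1_line p0 w t C).
- by rewrite in_itv /=; lra.
- by move=> t _; rewrite scale0r addr0.
Qed.

Lemma d2_max f p0 w : class_C 2 f -> (forall p, f p <= f p0) -> d2 f p0 w <= 0.
Proof.
move=> C M; rewrite leNgt; apply/negP => d2p.
have D1 := d1_max w (class_CS C) M.
have [d d0 Hd] := continuous_eps (@d2_continuous f w C p0) d2p.
have n0 : 0 < `|w| + 1 by rewrite ltr_wpDl.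
pose t := d / (`|w| + 1).
have t0 : 0 < t by exact: divr_gt0.
have [c /andP[c0 c1] E] := taylor2 p0 (t *: w) C.
have : f (p0 + t *: w) <= f p0 := M _.
rewrite E d1Z D1 mulr0 addr0 gerDl d2Z pmulr_lle0 ?invr_gt0 //.
rewrite pmulr_rle0 ?exprn_gt0 // leNgt => /negP; apply.
have := Hd (p0 + c *: (t *: w)); rewrite addrC addKr scalerA normrZ.
have -> : `|c * t| * `|w| < d.
  rewrite gtr0_norm ?mulr_gt0 //.
  have tw : t * `|w| < d.
    by rewrite -[ltRHS](divfK (lt0r_neq0 n0)) -/t ltr_pM2l // ltrDl.
  apply: le_lt_trans tw; rewrite -mulrA ler_piMl //; last exact: ltW.
  by rewrite mulr_ge0 // ltW.
move=> /(_ isT); rewrite ltr_norml => /andP[+ _].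
by rewrite ltrBrDl subrr.
Qed.

Lemma jet0 f p0 w (K : R) : class_C 2 f ->
  (forall t : R, `|t| <= 1 -> `|f (p0 + t *: w)| <= K * `|t| ^+ 4) ->
  d1 f p0 w = 0 /\ d2 f p0 w = 0.
Proof.
move=> C HK.
have f0 : f p0 = 0.
  have := HK 0; rewrite normr0 scale0r addr0 expr0n /= mulr0 normr_le0.
  by move=> /(_ ler01) /eqP.
have K0 : 0 <= K.
  by have := HK 1; rewrite normr1 expr1n mulr1 => /(_ (lexx _)); apply: le_trans.
have D1 : d1 f p0 w = 0.
  apply: (@is_derive_uniq _ _ 0 _ _ (d1_line0 p0 w (class_CS C))).
  apply: is_derive_eps => e e0.
  have K1 : 0 < K + 1 by rewrite ltr_wpDl.
  exists (Num.min 1 (e / (K + 1))); first by rewrite lt_min ltr01 divr_gt0.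
  move=> h _; rewrite lt_min => /andP[h1 he].
  rewrite add0r scale0r addr0 f0 subr0 mulr0 subr0.
  apply: le_trans (HK h (ltW h1)) _.
  rewrite exprS mulrA [_ * `|h|]mulrC -mulrA [leRHS]mulrC ler_wpM2l //.
  have h3 : `|h| ^+ 3 <= `|h| by rewrite exprS ler_piMr // exprn_ile1 // ltW.
  apply: le_trans (ler_wpM2l K0 h3) _.
  move: he; rewrite ltr_pdivlMr //; have := normr_ge0 h.
  move: (`|h|) => z; clear -K0; nra.
split=> //; apply/eqP; rewrite -normr_eq0 eq_le normr_ge0 andbT leNgt.
apply/negP => d2p.
have e0 : 0 < `|d2 f p0 w| / 2 by rewrite divr_gt0.
have [d d0 Hd] := continuous_eps (@d2_continuous f w C p0) e0.
have n0 : 0 < `|w| + 1 by rewrite ltr_wpDl.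
have K1 : 0 < 2 * K + 1 by rewrite ltr_wpDl // mulr_ge0.
pose t := Num.min 1 (Num.min (d / (`|w| + 1)) (`|d2 f p0 w| / 2 / (2 * K + 1))).
have t0 : 0 < t by rewrite !lt_min ltr01 !divr_gt0.
have [t1 td te] : [/\ t <= 1, t <= d / (`|w| + 1) & t <= `|d2 f p0 w| / 2 / (2 * K + 1)].
  by rewrite /t !ge_min !lexx ?orbT.
have [c /andP[c0 c1] E] := taylor2 p0 (t *: w) C.
have := HK t; rewrite gtr0_norm // => /(_ t1).
rewrite E f0 d1Z D1 mulr0 !add0r d2Z.
have := Hd (p0 + c *: (t *: w)); rewrite addrC addKr scalerA normrZ.
have -> : `|c * t| * `|w| < d.
  rewrite gtr0_norm ?mulr_gt0 //.
  have tw : t * (`|w| + 1) <= d by rewrite -ler_pdivlMr.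
  apply: lt_le_trans tw; rewrite -mulrA; apply: (@le_lt_trans _ _ (t * `|w|)).
    by rewrite ler_piMl ?mulr_ge0 // ltW.
  by rewrite ltr_pM2l // ltrDl.
move=> /(_ isT); move: te; rewrite ler_pdivlMr //.
move: (d2 f _ w) (d2 f p0 w) d2p => A B Bp te AB.
rewrite normrM normrM [`|2^-1|]gtr0_norm ?invr_gt0 // [`|t ^+ 2|]ger0_norm ?sqr_ge0 //.
have AB' : `|B| / 2 < `|A|.
  have : `|B| <= `|A - B| + `|A|.
    by rewrite addrC -{1}[B](subKr A) ler_normB.
  by move: AB; move: (`|A|) (`|B|) (`|A - B|); clear => *; lra.
rewrite (_ : K * t ^+ 4 = t ^+ 2 * (K * t ^+ 2)); last by ring.
rewrite -mulrA ler_pM2l ?exprn_gt0 //.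
have : t ^+ 2 <= t by rewrite expr2 ler_piMr // ltW.
move=> tt; have := ler_wpM2l K0 tt.
move: te AB' (exprn_gt0 2 t0); move: (`|A|) (`|B|) (t ^+ 2); clear -t0; move=> *; nra.
Qed.

Lemma touch_above (f phi : 'rV[R]_3 -> R) p0 : class_C 2 f -> class_C 2 phi ->
  (forall p, f p - phi p <= f p0 - phi p0) ->
  (forall eta, d1 f p0 (hvec p0 eta) = d1 phi p0 (hvec p0 eta)) /\
  (forall eta, d2 f p0 (hvec p0 eta) <= d2 phi p0 (hvec p0 eta)).
Proof.
move=> Cf Cp M; have Cn : class_C 2 (fun p => -1 * phi p) by exact: class_CZ.
have Cs := class_CD Cf Cn.
have M' p : f p + -1 * phi p <= f p0 + -1 * phi p0 by rewrite !mulN1r.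
have [Cf1 Cp1] := (class_CS Cf, class_CS Cp); have Cn1 := class_CS Cn.
split=> eta.
  have := d1_max (hvec p0 eta) (class_CS Cs) M'.
  by rewrite (d1D _ _ Cf1 Cn1) (d1Zl _ _ _ Cp1) mulN1r => /eqP; rewrite subr_eq0 => /eqP.
have := d2_max (hvec p0 eta) Cs M'.
by rewrite (d2D _ _ Cf Cn) (d2Zl _ _ _ Cp) mulN1r subr_le0.
Qed.

Lemma hgrad_eq (f phi : 'rV[R]_3 -> R) p :
  (forall eta, d1 f p (hvec p eta) = d1 phi p (hvec p eta)) -> hgrad f p = hgrad phi p.
Proof.
move=> H.
have D (i j : 'I_2) : (delta_mx 0 i : 'rV[R]_2) 0 j = (j == i)%:R.
  by rewrite mxE eqxx.
have h0 : hgrad f p 0 0 = hgrad phi p 0 0.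
  by have := H (delta_mx 0 0); rewrite -!hgrad_d1 !D /= !mul1r !mul0r !addr0.
have h1 : hgrad f p 0 1 = hgrad phi p 0 1.
  by have := H (delta_mx 0 1); rewrite -!hgrad_d1 !D /= !mul1r !mul0r !add0r.
apply/rowP => j; have [->|->] : j = 0 \/ j = 1; [|exact: h0|exact: h1].
by case: j => -[|[|//]] jlt; [left|right]; exact: val_inj.
Qed.

Lemma mx_ge_hhess (f phi : 'rV[R]_3 -> R) p : class_C 2 f -> class_C 2 phi ->
  (forall eta, d2 f p (hvec p eta) <= d2 phi p (hvec p eta)) ->
  mx_ge (hhess phi p) (hhess f p).
Proof.
move=> Cf Cp H v; rewrite mulmxBr mulmxBl.
have A1 := hhess_d2 p v Cf; have A2 := hhess_d2 p v Cp.
have -> : forall A B : 'M[R]_1, (A - B) 0 0 = A 0 0 - B 0 0 by move=> A B; rewrite !mxE.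
have key (x y a b : R) : x = a -> y = b -> a <= b -> 0 <= y - x.
  by move=> -> ->; rewrite subr_ge0.
exact: key A1 A2 (H v).
Qed.

Transparent hhess.

Lemma sym_hhess (f : 'rV[R]_3 -> R) p : sym_mx (hhess f p).
Proof.
apply/matrixP => i j; rewrite !mxE eq_sym.
by have [->|] := eqVneq j i.
Qed.

End Extremum.

Section FlatExists.
Variable R : realType.
Implicit Types (f : 'rV[R]_3 -> R) (p q g w x y : 'rV[R]_3) (eta : 'rV[R]_2).

Lemma partial_outside f (rho m : R) i p : (forall q, rho < `|q| -> f q = m) ->
  class_C 1 f -> rho < `|p| -> partial i f p = 0.
Proof.
move=> fm C pr; apply: (@is_derive_uniq _ _ 0 _ _ (partial_line p i C)).
apply: is_derive_eps => e e0; exists (`|p| - rho); first by rewrite subr_gt0.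
move=> h _ hp; rewrite add0r scale0r addr0 mulr0 subr0 (fm p pr) fm.
  by rewrite subrr normr0 mulr_ge0 // ltW.
have nh := norm_scale_delta h i.
have : `|p| <= `|p + h *: delta_mx 0 i| + `|h *: delta_mx 0 i : 'rV[R]_3|.
  by rewrite -{1}[p](addrK (h *: delta_mx 0 i)) ler_normB.
move: nh hp; move: (`|h *: delta_mx 0 i : 'rV[R]_3|) (`|p + h *: delta_mx 0 i|) (`|p|) (`|h|).
clear => *; lra.
Qed.

Lemma norm_mem (H : seq 'rV[R]_2) :
  exists2 N : R, 1 <= N & forall eta, eta \in H -> `|eta| <= N.
Proof.
elim: H => [|a H [N N1 HN]]; first by exists 1.
exists (Num.max N `|a|); first by rewrite le_max N1.
move=> eta; rewrite inE le_max => /orP[/eqP ->|/HN ->//].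
by rewrite lexx orbT.
Qed.

Lemma flat_exists f (rho0 m rho e : R) (H : seq 'rV[R]_2) :
  class_C 2 f -> (forall p, rho0 < `|p| -> f p = m) -> 0 < e ->
  exists2 r, 0 < r & flat rho r H e f.
Proof.
move=> C fm e0; have C1 := class_CS C.
have [N N1 HN] := norm_mem H.
have N0 : 0 < N by exact: lt_le_trans N1.
pose B := N * (2 * `|rho| + `|rho0| + 2).
have B0 : 0 < B by rewrite mulr_gt0 // ltr_wpDl // addr_ge0 // mulr_ge0.
have e1 : 0 < e / (3 * B) by rewrite divr_gt0 // mulr_gt0.
have e2 : 0 < e / (9 * B ^+ 2) by rewrite divr_gt0 // mulr_gt0 // exprn_gt0.
have P1 i p : rho0 < `|p| -> partial i f p = 0.
  by move=> pr; exact: (partial_outside i fm C1 pr).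
have P2 i j p : rho0 < `|p| -> partial j (partial i f) p = 0.
  exact: (@partial_outside (partial i f) rho0 0 j p (P1 i) (class_C_partial i C)).
have [da da0 Hda] := @fin_delta R 'I_3 (fun i d => forall x y : 'rV[R]_3, `|y - x| < d ->
  `|partial i f y - partial i f x| < e / (3 * B))
  (fun i a b _ ba h x y yx => h x y (lt_le_trans yx ba))
  (fun i => @unif_cst_outside R (partial i f) rho0 0 _
     (class_C_cont (class_C_partial i C1)) (P1 i) e1).
have [db db0 Hdb] := @fin_delta R ('I_3 * 'I_3)%type (fun ij d => forall x y : 'rV[R]_3, `|y - x| < d ->
  `|partial ij.2 (partial ij.1 f) y - partial ij.2 (partial ij.1 f) x| < e / (9 * B ^+ 2))
  (fun i a b _ ba h x y yx => h x y (lt_le_trans yx ba))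
  (fun ij => @unif_cst_outside R (partial ij.2 (partial ij.1 f)) rho0 0 _
     (class_C_cont (class_C_partial ij.2 (class_C_partial ij.1 C))) (P2 ij.1 ij.2) e2).
pose d := Num.min da db; have d0 : 0 < d by rewrite lt_min da0.
pose r := Num.min N^-1 (d / (2 * B)).
have r0 : 0 < r by rewrite lt_min invr_gt0 N0 divr_gt0 // mulr_gt0.
exists r => //; split=> // g x eta s xr etaH sr y w.
have sN : `|s| * N <= 1.
  by rewrite -ler_pdivlMr // div1r; apply: le_trans sr _; rewrite ge_min lexx.
have sB : `|s| * B < d.
  apply: (@le_lt_trans _ _ (d / 2)); last by rewrite ltr_pdivrMr // ltr_pMr // ltr1n.
  rewrite -ler_pdivlMr //; apply: le_trans sr _.
  by rewrite ge_min -mulrA -invfM lexx orbT.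
have eN (j : 'I_2) : `|eta 0 j| <= N by apply: le_trans (ler_mxnorm _ _) (HN _ etaH).
have wE : w = row3 (eta 0 0) (eta 0 1)
   ((eta 0 1 * (2 * x 0 0 - y 0 0) - eta 0 0 * (2 * x 0 1 - y 0 1)) / 2).
  by rewrite /w drtr_hvec.
have Sum3 (F : 'I_3 -> R) (a : R) : (forall i, `|F i| <= a) -> `|\sum_i F i| <= 3 * a.
  move=> HF; rewrite sum3; apply: le_trans (ler_normD _ _) _.
  apply: le_trans (lerD (ler_normD _ _) (lexx _)) _.
  by move: (HF 0) (HF 1) (HF 2); move: (`|F 0|) (`|F 1|) (`|F 2|); clear => *; lra.
have [|] := boolP ((`|y 0 0| <= `|rho0| + 1) && (`|y 0 1| <= `|rho0| + 1)).
  move=> /andP[y0 y1].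
  have wB : `|w| <= B.
    have NB : N <= B.
      rewrite /B ler_peMr // ?(ltW N0) //.
      by move: (normr_ge0 rho) (normr_ge0 rho0); move: (`|rho|) (`|rho0|); clear => *; lra.
    rewrite wE; apply: norm_row3; [exact: le_trans (eN _) NB|exact: le_trans (eN _) NB|].
    have T (a b c : R) : `|a| <= N -> `|b| <= `|rho| -> `|c| <= `|rho0| + 1 ->
        `|a * (2 * b - c)| <= B.
      move=> ha hb hc; rewrite normrM; apply: ler_pM => //.
      apply: le_trans (ler_normB _ _) _; rewrite normrM [`|2|]gtr0_norm //.
      by move: hb hc; move: (`|b|) (`|c|) (`|rho|) (`|rho0|); clear => *; lra.
    have xrho (j : 'I_3) : `|x 0 j| <= `|rho|.
      by apply: le_trans (ler_mxnorm _ _) (le_trans xr (ler_norm _)).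
    rewrite normrM [`|2^-1|]gtr0_norm ?invr_gt0 // ler_pdivrMr // mulr_natr mulr2n.
    by apply: le_trans (ler_normB _ _) _; apply: lerD; apply: T.
  have wiB i : `|w 0 i| <= B by apply: le_trans (ler_mxnorm _ _) wB.
  have yd : `|(y + s *: w) - y| < d.
    rewrite addrC addKr normrZ; apply: le_lt_trans sB.
    by rewrite ler_wpM2l.
  have [yda ydb] : `|(y + s *: w) - y| < da /\ `|(y + s *: w) - y| < db.
    by move: yd; rewrite lt_min => /andP[].
  split.
    rewrite /d1 -sumrB (_ : e = 3 * (B * (e / (3 * B)))); last first.
      by move: B0; move: (B) => b b0; field; rewrite gt_eqF.
    by apply: Sum3 => i; rewrite -mulrBr normrM ler_pM // ltW // Hda.
  rewrite /d2 -sumrB (_ : e = 3 * (3 * (B ^+ 2 * (e / (9 * B ^+ 2))))); last first.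
    by move: B0; move: (B) => b b0; field; rewrite gt_eqF.
  apply: (Sum3) => i; rewrite -sumrB; apply: Sum3 => j.
  rewrite -mulrBr normrM ler_pM //; last by rewrite ltW // (Hdb (i, j)).
  by rewrite normrM expr2 ler_pM.
rewrite negb_and => yfar.
have far z : z = y \/ z = y + s *: w -> rho0 < `|z|.
  have F (j : 'I_3) : `|w 0 j| <= N -> `|rho0| + 1 < `|y 0 j| -> z = y \/ z = y + s *: w -> rho0 < `|z|.
    move=> wN yj zE; apply: (le_lt_trans (ler_norm _)); apply: lt_le_trans (ler_mxnorm z j).
    case: zE => ->; first by apply: lt_trans yj; rewrite ltrDl.
    have swj : `|s * w 0 j| <= 1.
      by rewrite normrM; apply: le_trans sN; rewrite ler_wpM2l.
    have : `|y 0 j| <= `|y 0 j + s * w 0 j| + `|s * w 0 j|.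
      by rewrite -{1}[y 0 j](addrK (s * w 0 j)) ler_normB.
    rewrite (_ : (y + s *: w) 0 j = y 0 j + s * w 0 j); last by rewrite mxE [X in _ + X]mxE.
    move: yj swj; move: (`|y 0 j|) (`|s * w 0 j|) (`|y 0 j + s * w 0 j|) (`|rho0|).
    by clear => *; lra.
  case/orP: yfar; rewrite -ltNge => yj zE.
    by apply: (F 0) => //; rewrite wE row3E.
  by apply: (F 1) => //; rewrite wE row3E.
have Z z v : z = y \/ z = y + s *: w -> d1 f z v = 0 /\ d2 f z v = 0.
  move=> /far zf; split.
    by rewrite /d1 big1 // => i _; rewrite P1 // mulr0.
  by rewrite /d2 big1 // => i _; rewrite big1 // => j _; rewrite P2 // mulr0.
have [-> ->] := Z y w (or_introl erefl).
have [-> ->] := Z (y + s *: w) w (or_intror erefl).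
by rewrite subrr normr0; split; exact: ltW.
Qed.

End FlatExists.

Section Supergradient.
Variable R : realType.

Definition dot n (l x : 'rV[R]_n) : R := \sum_(i < n) l 0 i * x 0 i.

Lemma dotD n (l x y : 'rV[R]_n) : dot l (x + y) = dot l x + dot l y.
Proof. by rewrite /dot -big_split; apply: eq_bigr => i _; rewrite mxE mulrDr. Qed.

Lemma dotZ n (l x : 'rV[R]_n) (a : R) : dot l (a *: x) = a * dot l x.
Proof. by rewrite /dot mulr_sumr; apply: eq_bigr => i _; rewrite mxE mulrCA. Qed.

Lemma dotB n (l x y : 'rV[R]_n) : dot l (x - y) = dot l x - dot l y.
Proof. by rewrite dotD -scaleN1r dotZ mulN1r. Qed.

Lemma dotN n (l x : 'rV[R]_n) : dot (- l) x = - dot l x.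
Proof. by rewrite /dot -sumrN; apply: eq_bigr => i _; rewrite mxE mulNr. Qed.

Lemma dot0 n (l : 'rV[R]_n) : dot l 0 = 0.
Proof. by rewrite -[0 in LHS](scale0r 0) dotZ mul0r. Qed.

(* Hahn-Banach: the supporting functional is extended one coordinate at a time. *)
Lemma convex_subgradient n (g : 'rV[R]_n -> R) :
  (forall x y (t : R), 0 <= t <= 1 -> g (t *: x + (1 - t) *: y) <= t * g x + (1 - t) * g y) ->
  exists l, forall x, g 0 + dot l x <= g x.
Proof.
move=> cvx.
suff H k : (k <= n)%N -> exists l, forall x : 'rV[R]_n,
    (forall i : 'I_n, (k <= i)%N -> x 0 i = 0) -> g 0 + dot l x <= g x.
  have [l Hl] := H n (leqnn n); exists l => x; apply: Hl => i.
  by rewrite leqNgt ltn_ord.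
elim: k => [_|k IH kn].
  exists 0 => x x0; have -> : x = 0 by apply/rowP => i; rewrite mxE x0.
  by rewrite dot0 addr0.
have [l Hl] := IH (ltnW kn); pose kk := Ordinal kn.
pose e : 'rV[R]_n := delta_mx 0 kk.
pose W : set 'rV[R]_n := [set x | forall i : 'I_n, (k <= i)%N -> x 0 i = 0].
pose S := [set s | exists w t, [/\ W w, 0 < t & s = (g 0 + dot l w - g (w - t *: e)) / t]].
have cross w t w' t' : W w -> W w' -> 0 < t -> 0 < t' ->
    (g 0 + dot l w' - g (w' - t' *: e)) / t' <= (g (w + t *: e) - g 0 - dot l w) / t.
  move=> Ww Ww' t0 t'0; rewrite ler_pdivrMr // mulrAC ler_pdivlMr //.
  have tt : 0 < t + t' by exact: addr_gt0.
  have ne : t + t' != 0 by exact: lt0r_neq0.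
  pose a := t' / (t + t').
  have aE : 1 - a = t / (t + t') by rewrite /a; field.
  have a01 : 0 <= a <= 1.
    by rewrite /a divr_ge0 ?(ltW t'0) ?(ltW tt) //= ler_pdivrMr // mul1r lerDr ltW.
  have := cvx (w + t *: e) (w' - t' *: e) a a01; rewrite aE.
  have -> : a *: (w + t *: e) + (t / (t + t')) *: (w' - t' *: e) =
      a *: w + (t / (t + t')) *: w'.
    apply/rowP => i; rewrite !mxE /a; move: (w 0 i) (w' 0 i) (_%:R) => *.
    by field.
  have WW : W (a *: w + (t / (t + t')) *: w').
    by move=> i ki; rewrite !mxE Ww // Ww' // !mulr0 addr0.
  move=> /(le_trans (Hl _ WW)); rewrite dotD !dotZ /a.
  move: (g 0) (dot l w) (dot l w') (g (w + t *: e)) (g (w' - t' *: e)) => G0 D D' A B.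
  move=> h.
  have {}h := ler_wpM2l (ltW tt) h.
  have E1 : (t + t') * (G0 + (t' / (t + t') * D + t / (t + t') * D')) = (t + t') * G0 + t' * D + t * D'.
    by field.
  have E2 : (t + t') * (t' / (t + t') * A + t / (t + t') * B) = t' * A + t * B by field.
  rewrite E1 E2 in h; move: h; clear; lra.
have W0 : W 0 by move=> i _; rewrite mxE.
have S0 : S !=set0 by exists ((g 0 + dot l 0 - g (0 - 1 *: e)) / 1), 0, 1; split.
have Sub w t : W w -> 0 < t -> ubound S ((g (w + t *: e) - g 0 - dot l w) / t).
  by move=> Ww t0 _ [w' [t' [Ww' t'0 ->]]]; exact: cross.
have hS : has_sup S by split => //; exists ((g (0 + 1 *: e) - g 0 - dot l 0) / 1); exact: Sub.
pose s := sup S.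
exists (l + (s - l 0 kk) *: e) => x x0.
pose t := x 0 kk; pose w := x - t *: e.
have xE : x = w + t *: e by rewrite /w subrK.
have ekk i : e 0 i = (i == kk)%:R by rewrite mxE eqxx.
have Ww : W w.
  move=> i ki; rewrite 2!mxE [X in _ - X]mxE ekk.
  have [->|/eqP ik] := eqVneq i kk; first by rewrite mulr1 subrr.
  rewrite mulr0 subr0 x0 // ltn_neqAle ki andbT; apply/eqP => ki'.
  by apply: ik; apply: val_inj.
have -> : dot (l + (s - l 0 kk) *: e) x = dot l w + s * t.
  rewrite /dot (bigD1 kk) //= [in RHS](bigD1 kk) //= Ww //= mulr0 add0r.
  rewrite 2!mxE ekk eqxx mulr1 addrCA subrr addr0 addrC; congr (_ + _).
  apply: eq_bigr => i ik; rewrite 2!mxE [in RHS]mxE [X in _ = _ * (_ + X)]mxE [X in _ = _ * (_ - X)]mxE.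
  by rewrite !ekk (negbTE ik) !mulr0 oppr0 !addr0.
case: (ltgtP t 0) => t0.
- have : (g 0 + dot l w - g (w - (- t) *: e)) / (- t) <= s.
    by apply: sup_ubound; [case: hS|exists w, (- t); rewrite oppr_gt0].
  rewrite scaleNr opprK -xE ler_pdivrMr ?oppr_gt0 //.
  move: (g 0) (dot l w) (g x) => *; lra.
- have : s <= (g (w + t *: e) - g 0 - dot l w) / t.
    by apply: ge_sup => //; exact: Sub.
  rewrite -xE ler_pdivlMr //.
  move: (g 0) (dot l w) (g x) => *; lra.
- by rewrite t0 mulr0 addr0 xE t0 scale0r addr0; exact: Hl.
Qed.

Lemma concave_supergradient n (g : 'rV[R]_n -> R) x0 :
  (forall x y (t : R), 0 <= t <= 1 -> t * g x + (1 - t) * g y <= g (t *: x + (1 - t) *: y)) ->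
  exists l, forall x, g x <= g x0 + dot l (x - x0).
Proof.
move=> ccv.
have [|l Hl] := @convex_subgradient n (fun x => - g (x0 + x)).
  move=> x y t t01; rewrite !mulrN -opprD lerN2; apply: le_trans (ccv _ _ t t01) _.
  have -> // : t *: (x0 + x) + (1 - t) *: (x0 + y) = x0 + (t *: x + (1 - t) *: y).
  by apply/rowP => i; rewrite !mxE; ring.
exists (- l) => x; have := Hl (x - x0); rewrite addr0 [x0 + _]addrC subrK dotN.
by move: (g x) (g x0) (dot _ _) => *; lra.
Qed.

Lemma psd_decomp (a b c : R) :
  (forall x y : R, 0 <= a * x ^+ 2 + 2 * b * x * y + c * y ^+ 2) ->
  exists w1 w2 : 'rV[R]_2, [/\ a = w1 0 0 ^+ 2 + w2 0 0 ^+ 2,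
    b = w1 0 0 * w1 0 1 + w2 0 0 * w2 0 1 & c = w1 0 1 ^+ 2 + w2 0 1 ^+ 2].
Proof.
move=> H; pose v (x y : R) : 'rV[R]_2 := \row_j if j == 0 then x else y.
have vE x y : (v x y 0 0 = x) * (v x y 0 1 = y) by rewrite !mxE.
have a0 : 0 <= a by have := H 1 0; lra.
have c0 : 0 <= c by have := H 0 1; lra.
have [a_gt0|] := ltP 0 a.
  have D : b ^+ 2 <= a * c.
    by have := H b (- a); move: a_gt0; clear; nra.
  have sa : Num.sqrt a != 0 by rewrite sqrtr_eq0 -ltNge.
  exists (v (Num.sqrt a) (b / Num.sqrt a)), (v 0 (Num.sqrt (c - b ^+ 2 / a))).
  rewrite !vE sqr_sqrtr // expr_div_n sqr_sqrtr // sqr_sqrtr; last first.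
    by rewrite subr_ge0 ler_pdivrMr // mulrC.
  split; [ring| by field | ring].
rewrite le_eqVlt => /orP[/eqP aE|]; last by rewrite ltNge a0.
have bE : b = 0.
  apply/eqP; apply: contraT => b0.
  have := H (- (c + 1) / (2 * b)) 1; rewrite aE.
  have -> : 0 * (- (c + 1) / (2 * b)) ^+ 2 + 2 * b * (- (c + 1) / (2 * b)) * 1 + c * 1 ^+ 2 = - 1 by field.
  by rewrite oppr_ge0 lt_geF.
exists (v 0 (Num.sqrt c)), (v 0 0); rewrite !vE sqr_sqrtr // aE bE.
by split; ring.
Qed.

End Supergradient.

Section Majorant.
Variable R : realType.
Implicit Types (A : 'M[R]_2) (w : 'rV[R]_2).

Definition qform A w : R := (w *m A *m w^T) 0 0.

Lemma qformE A w : sym_mx A ->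
  qform A w = A 0 0 * w 0 0 ^+ 2 + 2 * A 0 1 * w 0 0 * w 0 1 + A 1 1 * w 0 1 ^+ 2.
Proof.
move=> /matrixP /(_ 0 1); rewrite mxE => A10.
rewrite /qform !mxE sum2 !mxE !sum2 A10.
by move: (A 0 0) (A 0 1) (A 1 1) (w 0 0) (w 0 1) => *; ring.
Qed.

Definition mx22 (a b c : R) : 'M[R]_2 :=
  \matrix_(i < 2, j < 2) if i != j then b else if i == 0 then a else c.

Lemma mx22E a b c : [/\ mx22 a b c 0 0 = a, mx22 a b c 0 1 = b & mx22 a b c 1 1 = c].
Proof. by rewrite !mxE. Qed.

Lemma sym_mx22 a b c : sym_mx (mx22 a b c).
Proof.
apply/matrixP => i j; rewrite !mxE eq_sym.
by have [->|] := eqVneq j i.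
Qed.

Lemma ord2 (i : 'I_2) : i = 0 \/ i = 1.
Proof. by case: i => -[|[|//]] ilt; [left|right]; exact: val_inj. Qed.

Lemma mx22_eta A : sym_mx A -> A = mx22 (A 0 0) (A 0 1) (A 1 1).
Proof.
move=> /matrixP /(_ 0 1); rewrite mxE => A10.
apply/matrixP => i j; rewrite mxE.
by case: (ord2 i) => ->; case: (ord2 j) => -> /=.
Qed.

Definition row2 (a b : R) : 'rV[R]_2 := \row_j if j == 0 then a else b.

Lemma row2E a b : (row2 a b 0 0 = a) * (row2 a b 0 1 = b).
Proof. by rewrite !mxE. Qed.

Lemma row2P (x y : 'rV[R]_2) : x 0 0 = y 0 0 -> x 0 1 = y 0 1 -> x = y.
Proof. by move=> h0 h1; apply/rowP => i; case: (ord2 i) => ->. Qed.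

Lemma sum9 (F : 'I_9 -> R) : \sum_(i < 9) F i =
  F (inord 0) + (F (inord 1) + (F (inord 2) + (F (inord 3) + (F (inord 4) +
  (F (inord 5) + (F (inord 6) + (F (inord 7) + F (inord 8)))))))).
Proof.
rewrite !big_ord_recl big_ord0 addr0.
by do ![congr (_ + _)]; congr F; apply: val_inj; rewrite /= ?inordK.
Qed.

Lemma operator_concave2 (F : operator R) (HF : operator_concave F) t p1 r1 xi1 A1 p2 r2 xi2 A2 :
  0 <= t <= 1 -> sym_mx A1 -> sym_mx A2 ->
  t * F p1 r1 xi1 A1 + (1 - t) * F p2 r2 xi2 A2 <=
  F (t *: p1 + (1 - t) *: p2) (t * r1 + (1 - t) * r2)
    (t *: xi1 + (1 - t) *: xi2) (t *: A1 + (1 - t) *: A2).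
Proof.
move=> /andP[t0 t1] S1 S2.
have := HF 2 (fun i => if i == 0 then t else 1 - t) (fun i => if i == 0 then p1 else p2)
  (fun i => if i == 0 then r1 else r2) (fun i => if i == 0 then xi1 else xi2)
  (fun i => if i == 0 then A1 else A2).
rewrite !big_ord_recl !big_ord0 /= !addr0; apply.
- by move=> i; case: ifP => _; rewrite ?t0 ?t1 // subr_ge0 t1 gerBl.
- by rewrite addrC subrK.
- by move=> i; case: ifP.
Qed.

(* Ellipticity and monotonicity of [F] give the signs of the [A]- and [r]-components
   of a supergradient. *)
Lemma affine_majorant (F : operator R) (p0 : 'rV[R]_3) (r0 : R) (xi0 : 'rV[R]_2) (A0 : 'M[R]_2) :
  degenerate_elliptic F -> monotone_in_r F -> operator_concave F -> sym_mx A0 ->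
  exists (b : 'rV[R]_3) (c : R) (d w1 w2 : 'rV[R]_2), 0 <= c /\
    forall p r xi A, sym_mx A ->
      F p r xi A <= F p0 r0 xi0 A0 + dot b (p - p0) + c * (r - r0) + dot d (xi - xi0)
        - qform (A - A0) w1 - qform (A - A0) w2.
Proof.
move=> HE HM HC S0.
pose P (y : 'rV[R]_9) := row3 (y 0 (inord 0)) (y 0 (inord 1)) (y 0 (inord 2)).
pose X (y : 'rV[R]_9) := row2 (y 0 (inord 4)) (y 0 (inord 5)).
pose M (y : 'rV[R]_9) := mx22 (y 0 (inord 6)) (y 0 (inord 7)) (y 0 (inord 8)).
pose G y := F (P y) (y 0 (inord 3)) (X y) (M y).
pose Y (p : 'rV[R]_3) (r : R) (xi : 'rV[R]_2) (A : 'M[R]_2) : 'rV[R]_9 :=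
  \row_i nth 0 [:: p 0 0; p 0 1; p 0 2; r; xi 0 0; xi 0 1; A 0 0; A 0 1; A 1 1] i.
have YE p r xi A k : (k < 9)%N -> Y p r xi A 0 (inord k) =
    nth 0 [:: p 0 0; p 0 1; p 0 2; r; xi 0 0; xi 0 1; A 0 0; A 0 1; A 1 1] k.
  by move=> k9; rewrite mxE inordK.
have GY p r xi A : sym_mx A -> G (Y p r xi A) = F p r xi A.
  move=> SA; rewrite /G /P /X /M !YE //=; congr F.
  - by apply: row3P; rewrite row3E.
  - by apply: row2P; rewrite row2E.
  - by rewrite -mx22_eta.
have Gc x y t : 0 <= t <= 1 -> t * G x + (1 - t) * G y <= G (t *: x + (1 - t) *: y).
  move=> t01; apply: le_trans (operator_concave2 HC _ _ _ _ _ _ t01 (sym_mx22 _ _ _) (sym_mx22 _ _ _)) _.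
  rewrite le_eqVlt /G; apply/orP; left; apply/eqP; congr F.
  - by apply: row3P; rewrite !mxE.
  - by rewrite !mxE.
  - by apply: row2P; rewrite !mxE.
  - by apply/matrixP => i j; rewrite !mxE; case: ifP => _ //; case: ifP.
have BE (m n : nat) (B C : 'M[R]_(m, n)) i j : (B - C) i j = B i j - C i j by rewrite !mxE.
have [l Hl] := concave_supergradient (Y p0 r0 xi0 A0) Gc.
have HL p r xi A : sym_mx A -> F p r xi A <= F p0 r0 xi0 A0 +
    (l 0 (inord 0) * (p 0 0 - p0 0 0) + (l 0 (inord 1) * (p 0 1 - p0 0 1) +
    (l 0 (inord 2) * (p 0 2 - p0 0 2) + (l 0 (inord 3) * (r - r0) +
    (l 0 (inord 4) * (xi 0 0 - xi0 0 0) + (l 0 (inord 5) * (xi 0 1 - xi0 0 1) +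
    (l 0 (inord 6) * (A 0 0 - A0 0 0) + (l 0 (inord 7) * (A 0 1 - A0 0 1) +
     l 0 (inord 8) * (A 1 1 - A0 1 1))))))))).
  move=> SA; have := Hl (Y p r xi A); rewrite !GY // /dot sum9.
  have E k : (k < 9)%N -> (Y p r xi A - Y p0 r0 xi0 A0) 0 (inord k) =
    Y p r xi A 0 (inord k) - Y p0 r0 xi0 A0 0 (inord k) by rewrite BE.
  by rewrite !E // !YE.
have c0 : 0 <= l 0 (inord 3).
  have := HL p0 (r0 + 1) xi0 A0 S0; rewrite !subrr !mulr0 !addr0 !add0r addrAC subrr add0r mulr1.
  have : F p0 r0 xi0 A0 <= F p0 (r0 + 1) xi0 A0 by apply: HM; rewrite // lerDl.
  by move: (F _ _ _ _) (F _ _ _ _) (l 0 _); clear => *; lra.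
have psd x y : 0 <= (- l 0 (inord 6)) * x ^+ 2 + 2 * (- l 0 (inord 7) / 2) * x * y
    + (- l 0 (inord 8)) * y ^+ 2.
  pose A := mx22 (A0 0 0 - x ^+ 2) (A0 0 1 - x * y) (A0 1 1 - y ^+ 2).
  have SA : sym_mx A by exact: sym_mx22.
  have [a1 a2 a3] : [/\ A 0 0 = A0 0 0 - x ^+ 2, A 0 1 = A0 0 1 - x * y & A 1 1 = A0 1 1 - y ^+ 2].
    exact: mx22E.
  have := HL p0 r0 xi0 A SA; rewrite !subrr !mulr0 !add0r a1 a2 a3.
  have : F p0 r0 xi0 A0 <= F p0 r0 xi0 A.
    apply: HE => // v; rewrite -/(qform _ v) qformE.
      have -> : (A0 - A) 0 0 = x ^+ 2 by rewrite BE a1; ring.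
      have -> : (A0 - A) 0 1 = x * y by rewrite BE a2; ring.
      have -> : (A0 - A) 1 1 = y ^+ 2 by rewrite BE a3; ring.
      rewrite (_ : _ + _ = (x * v 0 0 + y * v 0 1) ^+ 2) ?sqr_ge0 //; ring.
    by rewrite /sym_mx linearB /= S0 SA.
  by move: (F _ _ _ _) (F _ _ _ _) (l 0 _) (l 0 _) (l 0 _); clear => *; lra.
have [w1 [w2 [E1 E2 E3]]] := psd_decomp psd.
exists (row3 (l 0 (inord 0)) (l 0 (inord 1)) (l 0 (inord 2))), (l 0 (inord 3)),
  (row2 (l 0 (inord 4)) (l 0 (inord 5))), w1, w2; split=> // p r xi A SA.
apply: le_trans (HL p r xi A SA) _.
have SB : sym_mx (A - A0) by rewrite /sym_mx linearB /= SA S0.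
rewrite !qformE // /dot sum3 sum2 !row3E !row2E.
rewrite !BE.
have L6 : l 0 (inord 6) = - (w1 0 0 ^+ 2 + w2 0 0 ^+ 2) by rewrite -E1 opprK.
have L7 : l 0 (inord 7) = - (2 * (w1 0 0 * w1 0 1 + w2 0 0 * w2 0 1)).
  by rewrite -E2; field.
have L8 : l 0 (inord 8) = - (w1 0 1 ^+ 2 + w2 0 1 ^+ 2) by rewrite -E3 opprK.
rewrite L6 L7 L8 {E1 E2 E3 L6 L7 L8 psd c0 HL Hl}.
move: (F _ _ _ _) (l 0 _) (l 0 _) (l 0 _) (l 0 _) (l 0 _) (l 0 _).
move: (w1 0 0) (w1 0 1) (w2 0 0) (w2 0 1) (A 0 0) (A 0 1) (A 1 1) (A0 0 0) (A0 0 1) (A0 1 1).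
move: (p 0 0) (p 0 1) (p 0 2) (p0 0 0) (p0 0 1) (p0 0 2) (xi 0 0) (xi 0 1) (xi0 0 0) (xi0 0 1).
clear; move=> *; rewrite le_eqVlt; apply/orP; left; apply/eqP; ring.
Qed.

End Majorant.

Section Bumps.
Variable R : realType.
Implicit Types (f : 'rV[R]_3 -> R) (p q g w x y : 'rV[R]_3).

Definition pos (t : R) : R := Num.max t 0.

Lemma pos_ge (t : R) : 0 <= t -> pos t = t.
Proof. by move=> h; rewrite /pos; apply/max_idPl. Qed.

Lemma pos_le (t : R) : t <= 0 -> pos t = 0.
Proof. by move=> h; rewrite /pos; apply/max_idPr. Qed.

Lemma pos_ge0 (t : R) : 0 <= pos t.
Proof. by rewrite /pos le_max lexx orbT. Qed.

Lemma pos_lip (s t : R) : `|pos t - pos s| <= `|t - s|.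
Proof.
rewrite /pos; case: (leP t 0); case: (leP s 0) => s0 t0;
  rewrite /= ler_norml; case: (ger0P (t - s)); lra.
Qed.

Lemma pos_derive n (t : R) :
  is_derive t (1 : R) (fun t => pos t ^+ n.+2) (n.+2%:R * pos t ^+ n.+1).
Proof.
apply: is_derive_eps => e e0.
have D : is_derive t (1 : R) (fun t : R => t ^+ n.+2) (n.+2%:R * t ^+ n.+1).
  apply: DeriveDef; first exact: exprn_derivable.
  by rewrite exp_derive /GRing.scale /= mulr1.
case: (ltgtP t 0) => t0.
- exists (- t); first by rewrite oppr_gt0.
  move=> h _; rewrite ltr_norml => /andP[_ h1].
  rewrite !pos_le ?(ltW t0) //; last by move: h1; clear; lra.
  by rewrite !expr0n /= !mulr0 !subrr normr0 mulr_ge0 // ltW.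
- have [d d0 Hd] := eps_is_derive D e0.
  exists (Num.min d t); first by rewrite lt_min d0.
  move=> h _; rewrite lt_min => /andP[hd]; rewrite ltr_norml => /andP[h1 _].
  by rewrite !pos_ge ?(ltW t0) //; [exact: Hd|move: h1; clear; lra].
- have D' : is_derive (0 : R) (1 : R) (fun t : R => t ^+ n.+2) 0.
    apply: DeriveDef; first exact: exprn_derivable.
    by rewrite exp_derive expr0n /GRing.scale /= mulr1 mulr0.
  have [d d0 Hd] := eps_is_derive D' e0.
  exists d => // h _ hd; rewrite t0 (pos_le (lexx 0)) !expr0n /= mulr0 add0r !subr0 mulr0 subr0.
  case: (leP h 0) => h0; first by rewrite pos_le // expr0n normr0 mulr_ge0 // ltW.
  by rewrite pos_ge ?(ltW h0) //; have := Hd h hd; rewrite add0r expr0n mulr0 !subr0.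
Qed.

Lemma class_C_pos3 f : class_C 2 f -> class_C 2 (fun p => pos (f p) ^+ 3).
Proof.
apply: (@class_C_comp R 2 (fun n => match n with 0 => fun t => pos t ^+ 3
  | 1 => fun t => 3 * pos t ^+ 2 | _ => fun t => 3 * (2 * pos t ^+ 1) end)).
  move=> [|[|//]] t _; first exact: pos_derive.
  exact: is_deriveZ (pos_derive 0 t).
apply: (@lipschitz_cont R R R _ 6) => s t; rewrite -!mulrBr !normrM [`|3|]gtr0_norm // [`|2|]gtr0_norm //.
rewrite mulrA -natrM; apply: ler_wpM2l => //; exact: pos_lip.
Qed.

Lemma class_C_sqr k f : class_C k f -> class_C k (fun p => f p ^+ 2).
Proof. by move=> C; under eq_fun do rewrite expr2; exact: class_CM. Qed.

Definition bump (p0 p : 'rV[R]_3) : R :=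
  pos (1 - \sum_(i < 3) (p 0 i - p0 0 i) ^+ 4) ^+ 3.

Lemma class_C_bump p0 : class_C 2 (bump p0).
Proof.
apply: class_C_pos3; apply: class_CB; first exact: class_C_cst.
apply: class_C_sum => i; under eq_fun do rewrite (exprM _ 2 2).
do 2!apply: class_C_sqr.
by apply: class_CB; [exact: class_C_coord|exact: class_C_cst].
Qed.

Lemma sum4_ge0 p0 p : 0 <= \sum_(i < 3) (p 0 i - p0 0 i) ^+ 4.
Proof. by apply: sumr_ge0 => i _; rewrite exprn_even_ge0. Qed.

Lemma bump_ge0 p0 p : 0 <= bump p0 p.
Proof. by rewrite exprn_ge0 // pos_ge0. Qed.

Lemma bump_bound p0 p (a : R) : 0 <= a -> a <= 1 -> a <= \sum_(i < 3) (p 0 i - p0 0 i) ^+ 4 ->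
  bump p0 p <= 1 - a.
Proof.
move=> a0 a1 ha; rewrite /bump; set s := \sum_(i < 3) _ in ha *.
have [s1|s1] := leP 1 s.
  by rewrite pos_le ?subr_le0 // expr0n subr_ge0.
have S1 : 0 <= 1 - s <= 1 - a by rewrite lerB // subr_ge0 ltW.
rewrite pos_ge; last by case/andP: S1.
case/andP: S1 => h0 h1; apply: le_trans h1.
by rewrite exprS ler_piMr // exprn_ile1 //; move: ha a0; clear; lra.
Qed.

Lemma bump_le1 p0 p : bump p0 p <= 1.
Proof.
have := @bump_bound p0 p 0 (lexx _) ler01 (sum4_ge0 p0 p); by rewrite subr0.
Qed.

Lemma bump_center p0 : bump p0 p0 = 1.
Proof.
rewrite /bump big1 ?subr0; last by move=> i _; rewrite subrr expr0n.
by rewrite pos_ge ?expr1n.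
Qed.

Lemma mxnorm_ge (w : 'rV[R]_3) (r : R) : r <= `|w| -> exists i, r <= `|w 0 i|.
Proof.
move=> rw; apply: contrapT => H.
have {}H i : `|w 0 i| < r by rewrite ltNge; apply/negP => h; apply: H; exists i.
have := @mxnorm_le R 3 w (Num.max `|w 0 0| (Num.max `|w 0 1| `|w 0 2|)).
have K i : `|w 0 i| <= Num.max `|w 0 0| (Num.max `|w 0 1| `|w 0 2|).
  have := ord3 i.
  by case=> ->; rewrite !le_max lexx ?orbT.
rewrite (le_trans _ (K 0)) // => /(_ isT K) h.
have mr : Num.max `|w 0 0| (Num.max `|w 0 1| `|w 0 2|) < r by rewrite !gt_max !H.
by have := le_lt_trans (le_trans rw h) mr; rewrite ltxx.
Qed.

Lemma bump_away p0 p (r : R) : 0 <= r -> r <= 1 -> r <= `|p - p0| -> bump p0 p <= 1 - r ^+ 4.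
Proof.
move=> r0 r1 rp; apply: bump_bound; [exact: exprn_ge0|exact: exprn_ile1|].
have [i ri] := mxnorm_ge rp; rewrite (bigD1 i) //=.
apply: (@le_trans _ _ ((p 0 i - p0 0 i) ^+ 4)).
  rewrite -[leRHS]ger0_norm ?exprn_even_ge0 // normrX.
  have -> : p 0 i - p0 0 i = (p - p0) 0 i by rewrite !mxE.
  by rewrite lerXn2r // nnegrE.
by rewrite lerDl sumr_ge0 // => j _; rewrite exprn_even_ge0.
Qed.

Lemma bump_outside p0 p : 1 <= `|p - p0| -> bump p0 p = 0.
Proof.
move=> h; apply/eqP; rewrite eq_le bump_ge0 andbT.
by have := bump_away ler01 (lexx 1) h; rewrite expr1n subrr.
Qed.

Lemma bump_jet p0 w (t : R) : 0 <= 1 - bump p0 (p0 + t *: w) <= 3 * (\sum_(i < 3) w 0 i ^+ 4) * `|t| ^+ 4.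
Proof.
rewrite subr_ge0 bump_le1 /=; set Q := \sum_(i < 3) w 0 i ^+ 4.
have Q0 : 0 <= Q by apply: sumr_ge0 => i _; rewrite exprn_even_ge0.
have E : \sum_(i < 3) ((p0 + t *: w) 0 i - p0 0 i) ^+ 4 = Q * t ^+ 4.
  rewrite /Q mulr_suml; apply: eq_bigr => i _.
  by rewrite !mxE addrC addKr exprMn mulrC.
have tt : `|t| ^+ 4 = t ^+ 4 by rewrite -normrX ger0_norm // exprn_even_ge0.
rewrite /bump E tt -mulrA; move: (Q * t ^+ 4) (mulr_ge0 Q0 (exprn_even_ge0 (n := 4) t isT)) => z z0.
rewrite /pos; case: (leP (1 - z) 0) => h.
  rewrite expr0n subr0; move: h; clear; lra.
move: h z0; clear; nra.
Qed.

Definition cub (t : R) := pos t ^+ 3.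

(* [sstep] is a smooth step from 0 to 1 and [bspl] its unit increment, the cubic
   B-spline: integer translates of [bspl] telescope to a partition of unity. *)
Definition sstep (t : R) := (cub t - 3 * cub (t - 1) + 3 * cub (t - 2) - cub (t - 3)) / 6.
Definition bspl (t : R) := sstep t - sstep (t - 1).

Lemma sstep_le0 t : t <= 0 -> sstep t = 0.
Proof.
move=> t0; rewrite /sstep /cub !pos_le; by [rewrite !expr0n /= !mulr0 !subr0 addr0 mul0r|move: t0; lra].
Qed.

Lemma cub_ge t : 0 <= t -> cub t = t ^+ 3.
Proof. by move=> h; rewrite /cub pos_ge. Qed.
Lemma cub_le t : t <= 0 -> cub t = 0.
Proof. by move=> h; rewrite /cub pos_le // expr0n. Qed.

Lemma sstep_ge3 t : 3 <= t -> sstep t = 1.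
Proof.
by move=> t3; rewrite /sstep !cub_ge; [field|move: t3; lra..].
Qed.

Lemma sstep01 t : 0 <= sstep t <= 1.
Proof.
have [t0|t0] := leP t 0; first by rewrite sstep_le0 // lexx ler01.
have [t3|t3] := leP 3 t; first by rewrite sstep_ge3 // lexx ler01.
have [t1|t1] := leP t 1.
  rewrite /sstep (cub_ge (ltW t0)) !cub_le; [|move: t1; lra..].
  by apply/andP; split; move: t0 t1; nra.
have [t2|t2] := leP t 2.
  rewrite /sstep (cub_ge (ltW t0)) (@cub_ge (t - 1)) ?(@cub_le (t - 2)) ?(@cub_le (t - 3)); [|move: t1 t2; lra..].
  have [u [u0 u1 ->]] : exists u, [/\ 0 <= u, u <= 1 & t = u + 1].
    by exists (t - 1); split; move: t1 t2; lra.
  by apply/andP; split; move: u0 u1; clear; nra.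
rewrite /sstep (cub_ge (ltW t0)) (@cub_ge (t - 1)) ?(@cub_ge (t - 2)) ?(@cub_le (t - 3)); [|move: t2 t3; lra..].
have [u [u0 u1 ->]] : exists u, [/\ 0 <= u, u <= 1 & t = 3 - u].
  by exists (3 - t); split; move: t3 t2; lra.
have -> : ((3 - u) ^+ 3 - 3 * (3 - u - 1) ^+ 3 + 3 * (3 - u - 2) ^+ 3 - 0) / 6 = 1 - u ^+ 3 / 6 by field.
by apply/andP; split; move: u0 u1; clear; nra.
Qed.

Lemma bspl_ge0 t : 0 <= bspl t.
Proof.
rewrite /bspl subr_ge0.
have [t0|t0] := leP t 1.
  by rewrite (@sstep_le0 (t - 1)) ?subr_le0 //; case/andP: (sstep01 t).
have [t3|t3] := leP 3 t; first by rewrite (sstep_ge3 t3); case/andP: (sstep01 (t - 1)).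
have e0 : cub t = t ^+ 3 by rewrite cub_ge //; move: t0; clear; lra.
have e1 : cub (t - 1) = (t - 1) ^+ 3 by rewrite cub_ge //; move: t0; clear; lra.
have e3 : cub (t - 3) = 0 by rewrite cub_le //; move: t3; clear; lra.
have e12 : cub (t - 1 - 2) = 0 by rewrite cub_le //; move: t3; clear; lra.
have e13 : cub (t - 1 - 3) = 0 by rewrite cub_le //; move: t3; clear; lra.
have [t2|t2] := leP t 2.
  have e2 : cub (t - 2) = 0 by rewrite cub_le //; move: t2; clear; lra.
  have e11 : cub (t - 1 - 1) = 0 by rewrite cub_le //; move: t2; clear; lra.
  rewrite /sstep e0 e1 e2 e3 e11 e12 e13.
  have [u [u0 u1 ->]] : exists u, [/\ 0 <= u, u <= 1 & t = u + 1].
    by exists (t - 1); split; move: t0 t2; clear; lra.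
  by move: u0 u1; clear; nra.
have e2 : cub (t - 2) = (t - 2) ^+ 3 by rewrite cub_ge //; move: t2; clear; lra.
have e11 : cub (t - 1 - 1) = (t - 1 - 1) ^+ 3 by rewrite cub_ge //; move: t2; clear; lra.
rewrite /sstep e0 e1 e2 e3 e11 e12 e13.
have [u [u0 u1 ->]] : exists u, [/\ 0 <= u, u <= 1 & t = 3 - u].
  by exists (3 - t); split; move: t3 t2; clear; lra.
by move: u0 u1; clear; nra.
Qed.

Lemma bspl_supp t : bspl t != 0 -> 0 < t < 4.
Proof.
apply: contraR; rewrite negb_and -!leNgt => /orP[h|h]; rewrite /bspl.
  by rewrite !sstep_le0 ?subrr //; move: h; lra.
by rewrite !sstep_ge3 ?subrr //; move: h; lra.
Qed.

Lemma bspl_sum n t : \sum_(a < n) bspl (t - a%:R) = sstep t - sstep (t - n%:R).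
Proof.
elim: n => [|n IH]; first by rewrite big_ord0 subr0 subrr.
have -> : t - n.+1%:R = t - n%:R - 1 by rewrite -natr1; ring.
by rewrite big_ord_recr /= IH /bspl addrA subrK.
Qed.

Lemma class_C_bspl (i : 'I_3) (a b : R) : class_C 2 (fun p => bspl (a * p 0 i + b)).
Proof.
have C (c : R) : class_C 2 (fun p => cub (a * p 0 i + b - c)).
  apply: class_C_pos3; apply: class_CB; last exact: class_C_cst.
  apply: class_CD; last exact: class_C_cst.
  by apply: class_CZ; exact: class_C_coord.
have S (c : R) : class_C 2 (fun p => sstep (a * p 0 i + b - c)).
  rewrite /sstep; under eq_fun do rewrite mulrC -!(addrA _ (- c)) -!opprD.
  apply: class_CZ; apply: class_CB => //; apply: class_CD; last by apply: class_CZ.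
  by apply: class_CB => //; apply: class_CZ.
apply: class_CB => //; have := S 0; by under eq_fun do rewrite subr0.
Qed.

End Bumps.

Section Approximation.
Variable R : realType.
Implicit Types (p q : 'rV[R]_3).

Lemma lower_approx (U : 'rV[R]_3 -> R) (C0 M r rho : R) : 0 < r ->
  (forall p, - C0 <= U p) -> - C0 <= M -> (forall p, rho <= `|p| -> M <= U p) ->
  exists phi : 'rV[R]_3 -> R, [/\ class_C 2 phi,
    exists rho', forall p, rho' < `|p| -> phi p = M,
    forall p, phi p <= U p, forall p, phi p <= M &
    forall p m, m <= M -> (forall q, `|q - p| <= r -> m <= U q) -> m <= phi p].
Proof.
move=> r0 UC CM UM.
pose r' := r / 4; have r'0 : 0 < r' by rewrite divr_gt0.
pose n := (Num.truncn (`|rho| / r')).+1.+3.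
have nE : `|rho| <= r' * (n%:R - 3).
  rewrite mulrC -ler_pdivrMr // -natrB // subSS /=.
  by rewrite /n !subSS subn0; apply: ltW; exact: truncnS_gt.
pose B (a : 'I_(n + n)) (s : R) := bspl (r'^-1 * s + n%:R - a%:R).
have B0 a s : 0 <= B a s by exact: bspl_ge0.
pose J := ('I_(n + n) * 'I_(n + n) * 'I_(n + n))%type.
pose X (j : J) (p : 'rV[R]_3) := B j.1.1 (p 0 0) * B j.1.2 (p 0 1) * B j.2 (p 0 2).
have X0 j p : 0 <= X j p by rewrite !mulr_ge0.
pose S1 s := \sum_a B a s.
have S1E s : S1 s = sstep (r'^-1 * s + n%:R) - sstep (r'^-1 * s - n%:R).
  rewrite /S1 /B bspl_sum natrD; congr (_ - sstep _); ring.
have S1_01 s : 0 <= S1 s <= 1.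
  apply/andP; split; first exact: sumr_ge0.
  rewrite S1E; case/andP: (sstep01 (r'^-1 * s + n%:R)) => _ h1.
  by case/andP: (sstep01 (r'^-1 * s - n%:R)); move: h1; clear; lra.
have S1_1 s : `|s| <= r' * (n%:R - 3) -> S1 s = 1.
  rewrite mulrC -ler_pdivrMr // mulrC -[r'^-1]ger0_norm ?invr_ge0 ?(ltW r'0) // -normrM ler_norml => /andP[h1 h2].
  rewrite S1E sstep_ge3 ?sstep_le0 ?subr0 //; move: h1 h2; clear; lra.
have B_0 a s : r' * (n%:R + 4) <= `|s| -> B a s = 0.
  rewrite mulrC -ler_pdivlMr // mulrC -[r'^-1]ger0_norm ?invr_ge0 ?(ltW r'0) // -normrM => h.
  apply/eqP; apply: contraT => /bspl_supp /andP[h1 h2].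
  have a0 : 0 <= a%:R :> R by rewrite ler0n.
  have a1 : a%:R <= n%:R + n%:R - 1 :> R.
    by rewrite -natrD lerBrDr natr1 ler_nat ltn_ord.
  move: h h1 h2 a0 a1; clear; case: (ger0P (r'^-1 * s)); lra.
pose Sm p := \sum_j X j p.
have SmE p : Sm p = S1 (p 0 0) * S1 (p 0 1) * S1 (p 0 2).
  rewrite /S1 [X in _ = X * _]big_distrlr /= pair_bigA /=.
  by rewrite big_distrlr /= pair_bigA.
have Sm1 p : `|p| <= r' * (n%:R - 3) -> Sm p = 1.
  by move=> h; rewrite SmE !S1_1 ?mulr1 //; exact: le_trans (ler_mxnorm _ _) h.
have Sm01 p : 0 <= Sm p <= 1.
  have h s : 0 <= S1 s by case/andP: (S1_01 s).
  have h' s : S1 s <= 1 by case/andP: (S1_01 s).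
  by rewrite SmE !mulr_ge0 //= !mulr_ile1 // mulr_ge0.
pose V q := Num.min (U q) M.
have VC q : - C0 <= V q by rewrite le_min UC.
pose m (j : J) := inf [set V q | q in [set q | 0 < X j q]].
have mlb j : has_lbound [set V q | q in [set q | 0 < X j q]].
  by exists (- C0) => _ [q _ <-].
have mX j p : m j * X j p <= V p * X j p.
  have [->|Xn0] := eqVneq (X j p) 0; first by rewrite !mulr0.
  have Xp : 0 < X j p by rewrite lt_def Xn0 X0.
  by rewrite ler_wpM2r //; apply: ge_inf => //; exists p.
pose phi p := M * (1 - Sm p) + \sum_j m j * X j p.
exists phi; split.
- apply: class_CD.
    apply/class_CZ/class_CB; first exact: class_C_cst.
    apply: class_C_sum => j; do 2?apply: class_CM; rewrite /B;
    under eq_fun do rewrite -addrA; exact: class_C_bspl.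
  apply: class_C_sum => j; apply: class_CZ; do 2?apply: class_CM; rewrite /B;
    under eq_fun do rewrite -addrA; exact: class_C_bspl.
- exists (r' * (n%:R + 4)) => p hp.
  have XE j : X j p = 0.
    have [i hi] := mxnorm_ge (ltW hp).
    have := ord3 i.
    by case=> iE; move: hi; rewrite iE /X => /B_0 ->; rewrite ?(mul0r, mulr0).
  by rewrite /phi /Sm !big1 ?subr0 ?mulr1 ?addr0 // => j _; rewrite XE ?mulr0.
- move=> p; rewrite /phi.
  have h : \sum_j m j * X j p <= U p * Sm p.
    rewrite /Sm mulr_sumr; apply: ler_sum => j _; apply: le_trans (mX j p) _.
    by rewrite ler_wpM2r // ge_min lexx.
  have : M * (1 - Sm p) <= U p * (1 - Sm p).
    have [pr|pr] := leP `|p| (r' * (n%:R - 3)).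
      by rewrite Sm1 // subrr !mulr0.
    rewrite ler_wpM2r //; first by rewrite subr_ge0; case/andP: (Sm01 p).
    by apply: UM; apply: le_trans (ler_norm _) (le_trans nE (ltW pr)).
  by move: h; move: (\sum_j _) (Sm p) (U p) => *; lra.
- move=> p; rewrite /phi.
  have h : \sum_j m j * X j p <= M * Sm p.
    rewrite /Sm mulr_sumr; apply: ler_sum => j _; apply: le_trans (mX j p) _.
    by rewrite ler_wpM2r // ge_min lexx orbT.
  by move: h; move: (\sum_j _) (Sm p) => *; lra.
- move=> p t tM Ht; rewrite /phi.
  have h : t * Sm p <= \sum_j m j * X j p.
    rewrite /Sm mulr_sumr; apply: ler_sum => j _.
    have [->|Xn0] := eqVneq (X j p) 0; first by rewrite !mulr0.
    have Xp : 0 < X j p by rewrite lt_def Xn0 X0.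
    rewrite ler_wpM2r //; apply: lb_le_inf; first by exists (V p), p.
    move=> _ [q /= Xq <-]; rewrite le_min tM andbT; apply: Ht.
    have near a s s' : B a s != 0 -> B a s' != 0 -> `|s' - s| <= r.
      move=> /bspl_supp /andP[h1 h2] /bspl_supp /andP[h3 h4].
      have : `|r'^-1 * (s' - s)| <= 4.
        rewrite ler_norml mulrBr; move: (r'^-1 * s) (r'^-1 * s') h1 h2 h3 h4.
        by clear => *; lra.
      rewrite normrM gtr0_norm ?invr_gt0 // mulrC ler_pdivrMr // /r'.
      by move: (`|_|); clear => *; lra.
    have nz q' : X j q' != 0 -> [/\ B j.1.1 (q' 0 0) != 0, B j.1.2 (q' 0 1) != 0 & B j.2 (q' 0 2) != 0].
      by rewrite /X !mulf_eq0 !negb_or => /andP[/andP[-> ->] ->].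
    have [a1 a2 a3] := nz q (lt0r_neq0 Xq); have [b1 b2 b3] := nz p Xn0.
    apply: mxnorm_le; first exact: ltW.
    move=> i; rewrite !mxE.
    have := ord3 i.
    by case=> ->; [exact: near b1 a1|exact: near b2 a2|exact: near b3 a3].
  have : t * (1 - Sm p) <= M * (1 - Sm p).
    by rewrite ler_wpM2r // subr_ge0; case/andP: (Sm01 p).
  by move: h; move: (\sum_j _) (Sm p) => *; lra.
Qed.

End Approximation.

Section Resolvent.
Variable R : realType.
Implicit Types (p q x y : 'rV[R]_3) (v phi u : 'rV[R]_3 -> R).
Variables (w1 w2 d : 'rV[R]_2) (s mu : R).
Hypothesis mu0 : 0 < mu.

Definition steps (l : 'I_5) : 'rV[R]_2 :=
  nth 0 [:: s *: w1; - s *: w1; s *: w2; - s *: w2; - s ^+ 2 *: d] l.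

Definition avg v x : R := \sum_(l < 5) v (rtr (hstep (steps l)) x).

(* Iterates for the resolvent equation [(1 + 5 mu) v = phi + mu avg v] *)
Fixpoint vseq (m0 : R) phi (k : nat) : 'rV[R]_3 -> R :=
  if k is k'.+1 then fun x => (1 + 5 * mu)^-1 * (phi x + mu * avg (vseq m0 phi k') x)
  else fun=> m0.

Let N0 : 0 < 1 + 5 * mu.
Proof. by rewrite ltr_wpDr // ?mulr_ge0 // ltW. Qed.

Lemma avgE v x : avg v x = v (x + s *: hvec x w1) + v (x - s *: hvec x w1) +
  (v (x + s *: hvec x w2) + v (x - s *: hvec x w2)) + v (x + (- s ^+ 2) *: hvec x d).
Proof.
rewrite /avg !big_ord_recl big_ord0 /= !hvecE !hvecZ !scaleNr addr0 !addrA.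
reflexivity.
Qed.

Lemma avg_le v v' x : (forall y, v y <= v' y) -> avg v x <= avg v' x.
Proof. by move=> H; apply: ler_sum => l _. Qed.

Lemma avg_cst (c : R) x : avg (fun=> c) x = 5 * c.
Proof. by rewrite /avg sumr_const card_ord mulr_natl. Qed.

Lemma vseqS m0 phi k x :
  (1 + 5 * mu) * vseq m0 phi k.+1 x = phi x + mu * avg (vseq m0 phi k) x.
Proof. by rewrite /= mulrA mulfV ?mul1r // lt0r_neq0. Qed.

Lemma vseq_mono m0 phi k x : (forall y, m0 <= phi y) -> vseq m0 phi k x <= vseq m0 phi k.+1 x.
Proof.
move=> Hm; elim: k x => [|k IH] x.
  rewrite -(ler_pM2l N0) vseqS avg_cst /=; have := Hm x; move: mu0; nra.
rewrite -(ler_pM2l N0) !vseqS lerD2l ler_pM2l //; exact: avg_le.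
Qed.

Lemma vseq_le m0 M phi k x : m0 <= M -> (forall y, phi y <= M) -> vseq m0 phi k x <= M.
Proof.
move=> mM Hm; elim: k x => [|k IH] x //.
rewrite -(ler_pM2l N0) vseqS; have := avg_le x IH; rewrite avg_cst => h.
have := Hm x; move: h; move: (avg _ _) (phi x) => a b h1 h2.
have := ler_wpM2l (ltW mu0) h1; move: h2; nra.
Qed.

Lemma vseq_flat rho r H e m0 phi k : 0 <= e -> flat rho r H e phi ->
  flat rho r H e (vseq m0 phi k).
Proof.
move=> e0 Fp; elim: k => [|k IH] /=; first exact: flat_cst.
apply: (@flat_le _ _ _ _ ((1 + 5 * mu)^-1 * (e + mu * (#|'I_5|%:R * e)))).
  rewrite card_ord le_eqVlt; apply/orP; left; apply/eqP.
  by move: N0=> h; field; rewrite lt0r_neq0.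
apply: flatZ; first by rewrite invr_ge0 ltW.
apply: flatD => //; apply: flatZ; first exact: ltW.
rewrite /avg; apply: (flat_sum (F := fun l x => vseq m0 phi k (rtr (hstep (steps l)) x))) => l.
exact: flat_rtr.
Qed.

Lemma vseq_comparison (u f phi : 'rV[R]_3 -> R) (c lam rho r e m0 M : R) (H : seq 'rV[R]_2) k :
  lsc u ->
  (forall psi p0, class_C 2 psi -> (forall p, u p0 - psi p0 <= u p - psi p) ->
    0 <= f p0 + c * u p0 + d1 psi p0 (hvec p0 d)
         - d2 psi p0 (hvec p0 w1) - d2 psi p0 (hvec p0 w2)) ->
  mu * s ^+ 2 = lam -> 0 < lam -> 0 <= e -> 0 <= rho -> 0 < s -> s <= r -> s ^+ 2 <= r ->
  w1 \in H -> w2 \in H -> d \in H ->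
  flat rho r H e phi -> (forall y, m0 <= phi y) -> (forall y, phi y <= M) ->
  (forall y, rho < `|y| -> M <= u y) ->
  (forall y, phi y <= (1 - lam * c) * u y - lam * f y) ->
  forall x, vseq m0 phi k.+1 x <= u x + 3 * lam * e.
Proof.
move=> lu Hu mul lam0 e0 rho0 s0 sr s2r H1 H2 Hd Fp m0p pM uM pu x.
have m0M : m0 <= M by exact: le_trans (m0p 0) (pM 0).
set v := vseq m0 phi k.+1.
have Fv : flat rho r H e v by exact: vseq_flat.
have [Cv _] := Fv.
have vM y : v y <= M by exact: vseq_le.
rewrite leNgt; apply/negP => hx.
have le0 : 0 <= 3 * lam * e by rewrite mulr_ge0 // mulr_ge0 // ltW.
have [z zr zmin] := lsc_min_ball rho0 (lscB_continuous lu (class_C_cont Cv)).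
have uvx : u x - v x < - (3 * lam * e) by move: hx; move: (u x) (v x) (3 * _ * _) => *; lra.
have xr : `|x| <= rho.
  rewrite leNgt; apply/negP => /uM h.
  by move: uvx (vM x) h le0; move: (u x) (v x) (3 * _ * _); move=> *; lra.
have zx := zmin x xr.
have zglob p : u z - v z <= u p - v p.
  have [pr|/uM h] := leP `|p| rho; first exact: zmin.
  by move: zx uvx h (vM p) le0; move: (u z) (v z) (u x) (v x) (u p) (v p) (3 * _ * _); move=> *; lra.
have K := Hu v z Cv zglob.
have := flat_diff2 Fv zr H1 (s := s); rewrite (gtr0_norm s0) => /(_ sr).
have := flat_diff2 Fv zr H2 (s := s); rewrite (gtr0_norm s0) => /(_ sr).
have := flat_diff1 Fv zr Hd (t := - s ^+ 2).
rewrite normrN (ger0_norm (sqr_ge0 s)) => /(_ s2r).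
have vz : v z <= phi z + mu * (avg v z - 5 * v z).
  have := vseqS m0 phi k z; rewrite -/v.
  have : avg (vseq m0 phi k) z <= avg v z by apply: avg_le => y; exact: vseq_mono.
  move: (avg _ z) (avg v z) (v z) (phi z) => A A' V P AA.
  have := ler_wpM2l (ltW mu0) AA; nra.
have := pu z.
move: vz K; rewrite avgE.
move: zx uvx; rewrite !ler_norml.
move: (v (z + s *: hvec z w1)) (v (z - s *: hvec z w1)) (v (z + s *: hvec z w2))
  (v (z - s *: hvec z w2)) (v (z + (- s ^+ 2) *: hvec z d)) => a1 a2 b1 b2 c1.
move: (d2 v z _) (d2 v z _) (d1 v z _) (u z) (v z) (f z) (phi z) (u x - v x).
move=> D2 D2' D1 U V Fz P UV h1 h2 h3 h4 h5 /andP[_ h6] /andP[_ h7] /andP[_ h8].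
have S : a1 + a2 + (b1 + b2) + c1 - 5 * V <= s ^+ 2 * (D2 + D2' - D1 + 3 * e).
  move: h6 h7 h8; lra.
have := ler_wpM2l (ltW mu0) S; rewrite mulrA mul => S'.
have h4' := mulr_ge0 (ltW lam0) h4.
move: S' h4' h1 h2 h3 h5; lra.
Qed.

Lemma vseq_envelope n (c : 'I_n -> R) (Phi phi : 'rV[R]_3 -> R) (kap m0 D : R) k
    (q : 'I_n -> 'rV[R]_3) :
  \sum_(i < n) c i = 1 -> (forall y, Phi y <= m0 + D) ->
  (forall q : 'I_n -> 'rV[R]_3, let p := \sum_(i < n) c i *: q i in
    kap <= \sum_(i < n) c i * phi (q i) - Phi p + mu * (avg Phi p - 5 * Phi p)) ->
  kap - (5 * mu / (1 + 5 * mu)) ^+ k * (kap + D) <=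
  \sum_(i < n) c i * vseq m0 phi k (q i) - Phi (\sum_(i < n) c i *: q i).
Proof.
move=> c1 PD Hk; elim: k q => [|k IH] q.
  by rewrite expr0 mul1r /= -mulr_suml c1 mul1r; have := PD (\sum_(i < n) c i *: q i); move: (Phi _) => *; lra.
set p := \sum_(i < n) c i *: q i; rewrite -(ler_pM2l N0).
have E : (1 + 5 * mu) * (\sum_(i < n) c i * vseq m0 phi k.+1 (q i) - Phi p) =
   (\sum_(i < n) c i * phi (q i) - Phi p + mu * (avg Phi p - 5 * Phi p)) +
   mu * \sum_(l < 5) (\sum_(i < n) c i * vseq m0 phi k (rtr (hstep (steps l)) (q i))
                      - Phi (rtr (hstep (steps l)) p)).
  rewrite mulrBr mulr_sumr.
  have -> : \sum_(i < n) (1 + 5 * mu) * (c i * vseq m0 phi k.+1 (q i)) =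
      \sum_(i < n) c i * phi (q i) + mu * \sum_(i < n) c i * avg (vseq m0 phi k) (q i).
    rewrite mulr_sumr -big_split; apply: eq_bigr => i _.
    by rewrite mulrCA vseqS mulrDr; congr (_ + _); rewrite mulrCA.
  rewrite sumrB -/(avg Phi p).
  have -> : \sum_(i < n) c i * avg (vseq m0 phi k) (q i) =
    \sum_(l < 5) \sum_(i < n) c i * vseq m0 phi k (rtr (hstep (steps l)) (q i)).
    by rewrite exchange_big; apply: eq_bigr => i _; rewrite /avg mulr_sumr.
  by move: (\sum_(i < n) _) (\sum_(l < 5) _) (avg _ _) (Phi p) => *; ring.
rewrite E; apply: le_trans (lerD (Hk q) _); last first.
  apply: ler_wpM2l; first exact: ltW.
  apply: (@ler_sum _ _ _ _ (fun=> kap - (5 * mu / (1 + 5 * mu)) ^+ k * (kap + D))) => l _.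
  by have := IH (fun i => rtr (hstep (steps l)) (q i)); rewrite rtr_sum.
rewrite sumr_const card_ord -mulr_natl exprS.
rewrite le_eqVlt; apply/orP; left; apply/eqP.
have := lt0r_neq0 N0; move: ((5 * mu / (1 + 5 * mu)) ^+ k)=> z h.
by field.
Qed.

End Resolvent.

Section Envelope.
Variable R : realType.
Implicit Types (u : 'rV[R]_3 -> R) (p q x y : 'rV[R]_3).

Definition weights n (c : 'I_n -> R) := (forall i, 0 <= c i) /\ \sum_(i < n) c i = 1.

Lemma weights_le1 n (c : 'I_n -> R) : weights c -> forall i, 0 <= c i <= 1.
Proof.
move=> [c0 c1] i; rewrite c0 /= -c1 (bigD1 i) //= lerDl.
exact: sumr_ge0.
Qed.

Definition caratheodory u n := forall (c : 'I_n -> R) (q : 'I_n -> 'rV[R]_3),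
  weights c -> exists (c' : 'I_4 -> R) (q' : 'I_4 -> 'rV[R]_3),
  [/\ weights c', \sum_(i < 4) c' i *: q' i = \sum_(i < n) c i *: q i &
      \sum_(i < 4) c' i * u (q' i) <= \sum_(i < n) c i * u (q i)].

Lemma caratheodory_pad u n : caratheodory u n.+1 -> caratheodory u n.
Proof.
move=> H c q [c0 c1].
pose c' (i : 'I_n.+1) := if unlift ord0 i is Some j then c j else 0.
pose q' (i : 'I_n.+1) := if unlift ord0 i is Some j then q j else 0.
have c'0 : c' ord0 = 0 by rewrite /c' unlift_none.
have c'S i : c' (lift ord0 i) = c i by rewrite /c' liftK.
have q'S i : q' (lift ord0 i) = q i by rewrite /q' liftK.
have [|c'' [q'' [W E1 E2]]] := H c' q'.
  split; first by move=> i; rewrite /c'; case: unliftP.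
  by rewrite big_ord_recl c'0 add0r -c1; apply: eq_bigr => i _; rewrite c'S.
exists c'', q''; split => //.
- rewrite E1 big_ord_recl c'0 scale0r add0r.
  by apply: eq_bigr => i _; rewrite c'S q'S.
- apply: le_trans E2 _; rewrite big_ord_recl c'0 mul0r add0r.
  by apply: ler_sum => i _; rewrite c'S q'S.
Qed.

Lemma affine_dependence n (q : 'I_n -> 'rV[R]_3) : (4 < n)%N ->
  exists l : 'I_n -> R, [/\ exists i, l i != 0, \sum_(i < n) l i = 0 &
    \sum_(i < n) l i *: q i = 0].
Proof.
move=> n4.
pose A : 'M[R]_(n, 3 + 1) := row_mx (\matrix_(i < n) q i) (const_mx 1).
have : kermx A != 0.
  rewrite kermx_eq0 /row_free; apply/negP => /eqP rA.
  by have := rank_leq_col A; rewrite rA leqNgt n4.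
case/rowV0Pn => v /sub_kermxP vA v0.
exists (fun i => v 0 i); split.
- apply: contrapT => H; move/negP: v0; apply; apply/eqP/rowP => i; rewrite mxE.
  by apply/eqP; apply: contrapT => /negP vi; apply: H; exists i.
- move/matrixP: vA => /(_ 0 (rshift 3 0)); rewrite mxE [RHS]mxE; apply: etrans.
  by apply: eq_bigr => i _; rewrite row_mxEr mxE mulr1.
- apply/rowP => j; rewrite mxE summxE.
  move/matrixP: vA => /(_ 0 (lshift 1 j)); rewrite mxE [RHS]mxE; apply: etrans.
  by apply: eq_bigr => i _; rewrite row_mxEl !mxE.
Qed.

Lemma caratheodory_drop u n : (4 <= n)%N -> caratheodory u n -> caratheodory u n.+1.
Proof.
move=> n4 H c q [c0 c1].
have [l [[i0 li0] l1 lq lu]] : exists l : 'I_n.+1 -> R,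
    [/\ exists i, l i < 0, \sum_(i < n.+1) l i = 0, \sum_(i < n.+1) l i *: q i = 0 &
    \sum_(i < n.+1) l i * u (q i) <= 0].
  have [l [lne l1 lq]] := affine_dependence q (n4 : (4 < n.+1)%N).
  have neg (l' : 'I_n.+1 -> R) : (exists i, l' i != 0) -> \sum_(i < n.+1) l' i = 0 -> exists i, l' i < 0.
    move=> [i li] s0; apply: contrapT => h.
    have l'0 j : 0 <= l' j by rewrite leNgt; apply/negP => lj; apply: h; exists j.
    have : l' i == 0 by move/eqP: s0; rewrite psumr_eq0 // => /allP; apply; exact: mem_index_enum.
    by rewrite (negbTE li).
  have [s|s] := leP (\sum_(i < n.+1) l i * u (q i)) 0.
    by exists l; split => //; exact: neg.
  exists (fun i => - l i); split.
  - apply: neg; last by rewrite sumrN l1 oppr0.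
    by have [i li] := lne; exists i; rewrite oppr_eq0.
  - by rewrite sumrN l1 oppr0.
  - by under eq_bigr do rewrite scaleNr; rewrite sumrN lq oppr0.
  - by under eq_bigr do rewrite mulNr; rewrite sumrN oppr_le0 ltW.
have [j lj jmin] := @arg_minP _ _ _ i0 (fun i => l i < 0) (fun i => c i / - l i) li0.
pose t := c j / - l j.
have t0 : 0 <= t by rewrite divr_ge0 // oppr_ge0 ltW.
pose c' i := c i + t * l i.
have c'0 i : 0 <= c' i.
  rewrite /c'; have [li|li] := ltP (l i) 0; last by rewrite addr_ge0 // mulr_ge0.
  by have := jmin i li; rewrite -/t ler_pdivlMr ?oppr_gt0 //; move: (t) (c i) (l i) => *; lra.
have c'j : c' j = 0 by rewrite /c' /t; field; rewrite lt_eqF.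
have sumc' : \sum_(i < n.+1) c' i = 1.
  by rewrite big_split /= -mulr_sumr l1 mulr0 addr0.
have [|c'' [q'' [W E1 E2]]] := H (fun i => c' (lift j i)) (fun i => q (lift j i)).
  by split => //; rewrite -sumc' (bigD1_ord j) //= c'j add0r.
exists c'', q''; split => //.
- rewrite E1; transitivity (\sum_(i < n.+1) c' i *: q i).
    by rewrite (bigD1_ord j) //= c'j scale0r add0r.
  under eq_bigr do rewrite scalerDl -scalerA.
  by rewrite big_split /= -scaler_sumr lq scaler0 addr0.
- apply: le_trans E2 _; apply: (@le_trans _ _ (\sum_(i < n.+1) c' i * u (q i))).
    by rewrite (bigD1_ord j) //= c'j mul0r add0r.
  under eq_bigr do rewrite mulrDl -mulrA.
  by rewrite big_split /= -mulr_sumr gerDl mulr_ge0_le0.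
Qed.

Lemma caratheodoryP u n : caratheodory u n.
Proof.
have H4 : caratheodory u 4 by move=> c q W; exists c, q.
have ge k : caratheodory u (4 + k).
  by elim: k => [|k IH] //; rewrite addnS; exact: caratheodory_drop.
have : caratheodory u (n + 4) by rewrite addnC.
elim: {1}4%N => [|k IH]; first by rewrite addn0.
by rewrite addnS => /caratheodory_pad.
Qed.

Section bounded_below.
Variables (u : 'rV[R]_3 -> R) (C : R).
Hypothesis uC : forall p, - C <= u p.

Let S p := [set s | exists (c : 'I_4 -> R) (q : 'I_4 -> 'rV[R]_3),
         [/\ forall i, 0 <= c i <= 1, \sum_(i < 4) c i = 1,
             \sum_(i < 4) c i *: q i = p & s = \sum_(i < 4) c i * u (q i)]].

Let Slb p : lbound (S p) (- C).
Proof.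
move=> _ [c [q [c01 c1 _ ->]]].
rewrite -[leLHS]mul1r -c1 mulr_suml; apply: ler_sum => i _.
by rewrite ler_wpM2l //; case/andP: (c01 i).
Qed.

Let Su p : S p (u p).
Proof.
exists (fun i => (i == 0)%:R), (fun=> p); split.
- by move=> i; case: eqP; rewrite /= ?lexx ?ler01.
- by rewrite big_ord_recl /= big1 ?addr0.
- by rewrite big_ord_recl /= big1 ?addr0 ?scale1r // => i _; rewrite scale0r.
- by rewrite big_ord_recl /= big1 ?addr0 ?mul1r // => i _; rewrite mul0r.
Qed.

Let Sinf p : has_inf (S p).
Proof. by split; [exists (u p)|exists (- C)]; [exact: Su|exact: Slb]. Qed.

Lemma envelope_le_u p : convex_envelope u p <= u p.
Proof. by apply: ge_inf; [exists (- C); exact: Slb|exact: Su]. Qed.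

Lemma envelope_ge p : - C <= convex_envelope u p.
Proof. by apply: lb_le_inf; [exists (u p); exact: Su|exact: Slb]. Qed.

Lemma envelope_le n (c : 'I_n -> R) (q : 'I_n -> 'rV[R]_3) : weights c ->
  convex_envelope u (\sum_(i < n) c i *: q i) <= \sum_(i < n) c i * u (q i).
Proof.
move=> W; have [c' [q' [W' E1 E2]]] := @caratheodoryP u n c q W.
apply: le_trans E2; apply: ge_inf; first by exists (- C); exact: Slb.
by exists c', q'; split => //; [exact: weights_le1|case: W'].
Qed.

Lemma envelope_adherent p (e : R) : 0 < e -> exists (c : 'I_4 -> R) (q : 'I_4 -> 'rV[R]_3),
  [/\ weights c, \sum_(i < 4) c i *: q i = p &
      \sum_(i < 4) c i * u (q i) < convex_envelope u p + e].
Proof.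
move=> e0; have [_ [c [q [c01 c1 cq ->]]] h] := inf_adherent e0 (Sinf p).
by exists c, q; split => //; split => // i; case/andP: (c01 i).
Qed.

Lemma envelope_convex x y (t : R) : 0 <= t <= 1 ->
  convex_envelope u (t *: x + (1 - t) *: y) <=
  t * convex_envelope u x + (1 - t) * convex_envelope u y.
Proof.
move=> /andP[t0 t1]; have t1' : 0 <= 1 - t by rewrite subr_ge0.
apply/ler_addgt0Pr => e e0.
have [cx [qx [[cx0 cx1] Ex Hx]]] := envelope_adherent x e0.
have [cy [qy [[cy0 cy1] Ey Hy]]] := envelope_adherent y e0.
pose c (i : 'I_(4 + 4)) := match fintype.split i with inl j => t * cx j | inr j => (1 - t) * cy j end.
pose q (i : 'I_(4 + 4)) := match fintype.split i with inl j => qx j | inr j => qy j end.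
have cl j : c (lshift 4 j) = t * cx j by rewrite /c (unsplitK (inl j)).
have cr j : c (rshift 4 j) = (1 - t) * cy j by rewrite /c (unsplitK (inr j)).
have ql j : q (lshift 4 j) = qx j by rewrite /q (unsplitK (inl j)).
have qr j : q (rshift 4 j) = qy j by rewrite /q (unsplitK (inr j)).
have W : weights c.
  split.
    by move=> i; rewrite /c; case: (fintype.split i) => j; rewrite mulr_ge0.
  rewrite big_split_ord /=; under eq_bigr do rewrite cl.
  under [X in _ + X]eq_bigr do rewrite cr.
  by rewrite -!mulr_sumr cx1 cy1 !mulr1 addrC subrK.
have := envelope_le q W; rewrite !big_split_ord /=.
under eq_bigr do rewrite cl ql -scalerA.
under [X in convex_envelope _ (_ + X)]eq_bigr do rewrite cr qr -scalerA.
rewrite -!scaler_sumr Ex Ey => /le_trans; apply.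
under eq_bigr do rewrite cl ql -mulrA.
under [X in _ + X <= _]eq_bigr do rewrite cr qr -mulrA.
rewrite -!mulr_sumr.
move: Hx Hy; move: (\sum_(i < 4) _) (\sum_(i < 4) _) (convex_envelope u x) (convex_envelope u y) => A B X Y hA hB.
have := ler_wpM2l t0 (ltW hA); have := ler_wpM2l t1' (ltW hB).
move=> *; nra.
Qed.

Lemma envelope_locally_bounded : locally_bounded u -> locally_bounded (convex_envelope u).
Proof.
move=> lu p; have := lu p; rewrite /bounded_near => Hu.
near=> M; have hM : nbhs p [set x | `|u x| <= M] by near: M.
have CM : C <= M by near: M; apply: nbhs_pinfty_ge; exact: num_real.
apply: filterS hM => x /=; rewrite !ler_norml => /andP[_ h].
rewrite (le_trans (envelope_le_u x) h) andbT.
by apply: le_trans (envelope_ge x); rewrite lerN2.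
Unshelve. all: by end_near. Qed.

Lemma envelope_lsc : locally_bounded u -> lsc (convex_envelope u).
Proof.
move=> lu; apply/lscP => p0 a ag.
have [B B0 HB] := bounded_on_ball (`|p0| + 1) lu.
set G := convex_envelope u in ag *.
pose K := `|G p0| + B + 1.
have K0 : 0 < K by rewrite ltr_wpDl // addr_ge0 // ltW.
exists ((G p0 - a) / K); first by rewrite divr_gt0 // subr_gt0.
move=> p pd; pose tau := `|p - p0|.
have [->//|pp] := eqVneq p p0.
have tau0 : 0 < tau by rewrite normr_gt0 subr_eq0.
have tau1 : 0 < 1 + tau by rewrite ltr_wpDl.
pose p2 := p0 - tau^-1 *: (p - p0).
have p2n : `|p2| <= `|p0| + 1.
  apply: le_trans (ler_normB _ _) _; rewrite lerD2l normrZ -/tau.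
  by rewrite gtr0_norm ?invr_gt0 // mulVf // lt0r_neq0.
have Gp2 : G p2 <= B.
  by apply: le_trans (envelope_le_u _) _; apply: le_trans (ler_norm _) (HB _ p2n).
pose t := (1 + tau)^-1.
have t01 : 0 <= t <= 1.
  by rewrite /t invr_ge0 (ltW tau1) /= invf_le1 // lerDl ltW.
have tE : 1 - t = tau * t by rewrite /t; field; exact: lt0r_neq0.
have := envelope_convex p p2 t01; rewrite -/G.
have -> : t *: p + (1 - t) *: p2 = p0.
  apply/rowP => i; rewrite tE /p2 !mxE; rewrite /t; move: (p 0 i) (p0 0 i) => *.
  by field; rewrite !lt0r_neq0.
rewrite tE => h.
have h' : (1 + tau) * G p0 <= G p + tau * B.
  have := ler_wpM2l (ltW tau1) h.
  have -> : (1 + tau) * (t * G p + tau * t * G p2) = G p + tau * G p2.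
    by rewrite /t; move: (G p) (G p2) => *; field; exact: lt0r_neq0.
  by move=> /le_trans; apply; rewrite lerD2l ler_wpM2l // ltW.
move: pd; rewrite ltr_pdivlMr // -/tau.
have g1 : - (tau * G p0) <= tau * `|G p0|.
  by rewrite -mulrN ler_wpM2l ?(ltW tau0) // -normrN ler_norm.
move: h' g1; rewrite /K; move: (G p0) (G p) (`|G p0|) (tau) tau0 => *; nra.
Qed.

End bounded_below.

Lemma coercive_linear u (K : R) : 0 <= K -> coercive u ->
  exists2 rho, 0 < rho & forall p, rho <= `|p| -> K * `|p| <= u p.
Proof.
move=> K0; rewrite /coercive => /cvgeyPge /(_ K) [M [_ HM]].
pose rho := Num.max M 0 + 1.
have rM : M < rho by rewrite (le_lt_trans (y := Num.max M 0)) ?ltrDl // le_max lexx.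
have r0 : 0 < rho by rewrite (le_lt_trans (y := Num.max M 0)) ?ltrDl // le_max lexx orbT.
exists rho => // p pr.
have ne : `|p| <= euclid_norm p.
  apply: mxnorm_le; first exact: sqrtr_ge0.
  move=> i; rewrite /euclid_norm -sqrtr_sqr ler_sqrt; last first.
    by apply: sumr_ge0 => j _; exact: sqr_ge0.
  by rewrite (bigD1 i) //= lerDl; apply: sumr_ge0 => j _; exact: sqr_ge0.
have e0 : 0 < euclid_norm p by apply: lt_le_trans ne; exact: lt_le_trans pr.
have := HM _ rM => /= /le_trans h.
have : (K%:E <= (u p / euclid_norm p)%:E)%E.
  by apply: h; apply: ereal_inf_lbound; exists p => //=; exact: le_trans ne.
rewrite lee_fin ler_pdivlMr // => /(le_trans _); apply.
by rewrite ler_wpM2l.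
Qed.

End Envelope.

Section EnvelopeSupersolution.
Opaque class_C.
Variable R : realType.
Implicit Types (u g f : 'rV[R]_3 -> R) (p q x y w : 'rV[R]_3).

Lemma d1_addcst f (a : R) p w : class_C 1 f -> d1 (fun p => f p + a) p w = d1 f p w.
Proof.
move=> C; rewrite (d1D p w C (class_C_cst 1 a)) /d1 [X in _ + X]big1 ?addr0 //.
by move=> i _; rewrite partial_cst mulr0.
Qed.

Lemma d2_addcst f (a : R) p w : class_C 2 f -> d2 (fun p => f p + a) p w = d2 f p w.
Proof.
move=> C; rewrite (d2D p w C (class_C_cst 2 a)) /d2 [X in _ + X]big1 ?addr0 //.
move=> i _; rewrite big1 // => j _.
have -> : partial i (fun=> a) = (fun=> 0) :> ('rV[R]_3 -> R).
  by apply/funext => z; rewrite partial_cst.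
by rewrite partial_cst mulr0.
Qed.

Opaque class_C d1 d2 partial.

Lemma localized_test g (Phi : 'rV[R]_3 -> R) p0 (C C0 : R) :
  (forall p, - C <= g p) -> class_C 2 Phi -> (forall p, g p0 - Phi p0 <= g p - Phi p) ->
  exists (Psi : 'rV[R]_3 -> R) (C1 B : R),
  [/\ class_C 2 Psi,
      (forall p, 1 <= `|p - p0| -> Psi p = - C1) /\ C0 + 1 <= C1,
      forall p, - C1 <= Psi p <= B,
      (forall p, 1 - bump p0 p <= g p - Psi p) /\ Psi p0 = g p0 &
      forall w, d1 Psi p0 w = d1 Phi p0 w /\ d2 Psi p0 w = d2 Phi p0 w].
Proof.
move=> gC CPhi touch.
pose Phi0 p := Phi p + (g p0 - Phi p0).
have C0p : class_C 2 Phi0 := class_CD CPhi (class_C_cst 2 _).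
have gPhi0 p : Phi0 p <= g p by have := touch p; rewrite /Phi0; move: (g p) (Phi p) (g p0) (Phi p0); clear => *; lra.
have bdd rho : exists2 B, 0 < B & forall x, `|x| <= rho -> `|Phi0 x| <= B.
  by apply: bounded_on_ball; apply: continuous_locally_bounded; exact: (class_C_cont C0p).
have [B1 B10 HB1] := bdd (`|p0| + 1).
pose C1 := `|C| + `|C0| + B1 + 1.
pose Psi p := bump p0 p * (Phi0 p + C1) - C1.
have CPsi : class_C 2 Psi.
  apply: class_CB; last exact: class_C_cst.
  apply: class_CM; first exact: class_C_bump.
  exact: class_CD C0p (class_C_cst 2 _).
have hC := ler_norm C; have hC0 := ler_norm C0.
have nC := normr_ge0 C; have nC0 := normr_ge0 C0.
exists Psi, C1, B1; split; first exact: CPsi.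
- split; first by move=> p /bump_outside bp; rewrite /Psi bp mul0r sub0r.
  by rewrite /C1; move: B10 hC hC0 nC nC0; clear; lra.
- move=> p; rewrite /Psi; have b0 := bump_ge0 p0 p; have b1 := bump_le1 p0 p.
  have [h|h] := leP 1 `|p - p0|.
    rewrite (bump_outside h) mul0r sub0r lexx /= /C1.
    by move: B10 hC hC0 nC nC0; clear; lra.
  have : `|Phi0 p| <= B1.
    apply: HB1; rewrite -[p](subrK p0); apply: le_trans (ler_normD _ _) _.
    by rewrite addrC lerD2l ltW.
  rewrite ler_norml => /andP[h1 h2].
  have c10 : B1 <= C1 by rewrite /C1; move: hC hC0 nC nC0; clear; lra.
  move: (bump p0 p) (Phi0 p) (C1) b0 b1 h1 h2 c10 B10; clear => b P c b0 b1 h1 h2 c10 B10.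
  apply/andP; split; first by rewrite lerDr mulr_ge0 //; lra.
  have : b * (P + c) <= 1 * (P + c) by apply: ler_wpM2r => //; lra.
  lra.
- split; last first.
    by rewrite /Psi bump_center /Phi0; move: (g p0) (Phi p0); clear => *; ring.
  move=> p; rewrite /Psi; have b0 := bump_ge0 p0 p; have b1 := bump_le1 p0 p.
  have c1C : C + 1 <= C1 by rewrite /C1; move: B10 hC hC0 nC nC0; clear; lra.
  have g1 := gPhi0 p; have g2 := gC p.
  move: (bump p0 p) (Phi0 p) (g p) (C1) b0 b1 c1C g1 g2; clear => b P G c b0 b1 h1 h2 h3.
  have E : G - (b * (P + c) - c) = b * (G - P) + (1 - b) * (G + c) by ring.
  rewrite E; have := mulr_ge0 b0 (_ : 0 <= G - P); rewrite subr_ge0 => /(_ h2) h4.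
  have b1' : 0 <= 1 - b by lra.
  have : (1 - b) * 1 <= (1 - b) * (G + c) by apply: ler_wpM2l => //; lra.
  lra.
- move=> w; have [B2 B20 HB2] := bdd (`|p0| + `|w|).
  pose Dl p := Psi p + -1 * Phi0 p.
  have CD : class_C 2 Dl by exact: class_CD CPsi (class_CZ _ C0p).
  have [|j1 j2] := @jet0 R Dl p0 w (3 * (\sum_(i < 3) w 0 i ^+ 4) * (B2 + C1)) CD.
    move=> t t1; have := bump_jet p0 w t.
    have hP : `|Phi0 (p0 + t *: w)| <= B2.
      apply: HB2; apply: le_trans (ler_normD _ _) _; rewrite lerD2l normrZ.
      by rewrite ler_piMl.
    set q := p0 + t *: w in hP *; set K := 3 * _ => /andP[h1 h2].
    have -> : Dl q = - ((1 - bump p0 q) * (Phi0 q + C1)) by rewrite /Dl /Psi; ring.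
    rewrite normrN normrM (ger0_norm h1) mulrAC; apply: ler_pM => //.
    apply: le_trans (ler_normD _ _) _; apply: lerD => //.
    by rewrite ger0_norm // /C1; move: B10 nC nC0; clear; lra.
  have [C0p1 CPsi1] := (class_CS C0p, class_CS CPsi).
  have E1 : d1 Phi0 p0 w = d1 Phi p0 w by apply: d1_addcst; exact: class_CS.
  have E2 : d2 Phi0 p0 w = d2 Phi p0 w by exact: d2_addcst.
  split; first move: j1; last move: j2.
    rewrite (d1D p0 w CPsi1 (class_CZ _ C0p1)) (d1Zl _ _ _ C0p1) mulN1r => /eqP.
    by rewrite subr_eq0 E1 => /eqP.
  rewrite (d2D p0 w CPsi (class_CZ _ C0p)) (d2Zl _ _ _ C0p) mulN1r => /eqP.
  by rewrite subr_eq0 E2 => /eqP.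
Qed.

Lemma approx_sum n (c : 'I_n -> R) (U Th : 'rV[R]_3 -> R) p0 (C0 del : R) :
  weights c -> 0 <= C0 -> (forall p, - C0 <= U p) ->
  (forall M, exists rho, forall p, rho <= `|p| -> M <= U p) ->
  continuous Th -> 0 < del ->
  (forall q : 'I_n -> 'rV[R]_3, Th (\sum_(i < n) c i *: q i) <= \sum_(i < n) c i * U (q i)) ->
  exists phi (M : R), [/\ class_C 2 phi, exists rho, forall p, rho < `|p| -> phi p = M,
    forall p, phi p <= U p, forall p, - C0 <= phi p <= M &
    forall q : 'I_n -> 'rV[R]_3, let p := \sum_(i < n) c i *: q i in
     `|p - p0| <= 1 -> Th p - 2 * del <= \sum_(i < n) c i * phi (q i)].
Proof.
move=> [c0 c1] C00 UC Uco cTh del0 ThU.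
have [D D0 HD] := bounded_on_ball (`|p0| + 1) (continuous_locally_bounded cTh).
have [r r0 Hr] := unif_on_ball (`|p0| + 1) cTh del0.
pose M := \sum_(j < n) (D + C0) / c j.
have DC : 0 <= D + C0 by rewrite addr_ge0 // ltW.
have M0 : 0 <= M by apply: sumr_ge0 => j _; rewrite divr_ge0.
have [rho Hrho] := Uco M.
have r20 : 0 < r / 2 by rewrite divr_gt0.
have CM : - C0 <= M by apply: le_trans M0; rewrite oppr_le0.
have [phi [Cphi phio phiU phiM Hphi]] := lower_approx r20 UC CM Hrho.
have phiC p : - C0 <= phi p by apply: Hphi => // q _.
exists phi, M; split=> //; first by move=> p; rewrite phiC phiM.
move=> q p pp0.
have near i : exists q', `|q' - q i| <= r / 2 /\ Num.min (U q') M <= phi (q i) + del.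
  apply: contrapT => H.
  have {}H q' : `|q' - q i| <= r / 2 -> phi (q i) + del < Num.min (U q') M.
    by move=> h; rewrite ltNge; apply/negP => h'; apply: H; exists q'.
  have := Hphi (q i) (phi (q i) + del).
  have -> : phi (q i) + del <= M.
    have := H (q i); rewrite subrr normr0 => /(_ (ltW r20)) /ltW /le_trans; apply.
    by rewrite ge_min lexx orbT.
  move=> /(_ isT); apply/not_implyP; split.
    by move=> q' /H /ltW /le_trans; apply; rewrite ge_min lexx.
  by apply/negP; rewrite -ltNge ltrDl.
pose q' i := xget 0 [set z | `|z - q i| <= r / 2 /\ Num.min (U z) M <= phi (q i) + del].
have Hq' i : `|q' i - q i| <= r / 2 /\ Num.min (U (q' i)) M <= phi (q i) + del.
  by have [z hz] := near i; exact: (@xgetPex _ 0 [set z | `|z - q i| <= r / 2 /\ Num.min (U z) M <= phi (q i) + del] (ex_intro _ z hz)).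
have S : \sum_(i < n) c i * Num.min (U (q' i)) M - del <= \sum_(i < n) c i * phi (q i).
  rewrite lerBlDr -[del]mul1r -c1 mulr_suml -big_split /=; apply: ler_sum => i _.
  by rewrite -mulrDr ler_wpM2l //; case: (Hq' i).
have pr : `|p| <= `|p0| + 1.
  by rewrite -[p](subrK p0); apply: le_trans (ler_normD _ _) _; rewrite addrC lerD2l.
have [/existsP[i /andP[ci Ui]]|] := boolP [exists i, (0 < c i) && (M < U (q' i))].
  have h1 : D <= \sum_(i < n) c i * Num.min (U (q' i)) M.
    have minC j : - C0 <= Num.min (U (q' j)) M by rewrite le_min UC.
    rewrite (bigD1 i) //= (min_idPr (ltW Ui)).
    have ciM : D + C0 <= c i * M.
      rewrite /M (bigD1 i) //= mulrDr mulrCA mulfV ?mulr1 ?lt0r_neq0 // lerDl.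
      by rewrite mulr_ge0 // sumr_ge0 // => j _; rewrite divr_ge0.
    have : - C0 <= \sum_(j < n | j != i) c j * Num.min (U (q' j)) M.
      apply: (@le_trans _ _ (\sum_(j < n | j != i) c j * - C0)).
        rewrite -mulr_suml mulrN lerN2 ler_piMl //.
        by rewrite -c1 [leRHS](bigD1 i) //= lerDr.
      by apply: ler_sum => j _; rewrite ler_wpM2l.
    by move: ciM; move: (c i * M) (\sum_(j < n | j != i) _); clear => *; lra.
  have := HD p pr; rewrite ler_norml => /andP[_ h2].
  move: h1 h2 S; move: (\sum_(i < n) _) (\sum_(i < n) _) (Th p); clear -del0 => *; lra.
rewrite negb_exists => /forallP H.
have h1 : \sum_(i < n) c i * Num.min (U (q' i)) M = \sum_(i < n) c i * U (q' i).
  apply: eq_bigr => i _; have := H i; rewrite negb_and => /orP[ci|].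
    by have -> : c i = 0; [apply/eqP; rewrite eq_le c0 andbT leNgt|rewrite !mul0r].
  by rewrite -leNgt => /min_idPl ->.
have pd : `|\sum_(i < n) c i *: q' i - p| < r.
  rewrite /p -sumrB; apply: (@le_lt_trans _ _ (r / 2)); last first.
    by rewrite ltr_pdivrMr // ltr_pMr // ltr1n.
  apply: le_trans (ler_norm_sum _ _ _) _.
  rewrite -[leRHS]mul1r -{1}c1 mulr_suml; apply: ler_sum => i _.
  have [h _] := Hq' i; rewrite -scalerBr normrZ (ger0_norm (c0 i)).
  exact: ler_wpM2l.
have := Hr p _ pr pd; rewrite ltr_norml => /andP[h2 _].
move: h2 S (ThU q'); rewrite h1; move: (Th (\sum_(i < n) c i *: q' i)) (Th p) (\sum_(i < n) c i * U (q' i)) (\sum_(i < n) c i * phi (q i)).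
clear -del0 => *; lra.
Qed.

Lemma geometric_small (a X y : R) : 0 <= a -> a < 1 -> 0 < y -> exists k, a ^+ k.+1 * X <= y.
Proof.
move=> a0 a1 y0.
have X0 : 0 < `|X| + 1 by rewrite ltr_wpDl.
have /cvgrPdist_lt /(_ _ (divr_gt0 y0 X0)) [N _ HN] : a ^+ n @[n --> \oo] --> 0.
  by apply: cvg_expr; rewrite ger0_norm.
exists N; have := HN N.+1 (leqnSn N); rewrite /= sub0r normrN ger0_norm ?exprn_ge0 // => h.
apply: (@le_trans _ _ (a ^+ N.+1 * (`|X| + 1))).
  by rewrite ler_wpM2l ?exprn_ge0 // ler_wpDr // ler_norm.
by rewrite -ler_pdivlMr // ltW.
Qed.

End EnvelopeSupersolution.

Section LinearEnvelope.
Variable R : realType.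
Implicit Types (u g f : 'rV[R]_3 -> R) (p q x y w : 'rV[R]_3).

Lemma class_C_hvec k (eta : 'rV[R]_2) (i : 'I_3) : class_C k (fun p => hvec p eta 0 i).
Proof.
have := ord3 i.
case=> ->; rewrite /hvec; under eq_fun do rewrite row3E.
- exact: class_C_cst.
- exact: class_C_cst.
- under eq_fun do rewrite mulrC; apply: class_CZ; apply: class_CB;
    under eq_fun do rewrite mulrC; apply: class_CZ; exact: class_C_coord.
Qed.

Lemma d1_hvec_continuous f eta : class_C 1 f -> continuous (fun p => d1 f p (hvec p eta)).
Proof.
move=> C; apply: (@class_C_cont _ 0); apply: class_C_sum => i.
by apply: class_CM; [exact: class_C_hvec|exact: class_C_partial].
Qed.

Lemma d2_hvec_continuous f eta : class_C 2 f -> continuous (fun p => d2 f p (hvec p eta)).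
Proof.
move=> C; apply: (@class_C_cont _ 0); do 2![apply: class_C_sum => ?].
apply: class_CM; first by apply: class_CM; exact: class_C_hvec.
by do 2!apply: class_C_partial.
Qed.

Lemma dot_continuous (b : 'rV[R]_3) : continuous (dot b).
Proof.
apply: (@class_C_cont _ 0); apply: class_C_sum => i; apply: class_CZ.
exact: class_C_coord.
Qed.

Lemma dot_bound (b x : 'rV[R]_3) : `|dot b x| <= 3 * `|b| * `|x|.
Proof.
rewrite /dot sum3; apply: le_trans (ler_normD _ _) _.
apply: le_trans (lerD (ler_normD _ _) (lexx _)) _.
have h i : `|b 0 i * x 0 i| <= `|b| * `|x|.
  by rewrite normrM ler_pM ?ler_mxnorm.
move: (h 0) (h 1) (h 2); rewrite -mulrA; move: (`|_ * _|) (`|b 0 1 * _|) (`|b 0 2 * _|) (`|b| * _).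
by clear => *; lra.
Qed.

Opaque class_C d1 d2 partial dot.

Lemma continuousDr (f g : 'rV[R]_3 -> R) : continuous f -> continuous g ->
  continuous (fun p => f p + g p).
Proof. by move=> cf cg x; apply: continuousD; [exact: cf|exact: cg]. Qed.

Lemma continuousZr (a : R) (f : 'rV[R]_3 -> R) : continuous f -> continuous (fun p => a * f p).
Proof.
move=> cf x; apply: (@continuousM _ _ (fun=> a) f); [exact: cst_continuous|exact: cf].
Qed.

Lemma perturbed_below u f (a0 : R) (b : 'rV[R]_3) (c C : R) :
  (forall p, f p = a0 + dot b p) -> 0 <= c -> (forall p, - C <= u p) ->
  (forall K, 0 <= K -> exists2 rho, 0 < rho & forall p, rho <= `|p| -> K * `|p| <= u p) ->
  exists2 C0, 0 <= C0 & forall lam, 0 < lam -> lam <= 1 -> lam * c <= 2^-1 ->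
   (forall p, - C0 <= (1 - lam * c) * u p - lam * f p) /\
   forall M, exists rho, forall p, rho <= `|p| -> M <= (1 - lam * c) * u p - lam * f p.
Proof.
move=> fE c0 uC coer.
pose N := `|a0| + 3 * `|b|.
have N0 : 0 <= N by rewrite addr_ge0 // mulr_ge0.
have fN p : 1 <= `|p| -> `|f p| <= N * `|p|.
  move=> p1; rewrite fE; apply: le_trans (ler_normD _ _) _; rewrite mulrDl.
  by apply: lerD; [rewrite ler_peMr|exact: dot_bound].
have [rho1 rho10 H1] := coer (2 * N + 2) ltac:(by rewrite addr_ge0 // mulr_ge0).
pose rho := Num.max rho1 1.
have far lam p : 0 < lam -> lam <= 1 -> lam * c <= 2^-1 -> rho <= `|p| ->
    `|p| <= (1 - lam * c) * u p - lam * f p.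
  move=> l0 l1 lc; rewrite ge_max => /andP[/H1 h1 p1].
  have h2 : lam * f p <= N * `|p|.
    apply: le_trans (ler_norm _) _; rewrite normrM gtr0_norm //.
    by apply: le_trans (fN p p1); rewrite ler_piMl.
  have u0 : 0 <= u p by apply: le_trans h1; rewrite mulr_ge0 // addr_ge0 // mulr_ge0.
  have h3 : 2^-1 * u p <= (1 - lam * c) * u p by rewrite ler_wpM2r //; move: lc; clear; lra.
  by move: h1 h2 h3; move: (lam * f p) ((1 - lam * c) * u p) (u p) (`|p|); clear => *; nra.
have fb p : `|p| <= rho -> `|f p| <= `|a0| + 3 * `|b| * rho.
  move=> pr; rewrite fE; apply: le_trans (ler_normD _ _) _; rewrite lerD2l.
  by apply: le_trans (dot_bound _ _) _; rewrite ler_wpM2l // mulr_ge0.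
exists (`|C| + (`|a0| + 3 * `|b| * rho)).
  rewrite !addr_ge0 // mulr_ge0 ?mulr_ge0 //.
  by rewrite /rho le_max ler01 orbT.
move=> lam l0 l1 lc; split=> [p|M].
  have [pr|pr] := leP `|p| rho; last first.
    apply: le_trans (far lam p l0 l1 lc (ltW pr)); apply: (@le_trans _ _ 0) => //.
    rewrite oppr_le0 !addr_ge0 // mulr_ge0 ?mulr_ge0 //.
    by rewrite /rho le_max ler01 orbT.
  rewrite opprD; apply: lerD.
    have lc0 : 0 <= lam * c by rewrite mulr_ge0 // ltW.
    have h : - `|C| <= u p.
      by apply: le_trans (uC p); rewrite lerN2 ler_norm.
    move: (lam * c) lc lc0 h (normr_ge0 C); move: (u p) (`|C|); clear => U a z h1 h2 h3 h4.
    nra.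
  rewrite lerN2; apply: le_trans (fb p pr); apply: le_trans (ler_norm _) _.
  by rewrite normrM gtr0_norm // ler_piMl.
exists (Num.max rho M) => p; rewrite ge_max => /andP[h1 h2].
exact: le_trans h2 (far lam p l0 l1 lc h1).
Qed.

Lemma envelope_linear_super u f (a0 : R) (b : 'rV[R]_3) (c : R) (d w1 w2 : 'rV[R]_2)
    (Phi : 'rV[R]_3 -> R) p0 :
  lsc u -> locally_bounded u ->
  (forall K, 0 <= K -> exists2 rho, 0 < rho & forall p, rho <= `|p| -> K * `|p| <= u p) ->
  (forall p, f p = a0 + dot b p) -> 0 <= c ->
  (forall psi p0, class_C 2 psi -> (forall p, u p0 - psi p0 <= u p - psi p) ->
    0 <= f p0 + c * u p0 + d1 psi p0 (hvec p0 d)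
         - d2 psi p0 (hvec p0 w1) - d2 psi p0 (hvec p0 w2)) ->
  class_C 2 Phi ->
  (forall p, convex_envelope u p0 - Phi p0 <= convex_envelope u p - Phi p) ->
  0 <= f p0 + c * convex_envelope u p0 + d1 Phi p0 (hvec p0 d)
         - d2 Phi p0 (hvec p0 w1) - d2 Phi p0 (hvec p0 w2).
Proof.
move=> lu lbu coer fE c0 Hu CPhi touch; rewrite leNgt; apply/negP => neg.
set g := convex_envelope u in touch neg.
have [C uC] : exists C, forall p, - C <= u p.
  have [rho rho0 Hr] := coer 0 (lexx 0).
  have [B B0 HB] := bounded_on_ball rho lbu.
  exists B => p; have [pr|pr] := leP `|p| rho.
    by have := HB p pr; rewrite ler_norml => /andP[].
  by apply: (@le_trans _ _ 0); [rewrite oppr_le0 ltW|have := Hr p (ltW pr); rewrite mul0r].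
have gC p : - C <= g p by exact: envelope_ge.
have [C0 C00 HC0] := perturbed_below fE c0 uC coer.
have [Psi [C1 [B [CPsi [Psio C01] PsiB [gPsi Psi0] jet]]]] :=
  localized_test C0 gC CPhi touch.
set th := - (f p0 + c * g p0 + d1 Phi p0 (hvec p0 d)
         - d2 Phi p0 (hvec p0 w1) - d2 Phi p0 (hvec p0 w2)).
have th0 : 0 < th by rewrite oppr_gt0.
have CPsi1 := class_CS CPsi.
pose G p := d2 Psi p (hvec p w1) + d2 Psi p (hvec p w2) + -1 * d1 Psi p (hvec p d).
pose J p := G p + - c * Psi p + -1 * f p.
have cf : continuous f.
  have -> : f = (fun p => a0 + dot b p) by apply/funext.
  by apply: continuousDr; [exact: cst_continuous|exact: dot_continuous].
have cPsi := class_C_cont CPsi.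
have cG : continuous G.
  apply: continuousDr; first by apply: continuousDr; exact: d2_hvec_continuous.
  by apply: continuousZr; exact: d1_hvec_continuous.
have cJ : continuous J.
  by do 2?[apply: continuousDr]; rewrite //; exact: continuousZr.
have J0 : J p0 = th.
  rewrite /J /G /th Psi0; have [-> _] := jet (hvec p0 d).
  have [_ ->] := jet (hvec p0 w1); have [_ ->] := jet (hvec p0 w2).
  by move: (d1 _ _ _) (d2 _ _ _) (d2 _ _ _) (f p0) (g p0) => *; ring.
have [r1 r10 Hr1] := continuous_eps (cJ p0) (divr_gt0 th0 (ltr0n _ 2)).
pose r := Num.min r1 1; have r0 : 0 < r by rewrite lt_min r10 ltr01.
have r_le1 : r <= 1 by rewrite ge_min lexx orbT.
have [Jb Jb0 HJb] := bounded_on_ball (`|p0| + 1) (continuous_locally_bounded cJ).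
pose lam := Num.min 1 (Num.min (2 * (c + 1))^-1 (Num.min (r ^+ 4 / (2 * (Jb + th))) th^-1)).
have c10 : 0 < 2 * (c + 1) by rewrite mulr_gt0 // ltr_wpDl.
have Jt0 : 0 < 2 * (Jb + th) by rewrite mulr_gt0 // addr_gt0.
have r40 : 0 < r ^+ 4 by exact: exprn_gt0.
have l0 : 0 < lam by rewrite !lt_min ltr01 invr_gt0 c10 divr_gt0 // invr_gt0.
have [l1 l2 l3 l4] : [/\ lam <= 1, lam <= (2 * (c + 1))^-1, lam <= r ^+ 4 / (2 * (Jb + th)) & lam <= th^-1].
  by split; rewrite /lam !ge_min lexx ?orbT.
have lc : lam * c <= 2^-1.
  apply: (@le_trans _ _ (lam * (c + 1))); first by rewrite ler_wpM2l ?lerDl // ltW.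
  by move: l2; rewrite invfM -ler_pdivlMr ?ltr_wpDl // mulrC.
have lth : lam * th <= 1 by move: l4; rewrite -div1r ler_pdivlMr.
have lJ : lam * (2 * (Jb + th)) <= r ^+ 4 by move: l3; rewrite ler_pdivlMr.
have lth0 : 0 < lam * th by exact: mulr_gt0.
have [UC Uco] := HC0 lam l0 l1 lc.
set U := fun p => (1 - lam * c) * u p - lam * f p.
have lc1 : 0 <= 1 - lam * c by move: lc; clear; lra.
have del0 : 0 < lam * th / 32 by rewrite divr_gt0.
have [cw [pw [W Epw Hpw]]] := envelope_adherent uC p0 del0.
rewrite -/g in Hpw; have [cw0 cw1] := W.
pose Th p := (1 - lam * c) * (Psi p + (1 + -1 * bump p0 p)) + (- lam) * f p.
have cTh : continuous Th.
  apply: continuousDr; last exact: continuousZr.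
  apply: continuousZr; apply: continuousDr => //; apply: continuousDr; first exact: cst_continuous.
  by apply: continuousZr; exact: (class_C_cont (class_C_bump p0)).
have ThU (q : 'I_4 -> 'rV[R]_3) : Th (\sum_(i < 4) cw i *: q i) <= \sum_(i < 4) cw i * U (q i).
  set p := \sum_(i < 4) _.
  have -> : \sum_(i < 4) cw i * U (q i) =
      (1 - lam * c) * (\sum_(i < 4) cw i * u (q i)) + - lam * f p.
    have -> : f p = \sum_(i < 4) cw i * f (q i).
      rewrite fE -[a0]mul1r -cw1 mulr_suml.
      have -> : dot b p = \sum_(i < 4) cw i * dot b (q i).
        rewrite /p; elim/big_ind2: _ => [|x1 y1 x2 y2 <- <-|i _]; [exact: dot0|exact: dotD|exact: dotZ].
      by rewrite -big_split /=; apply: eq_bigr => i _; rewrite fE mulrDr.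
    rewrite !mulr_sumr -big_split /=; apply: eq_bigr => i _; rewrite /U.
    by move: (u (q i)) (f (q i)) => *; ring.
  rewrite /Th lerD2r; apply: ler_wpM2l => //.
  have := gPsi p; have : g p <= \sum_(i < 4) cw i * u (q i) by exact: envelope_le.
  by move: (\sum_(i < 4) _) (g p) (Psi p) (bump p0 p); clear => *; lra.
have [phi [M [Cphi [rphi phio] phiU phiM Hphi]]] :=
  @approx_sum R 4 cw U Th p0 C0 _ W C00 UC Uco cTh del0 ThU.
pose H := [:: w1; w2; d].
pose e := th / 96; have e0 : 0 < e by rewrite divr_gt0.
have [rho2 rho20 Hrho2] := coer 1 ler01.
pose rho := Num.max (Num.max rho2 `|M|) (`|p0| + 1).
have rho0 : 0 <= rho by rewrite !le_max (ltW rho20).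
have uM y : rho < `|y| -> M <= u y.
  move=> hy; apply: le_trans (Hrho2 y _).
    rewrite mul1r; apply: le_trans (ler_norm _) _; apply: le_trans (ltW hy).
    by rewrite !le_max lexx ?orbT.
  by apply: le_trans (ltW hy); rewrite !le_max lexx.
have [ra ra0 Fphi] := flat_exists rho H Cphi phio e0.
have PsioN p : `|p0| + 1 < `|p| -> Psi p = - C1.
  move=> hp; apply: Psio; have : `|p| <= `|p - p0| + `|p0|.
    by rewrite -{1}[p](subrK p0) ler_normD.
  by move: hp; move: (`|p|) (`|p0|) (`|p - p0|); clear => *; lra.
have [rb rb0 FPsi] := flat_exists rho H CPsi PsioN e0.
pose s := Num.min 1 (Num.min ra rb).
have s0 : 0 < s by rewrite !lt_min ltr01 ra0.
have [s1 sa sb] : [/\ s <= 1, s <= ra & s <= rb] by split; rewrite /s !ge_min lexx ?orbT.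
have s2 : s ^+ 2 <= s by rewrite expr2 ler_piMl // ltW.
pose mu := lam / s ^+ 2.
have mu0 : 0 < mu by rewrite divr_gt0 // exprn_gt0.
have muE : mu * s ^+ 2 = lam by rewrite /mu divfK // lt0r_neq0 // exprn_gt0.
have [H1 H2 Hd] : [/\ w1 \in H, w2 \in H & d \in H] by rewrite !inE !eqxx ?orbT.
pose kap := lam * th / 4.
have kap0 : 0 < kap by rewrite divr_gt0.
have key (q : 'I_4 -> 'rV[R]_3) : let p := \sum_(i < 4) cw i *: q i in
    kap <= \sum_(i < 4) cw i * phi (q i) - Psi p + mu * (avg w1 w2 d s Psi p - 5 * Psi p).
  move=> p; have [pp0|pp0] := leP 1 `|p - p0|.
    rewrite (Psio _ pp0).
    have h1 : 0 <= mu * (avg w1 w2 d s Psi p - 5 * - C1).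
      rewrite mulr_ge0 ?(ltW mu0) // subr_ge0 -(avg_cst w1 w2 d s (- C1) p).
      by apply: avg_le => y; case/andP: (PsiB y).
    have h2 : - C0 <= \sum_(i < 4) cw i * phi (q i).
      rewrite -[leLHS]mul1r -cw1 mulr_suml; apply: ler_sum => i _.
      by apply: ler_wpM2l => //; case/andP: (phiM (q i)).
    move: h1 h2 C01 lth; rewrite /kap; move: (mu * _) (\sum_(i < 4) _) (lam * th); clear => *; lra.
  have prho : `|p| <= rho.
    rewrite !le_max; apply/orP; right; rewrite -[p](subrK p0).
    by apply: le_trans (ler_normD _ _) _; rewrite addrC lerD2l ltW.
  have h1 := Hphi q (ltW pp0); rewrite -/p in h1.
  have := flat_diff2 FPsi prho H1 (s := s); rewrite (gtr0_norm s0) => /(_ sb).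
  have := flat_diff2 FPsi prho H2 (s := s); rewrite (gtr0_norm s0) => /(_ sb).
  have := flat_diff1 FPsi prho Hd (t := - s ^+ 2).
  rewrite normrN (ger0_norm (sqr_ge0 s)) => /(_ (le_trans s2 sb)).
  rewrite !ler_norml => /andP[f1 _] /andP[f2 _] /andP[f3 _].
  have A : s ^+ 2 * (G p - 3 * e) <= avg w1 w2 d s Psi p - 5 * Psi p.
    rewrite avgE /G; move: f1 f2 f3.
    move: (Psi (p + s *: hvec p w1)) (Psi (p - s *: hvec p w1)) (Psi (p + s *: hvec p w2))
      (Psi (p - s *: hvec p w2)) (Psi (p + (- s ^+ 2) *: hvec p d)) => a1 a2 b1 b2 c1'.
    move: (d2 Psi p _) (d2 Psi p _) (d1 Psi p _) (Psi p) (s ^+ 2); clear => *; lra.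
  have := ler_wpM2l (ltW mu0) A; rewrite mulrA muE => h2.
  have h3 : lam * th / 2 <= (1 - lam * c) * (1 + -1 * bump p0 p) + lam * J p.
    have b1 := bump_le1 p0 p.
    have [pr|pr] := ltP `|p - p0| r.
      have := Hr1 p; rewrite J0 => /(_ (lt_le_trans pr _)).
      rewrite /r ge_min lexx => /(_ isT); rewrite ltr_norml => /andP[h _].
      have h4 : lam * (th / 2) <= lam * J p.
        by apply: ler_wpM2l; [exact: ltW|move: h; move: (J p); clear => *; lra].
      have h5 : 0 <= (1 - lam * c) * (1 + -1 * bump p0 p).
        by apply: mulr_ge0 => //; move: b1; move: (bump p0 p); clear => *; lra.
      by move: h4 h5; move: (lam * J p) ((1 - lam * c) * _); clear => *; lra.
    have := bump_away (ltW r0) r_le1 pr => hb.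
    have : `|J p| <= Jb.
      apply: HJb; rewrite -[p](subrK p0); apply: le_trans (ler_normD _ _) _.
      by rewrite addrC lerD2l ltW.
    rewrite ler_norml => /andP[hJ _].
    have h4 : lam * - Jb <= lam * J p by apply: ler_wpM2l => //; exact: ltW.
    have h5 : 2^-1 * r ^+ 4 <= (1 - lam * c) * (1 + -1 * bump p0 p).
      apply: ler_pM; rewrite ?invr_ge0 ?(ltW r40) //.
        by move: lc; clear; lra.
      by move: hb; move: (bump p0 p) (r ^+ 4); clear => *; lra.
    move: h4 h5 lJ; move: (lam * J p) ((1 - lam * c) * _) (r ^+ 4); clear -lth0 => *; lra.
  have h4 : lam * (3 * e) = lam * th / 32 by rewrite /e; field.
  have {}h2 : lam * G p - lam * th / 32 <= mu * (avg w1 w2 d s Psi p - 5 * Psi p).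
    by rewrite -h4 -mulrBr.
  move: h1 h2 h3; rewrite /Th /J /kap.
  move: (\sum_(i < 4) cw i * phi (q i)) (avg w1 w2 d s Psi p) (G p) (Psi p) (f p) (bump p0 p).
  move=> S A' g' P F b'; move: (mu * (A' - 5 * P)) => A''.
  clear -lth0 => h1 h2 h3; lra.
have m0phi y : - C0 <= phi y by case/andP: (phiM y).
have phileM y : phi y <= M by case/andP: (phiM y).
have N0 : 0 < 1 + 5 * mu by rewrite ltr_wpDr // mulr_ge0 // ltW.
have [k Hk] : exists k, (5 * mu / (1 + 5 * mu)) ^+ k.+1 * (kap + (B + C0)) <= kap / 2.
  apply: geometric_small.
  - by rewrite divr_ge0 ?(ltW N0) // mulr_ge0 // ltW.
  - by rewrite ltr_pdivrMr // mul1r ltrDr.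
  - by rewrite divr_gt0.
have PsiD y : Psi y <= - C0 + (B + C0).
  by rewrite addrCA addNr addr0; case/andP: (PsiB y).
have L := vseq_envelope mu0 k.+1 pw cw1 PsiD key.
have V := vseq_comparison mu0 k lu Hu muE l0 (ltW e0) rho0 s0 sa (le_trans s2 sa) H1 H2 Hd
  Fphi m0phi phileM uM phiU.
have V' : \sum_(i < 4) cw i * vseq w1 w2 d s mu (- C0) phi k.+1 (pw i) <=
    \sum_(i < 4) cw i * u (pw i) + 3 * lam * e.
  have -> : 3 * lam * e = \sum_(i < 4) cw i * (3 * lam * e) by rewrite -mulr_suml cw1 mul1r.
  by rewrite -big_split /=; apply: ler_sum => i _; rewrite -mulrDr; exact: ler_wpM2l (cw0 i) _ _ (V (pw i)).
rewrite Epw Psi0 in L.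
have h4 : 3 * lam * e = lam * th / 32 by rewrite /e; field.
rewrite h4 in V'.
move: L V' Hpw Hk; rewrite /kap.
move: ((_ / _) ^+ _ * _) (\sum_(i < 4) _) (\sum_(i < 4) _) (g p0); clear -lth0 => *; lra.
Qed.

End LinearEnvelope.

Section Exploding.
Variable R : realType.
Implicit Types (p q x y w : 'rV[R]_3).

Opaque class_C.

Lemma jet_line (Phi : 'rV[R]_3 -> R) p w (a : R -> R) (l : R) : class_C 2 Phi ->
  (forall t, is_derive t (1 : R) (fun t => Phi (p + t *: w)) (a t)) ->
  is_derive 0 (1 : R) a l -> d1 Phi p w = a 0 /\ d2 Phi p w = l.
Proof.
move=> C D D2; have C1 := class_CS C.
have E t : d1 Phi (p + t *: w) w = a t.
  exact: (is_derive_uniq (d1_line p w t C1) (D t)).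
split; first by have := E 0; rewrite scale0r addr0.
apply: (is_derive_uniq (d2_line0 p w C)).
by rewrite (_ : (fun t : R => d1 Phi _ _) = a) //; apply/funext.
Qed.

Definition expo (al be k x : R) := al * expR (k * x) + be * expR (- k * x).

Lemma is_derive_expo al be k (x : R) :
  is_derive x (1 : R) (expo al be k) (expo (k * al) (- k * be) k x).
Proof.
rewrite /expo; apply: is_derive_eq; rewrite /GRing.scale /=; ring.
Qed.

Lemma class_C_expo (f : 'rV[R]_3 -> R) al be k : class_C 2 f ->
  class_C 2 (fun p => expo al be k (f p)).
Proof.
apply: (@class_C_comp R 2 (fun n => match n with 0 => expo al be k
  | 1 => expo (k * al) (- k * be) k | _ => expo (k * (k * al)) (- k * (- k * be)) k end)).
  by move=> [|[|//]] t _; exact: is_derive_expo.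
move=> t; apply/differentiable_continuous/derivable1_diffP.
by case: (is_derive_expo (k * (k * al)) (- k * (- k * be)) k t).
Qed.

Section coordinates.
(* [s], [tau] and [ze] are coordinates in which the two horizontal fields become
   d/ds - tau d/dze and d/dtau. *)
Variables (s tau ze : 'rV[R]_3 -> R) (es et : 'rV[R]_2 -> R).
Hypotheses (Cs : class_C 2 s) (Ctau : class_C 2 tau) (Cze : class_C 2 ze).
Hypothesis s_line : forall p eta t, s (p + t *: hvec p eta) = s p + t * es eta.
Hypothesis tau_line : forall p eta t, tau (p + t *: hvec p eta) = tau p + t * et eta.
Hypothesis ze_line : forall p eta t, ze (p + t *: hvec p eta) =
  ze p - es eta * (tau p * t + et eta * t ^+ 2 / 2).
Hypothesis s_onto : forall a, exists p, s p = a.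

Definition hgt p := 1 + tau p ^+ 2 + ze p ^+ 2.

Lemma hgt_ge1 p : 1 <= hgt p.
Proof. by rewrite /hgt -addrA lerDl addr_ge0 // sqr_ge0. Qed.

Definition testf al be k p := expo al be k (s p) * hgt p.

Lemma class_C_testf al be k : class_C 2 (testf al be k).
Proof.
apply: class_CM; first exact: class_C_expo.
apply: class_CD; last exact: class_C_sqr.
apply: class_CD; [exact: class_C_cst|exact: class_C_sqr].
Qed.

Definition hgt1 p eta := 2 * et eta * tau p - 2 * es eta * tau p * ze p.
Definition hgt2 p eta := 2 * et eta ^+ 2 - 2 * es eta * et eta * ze p + 2 * es eta ^+ 2 * tau p ^+ 2.

Lemma testf_jet al be k p eta :
  d1 (testf al be k) p (hvec p eta) =
    es eta * expo (k * al) (- k * be) k (s p) * hgt p + expo al be k (s p) * hgt1 p eta /\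
  d2 (testf al be k) p (hvec p eta) =
    es eta ^+ 2 * k ^+ 2 * expo al be k (s p) * hgt p +
    2 * es eta * expo (k * al) (- k * be) k (s p) * hgt1 p eta +
    expo al be k (s p) * hgt2 p eta.
Proof.
set S := s p; set T := tau p; set Z := ze p; set es' := es eta; set et' := et eta.
pose E t := expo al be k (S + t * es').
pose E1 t := expo (k * al) (- k * be) k (S + t * es').
pose Tt t := T + t * et'.
pose Zt t := Z - es' * (T * t + et' * t ^+ 2 / 2).
pose H t := 1 + Tt t ^+ 2 + Zt t ^+ 2.
pose H1 t := 2 * et' * Tt t - 2 * es' * Tt t * Zt t.
have Dl (t : R) : is_derive t (1 : R) (fun t : R => S + t * es') es'.
  by apply: is_derive_eq; rewrite /GRing.scale /=; ring.
have DE (t : R) : is_derive t (1 : R) E (E1 t * es').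
  exact: (@is_derive1_comp R (expo al be k) (fun t => S + t * es') t _ _ (is_derive_expo al be k _) (Dl t)).
have DE1 (t : R) : is_derive t (1 : R) E1 (k ^+ 2 * E t * es').
  have := @is_derive1_comp R (expo (k * al) (- k * be) k) (fun t => S + t * es') t _ _ (is_derive_expo _ _ k _) (Dl t).
  have -> : expo (k * (k * al)) (- k * (- k * be)) k (S + t * es') = k ^+ 2 * E t.
    by rewrite /E /expo; ring.
  by [].
have DT (t : R) : is_derive t (1 : R) Tt et'.
  by rewrite /Tt; apply: is_derive_eq; rewrite /GRing.scale /=; ring.
have DZ (t : R) : is_derive t (1 : R) Zt (- es' * Tt t).
  have D2 : is_derive t (1 : R) (fun t : R => t ^+ 2) (2 * t).
    by apply: is_derive_eq; rewrite /GRing.scale /= ; ring.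
  have -> : Zt = fun t => Z + - (es' * T) * t + - (es' * et' / 2) * (t ^+ 2).
    by apply/funext => z; rewrite /Zt; ring.
  have := is_deriveD (is_deriveD (is_derive_cst Z t (1 : R)) (is_deriveZ (- (es' * T)) (is_derive_id t (1 : R))))
     (is_deriveZ (- (es' * et' / 2)) D2).
  have -> : 0 + - (es' * T) *: (1 : R) + - (es' * et' / 2) *: (2 * t) = - es' * Tt t.
    by rewrite /Tt /GRing.scale /=; field.
  by [].
have Dsq (f : R -> R) (l t : R) : is_derive t (1 : R) f l -> is_derive t (1 : R) (fun t => f t ^+ 2) (2 * f t * l).
  move=> Df; have := is_deriveM Df Df.
  have -> : f t *: l + f t *: l = 2 * f t * l by rewrite /GRing.scale /=; ring.
  by [].
have DH (t : R) : is_derive t (1 : R) H (H1 t).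
  have := is_deriveD (is_deriveD (is_derive_cst (1 : R) t (1 : R)) (Dsq _ _ _ (DT t))) (Dsq _ _ _ (DZ t)).
  have -> : 0 + 2 * Tt t * et' + 2 * Zt t * (- es' * Tt t) = H1 t by rewrite /H1; ring.
  by [].
have DH1 (t : R) : is_derive t (1 : R) H1 (2 * et' ^+ 2 - 2 * es' * et' * Zt t + 2 * es' ^+ 2 * Tt t ^+ 2).
  have := is_deriveB (is_deriveZ (2 * et') (DT t)) (is_deriveZ (2 * es') (is_deriveM (DT t) (DZ t))).
  have -> : (2 * et') *: et' - (2 * es') *: (Tt t *: (- es' * Tt t) + Zt t *: et') =
     2 * et' ^+ 2 - 2 * es' * et' * Zt t + 2 * es' ^+ 2 * Tt t ^+ 2.
    by rewrite /GRing.scale /=; ring.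
  congr is_derive; apply/funext => z; rewrite /H1; change (2 * et' * Tt z - 2 * es' * (Tt z * Zt z) = 2 * et' * Tt z - 2 * es' * Tt z * Zt z).
  by ring.
have [||J1 J2] := @jet_line (testf al be k) p (hvec p eta) (fun t => E t * H1 t + H t * (E1 t * es'))
  ((E 0 * (2 * et' ^+ 2 - 2 * es' * et' * Zt 0 + 2 * es' ^+ 2 * Tt 0 ^+ 2) + H1 0 * (E1 0 * es'))
   + (H 0 * (k ^+ 2 * E 0 * es' * es') + (E1 0 * es') * H1 0)) (class_C_testf al be k).
- move=> t; rewrite (_ : (fun t : R => _) = fun t => E t * H t).
    exact: is_deriveM (DE t) (DH t).
  by apply/funext => z; rewrite /testf /hgt s_line tau_line ze_line.
- have D1 := is_deriveM (DE 0) (DH1 0).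
  have DE2 : is_derive 0 (1 : R) (fun t => E1 t * es') (k ^+ 2 * E 0 * es' * es').
    have := is_deriveZ es' (DE1 0).
    have -> : es' *: (k ^+ 2 * E 0 * es') = k ^+ 2 * E 0 * es' * es' by rewrite /GRing.scale /=; ring.
    by congr is_derive; apply/funext => z; exact: mulrC.
  exact: is_deriveD D1 (is_deriveM (DH 0) DE2).
rewrite J1 J2 /E /E1 /H /H1 /Tt /Zt /hgt /hgt1 /hgt2 -/S -/T -/Z -/es' -/et'.
rewrite (_ : S + 0 * es' = S); last by ring.
move: (expo al be k S) (expo (k * al) (- k * be) k S); move=> *; split; by field.
Qed.


Lemma expo_bound (al be k x : R) : `|al| <= 1 -> `|be| <= 1 -> 0 <= k ->
  `|expo al be k x| <= expo 1 1 k x /\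
  `|expo (k * al) (- k * be) k x| <= k * expo 1 1 k x.
Proof.
move=> ha hb k0; rewrite /expo; have e1 := expR_ge0 (k * x); have e2 := expR_ge0 (- k * x).
have h (a b : R) : `|a| <= 1 -> `|b| <= 1 ->
    `|a * expR (k * x) + b * expR (- k * x)| <= 1 * expR (k * x) + 1 * expR (- k * x).
  move=> h1 h2; apply: le_trans (ler_normD _ _) _; rewrite !normrM !(ger0_norm (expR_ge0 _)).
  by apply: lerD; rewrite ler_wpM2r.
split; first exact: h.
have -> : k * al * expR (k * x) + - k * be * expR (- k * x) =
   k * (al * expR (k * x) + (- be) * expR (- k * x)) by ring.
by rewrite normrM (ger0_norm k0) ler_wpM2l // h // normrN.
Qed.

Lemma expo_ge (k x : R) : 1 <= k -> 1 + `|x| <= expo 1 1 k x.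
Proof.
move=> k1; rewrite /expo !mul1r.
have k0 : 0 <= k by apply: le_trans k1.
have h (y : R) : 0 <= y -> 1 + y <= expR (k * y).
  move=> y0; apply: le_trans (expR_ge1Dx _); rewrite lerD2l ler_peMl //.
have [x0|x0] := leP 0 x.
  by rewrite ger0_norm // ler_wpDr ?expR_ge0 // h.
rewrite ltr0_norm // ler_wpDl ?expR_ge0 //; have := h (- x); rewrite oppr_ge0 => /(_ (ltW x0)).
by rewrite mulrN mulNr.
Qed.


Lemma hgt1_bound p eta : `|hgt1 p eta| <= (`|et eta| + `|es eta|) * hgt p.
Proof.
rewrite /hgt1 /hgt; move: (tau p) (ze p) (et eta) (es eta) => T Z a b.
apply: le_trans (ler_normB _ _) _; rewrite [leRHS]mulrDl; apply: lerD.
  rewrite -mulrA mulrCA normrM ler_wpM2l // normrM gtr0_norm //.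
  rewrite -(real_normK (num_real T)); move: (`|T|) (sqr_ge0 Z) (sqr_ge0 (`|T| - 1)) => *; nra.
rewrite -!mulrA mulrCA normrM ler_wpM2l // !normrM gtr0_norm //.
rewrite -(real_normK (num_real T)) -(real_normK (num_real Z)).
have := sqr_ge0 (`|T| - `|Z|); move: (`|T|) (`|Z|) => *; nra.
Qed.

Lemma hgt2_bound p eta : `|hgt2 p eta| <=
  (2 * et eta ^+ 2 + `|es eta * et eta| + 2 * es eta ^+ 2) * hgt p.
Proof.
rewrite /hgt2 /hgt; move: (tau p) (ze p) (et eta) (es eta) => T Z a b.
have e1 : 2 * a ^+ 2 <= 2 * a ^+ 2 * (1 + T ^+ 2 + Z ^+ 2).
  apply: ler_peMr; first by rewrite mulr_ge0 // sqr_ge0.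
  by rewrite -addrA lerDl addr_ge0 // sqr_ge0.
have e2 : `|2 * b * a * Z| <= `|b * a| * (1 + T ^+ 2 + Z ^+ 2).
  rewrite (_ : 2 * b * a * Z = (b * a) * (2 * Z)); last by ring.
  rewrite normrM ler_wpM2l // normrM gtr0_norm //.
  rewrite -(real_normK (num_real Z)); move: (`|Z|) (sqr_ge0 T) (sqr_ge0 (`|Z| - 1)) => *; nra.
have e3 : 2 * b ^+ 2 * T ^+ 2 <= 2 * b ^+ 2 * (1 + T ^+ 2 + Z ^+ 2).
  apply: ler_wpM2l; first by rewrite mulr_ge0 // sqr_ge0.
  by move: (sqr_ge0 Z); move: (Z ^+ 2) (T ^+ 2) => *; lra.
apply: le_trans (ler_normD _ _) _; rewrite [leRHS]mulrDl; apply: lerD; last first.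
  by rewrite ger0_norm // mulr_ge0 ?sqr_ge0 // mulr_ge0 // sqr_ge0.
apply: le_trans (ler_normB _ _) _; rewrite [leRHS]mulrDl; apply: lerD => //.
by rewrite ger0_norm // mulr_ge0 // sqr_ge0.
Qed.

Variables (f : 'rV[R]_3 -> R) (Q0 c : R) (d w1 w2 : 'rV[R]_2).
Hypotheses (Q00 : 0 <= Q0) (c0 : 0 <= c).
Hypothesis f_bound : forall p, f p <= Q0 * ((1 + `|s p|) * hgt p).

Definition explodes := exists x0, forall N, 1 <= N -> exists Phi : 'rV[R]_3 -> R,
  [/\ class_C 2 Phi, forall p, f p + c * Phi p + d1 Phi p (hvec p d)
        - d2 Phi p (hvec p w1) - d2 Phi p (hvec p w2) <= 0 & N <= Phi x0].

Lemma explode_of al be k x0 : 1 <= k -> 1 <= testf al be k x0 ->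
  (forall p, Q0 * (expo 1 1 k (s p) * hgt p) + c * testf al be k p
      + d1 (testf al be k) p (hvec p d) - d2 (testf al be k) p (hvec p w1)
      - d2 (testf al be k) p (hvec p w2) <= 0) -> explodes.
Proof.
move=> k1 t1 H; exists x0 => N N1; exists (fun p => N * testf al be k p).
have N0 : 0 <= N by apply: le_trans N1.
have C := class_C_testf al be k; have C1 := class_CS C.
split; first exact: class_CZ.
  move=> p; rewrite (d1Zl _ _ _ C1) !(d2Zl _ _ _ C).
  have h1 : f p <= N * (Q0 * (expo 1 1 k (s p) * hgt p)).
    have X0 : 0 <= Q0 * (expo 1 1 k (s p) * hgt p).
      rewrite !mulr_ge0 //; last by apply: le_trans (hgt_ge1 p).
      by apply: le_trans (expo_ge (s p) k1); rewrite addr_ge0.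
    apply: le_trans (f_bound p) _; apply: (@le_trans _ _ (Q0 * (expo 1 1 k (s p) * hgt p))).
      apply: ler_wpM2l => //; apply: ler_wpM2r; first by apply: le_trans (hgt_ge1 p).
      exact: expo_ge.
    by rewrite ler_peMl.
  have := mulr_ge0_le0 N0 (H p); move: h1.
  move: (Q0 * _) (testf _ _ _ p) (d1 _ _ _) (d2 _ _ _) (d2 _ _ _) (f p) => *; nra.
by rewrite ler_peMr // ?(le_trans _ N1).
Qed.

Lemma explode_diffusion : es w1 != 0 \/ es w2 != 0 -> explodes.
Proof.
move=> w0.
pose e := es w1 ^+ 2 + es w2 ^+ 2.
have e0 : 0 < e.
  case: w0 => w0; rewrite /e; [apply: ltr_pwDl|apply: ltr_wpDl]; rewrite ?sqr_ge0 //;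
  by rewrite lt_def sqr_ge0 sqrf_eq0 w0.
pose A1 eta := `|es eta| + (`|et eta| + `|es eta|).
pose A2 eta := 2 * `|es eta| * (`|et eta| + `|es eta|) +
   (2 * et eta ^+ 2 + `|es eta * et eta| + 2 * es eta ^+ 2).
have A10 eta : 0 <= A1 eta by rewrite !addr_ge0.
have A20 eta : 0 <= A2 eta.
  by rewrite /A2; do ?[done | apply: sqr_ge0 | apply: addr_ge0 | apply: mulr_ge0].
pose Q := Q0 + c + A1 d + A2 w1 + A2 w2.
have Qp : 0 <= Q by rewrite /Q; do ?[done | apply: addr_ge0 | exact: A10 | exact: A20].
pose k := 1 + Q / e.
have k1 : 1 <= k by rewrite lerDl divr_ge0 // ltW.
have k0 : 0 <= k by apply: le_trans k1.
have ek : Q <= e * k by rewrite mulrC -ler_pdivrMr // lerDr.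
have [x0 sx0] := s_onto 0.
have n1 : `|1 : R| <= 1 by rewrite normr1.
have C1 p : 1 <= expo 1 1 k (s p) by apply: le_trans (expo_ge (s p) k1); rewrite lerDl.
apply: (@explode_of 1 1 k x0) => //.
  by rewrite /testf; apply: mulr_ege1; [exact: C1|exact: hgt_ge1].
move=> p; have [J1 _] := testf_jet 1 1 k p d.
have [_ J2] := testf_jet 1 1 k p w1; have [_ J3] := testf_jet 1 1 k p w2.
rewrite J1 J2 J3 {J1 J2 J3} /testf.
have [_ hE1] := expo_bound (s p) n1 n1 k0.
have hh := hgt_ge1 p; have cc := C1 p.
set C := expo 1 1 k (s p) in hE1 cc *; set E1 := expo (k * 1) (- k * 1) k (s p) in hE1 *.
set h := hgt p in hh *.
have C0 : 0 <= C by apply: le_trans cc.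
have h0 : 0 <= h by apply: le_trans hh.
pose X := C * h; have X0 : 0 <= X by exact: mulr_ge0.
have kX : X <= k * X by rewrite ler_peMl.
have B1 : es d * E1 * h + C * hgt1 p d <= k * A1 d * X.
  have b1 : es d * E1 * h <= `|es d| * (k * X).
    apply: le_trans (ler_norm _) _; rewrite !normrM (ger0_norm h0) -mulrA ler_wpM2l //.
    by rewrite /X mulrA ler_wpM2r.
  have b2 : C * hgt1 p d <= (`|et d| + `|es d|) * (k * X).
    apply: (@le_trans _ _ (C * ((`|et d| + `|es d|) * h))).
      by rewrite ler_wpM2l //; apply: le_trans (ler_norm _) (hgt1_bound p d).
    by rewrite mulrCA -/X ler_wpM2l // addr_ge0.
  rewrite (_ : k * A1 d * X = A1 d * (k * X)); last by ring.
  by rewrite /A1 [leRHS]mulrDl; exact: lerD.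
have B2 eta : - (es eta ^+ 2 * k ^+ 2 * C * h + 2 * es eta * E1 * hgt1 p eta + C * hgt2 p eta)
    <= - es eta ^+ 2 * k * (k * X) + A2 eta * (k * X).
  have b1 : - (2 * es eta * E1 * hgt1 p eta) <= 2 * `|es eta| * (`|et eta| + `|es eta|) * (k * X).
    apply: le_trans (ler_norm _) _; rewrite normrN !normrM [`|2|]gtr0_norm //.
    rewrite -!mulrA ler_wpM2l // ler_wpM2l //.
    apply: le_trans (ler_pM (normr_ge0 _) (normr_ge0 _) hE1 (hgt1_bound p eta)) _.
    by rewrite /X le_eqVlt; apply/orP; left; apply/eqP; rewrite /h; ring.
  have b2 : - (C * hgt2 p eta) <= (2 * et eta ^+ 2 + `|es eta * et eta| + 2 * es eta ^+ 2) * (k * X).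
    apply: (@le_trans _ _ (C * ((2 * et eta ^+ 2 + `|es eta * et eta| + 2 * es eta ^+ 2) * h))).
      rewrite -mulrN ler_wpM2l //; apply: le_trans (ler_norm _) _.
      by rewrite normrN; exact: hgt2_bound.
    rewrite mulrCA -/X ler_wpM2l //.
    by do ?[done | apply: sqr_ge0 | apply: addr_ge0 | apply: mulr_ge0].
  have b3 : es eta ^+ 2 * k ^+ 2 * C * h = es eta ^+ 2 * k * (k * X) by rewrite /X; ring.
  by move: b1 b2; rewrite b3 /A2; move: (k * X) => *; lra.
have B3 := B2 w1; have B4 := B2 w2.
have B5 : Q0 * X <= Q0 * (k * X) by rewrite ler_wpM2l.
have B6 : c * X <= c * (k * X) by rewrite ler_wpM2l.
have B7 : Q * (k * X) <= e * k * (k * X) by rewrite ler_wpM2r // mulr_ge0.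
move: B1 B3 B4 B5 B6 B7; rewrite /Q /e /X.
move: (A1 d) (A2 w1) (A2 w2) (hgt1 p d) (hgt2 p w1) (hgt1 p w1) (hgt2 p w2) (hgt1 p w2).
move: (es w1) (es w2) (es d) => *; nra.
Qed.

Lemma explode_transport : es w1 = 0 -> es w2 = 0 -> et w1 = 0 -> et w2 = 0 ->
  es d != 0 -> explodes.
Proof.
move=> s1 s2 t1 t2 d0.
have a0 : 0 < `|es d| by rewrite normr_gt0.
pose sg := Num.sg (es d).
have sgn : `|sg| <= 1 by rewrite normr_sg d0.
pose Q := Q0 + c + (`|et d| + `|es d|).
have Qp : 0 <= Q by rewrite /Q; do ?[done | apply: addr_ge0].
pose k := 1 + Q / `|es d|.
have k1 : 1 <= k by rewrite lerDl divr_ge0.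
have k0 : 0 <= k by apply: le_trans k1.
have ek : Q <= `|es d| * k by rewrite mulrC -ler_pdivrMr // lerDr.
have [x0 sx0] := s_onto (- sg).
apply: (@explode_of (- sg) sg k x0) => //.
  rewrite /testf sx0; apply: mulr_ege1; last exact: hgt_ge1.
  have h : 1 <= expR k - expR (- k).
    have := expR_ge1Dx k; have : expR (- k) <= 1 by rewrite -expR0 ler_expR oppr_le0.
    by move: k1; move: (expR k) (expR (- k)) => *; lra.
  have [->|->] : sg = 1 \/ sg = -1 by rewrite /sg; move: d0; case: sgrP; auto.
    by rewrite /expo !mulrN1 opprK mulN1r mul1r addrC.
  by rewrite /expo opprK !mulr1 mulN1r mul1r.
move=> p; have [J1 _] := testf_jet (- sg) sg k p d.
have [_ J2] := testf_jet (- sg) sg k p w1; have [_ J3] := testf_jet (- sg) sg k p w2.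
rewrite J1 J2 J3 {J1 J2 J3} /hgt2 /testf s1 s2 t1 t2.
have := @expo_bound (- sg) sg k (s p); rewrite normrN => /(_ sgn sgn k0) [hE _].
have E1E : expo (k * - sg) (- k * sg) k (s p) = - sg * (k * expo 1 1 k (s p)).
  by rewrite /expo; ring.
rewrite E1E.
have cc : 1 <= expo 1 1 k (s p) by apply: le_trans (expo_ge (s p) k1); rewrite lerDl.
have hh := hgt_ge1 p.
set C := expo 1 1 k (s p) in hE cc *; set E := expo (- sg) sg k (s p) in hE *.
set h := hgt p in hh *.
have C0 : 0 <= C by apply: le_trans cc.
have h0 : 0 <= h by apply: le_trans hh.
pose X := C * h; have X0 : 0 <= X by exact: mulr_ge0.
have B1 : es d * (- sg * (k * C)) * h = - `|es d| * k * X.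
  by rewrite normrEsg -/sg /X; ring.
have B2 : E * hgt1 p d <= (`|et d| + `|es d|) * X.
  apply: le_trans (ler_norm _) _; rewrite normrM.
  apply: le_trans (ler_pM (normr_ge0 _) (normr_ge0 _) hE (hgt1_bound p d)) _.
  by rewrite /X mulrCA.
have B3 : c * (E * h) <= c * X.
  by rewrite ler_wpM2l // /X ler_wpM2r // (le_trans (ler_norm _)).
have B4 : Q * X <= `|es d| * k * X by rewrite ler_wpM2r.
move: B1 B2 B3 B4; rewrite /Q -/X.
move: (hgt1 p d) (`|es d|) (es d * (- sg * (k * C)) * h) => *; nra.
Qed.

End coordinates.

End Exploding.

Section Supersolutions.
Variable R : realType.
Implicit Types (p q x y : 'rV[R]_3) (F : operator R).

Opaque class_C d1 d2 partial.

Lemma qformB (A B : 'M[R]_2) w : qform (A - B) w = qform A w - qform B w.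
Proof.
rewrite /qform mulmxBr mulmxBl.
by have -> : forall A B : 'M[R]_1, (A - B) 0 0 = A 0 0 - B 0 0 by move=> A' B'; rewrite !mxE.
Qed.

Lemma dot_hgrad (Phi : 'rV[R]_3 -> R) p d : dot d (hgrad Phi p) = d1 Phi p (hvec p d).
Proof. by rewrite /dot sum2 hgrad_d1. Qed.

Lemma qform_hhess (Phi : 'rV[R]_3 -> R) p w : class_C 2 Phi ->
  qform (hhess Phi p) w = d2 Phi p (hvec p w).
Proof. exact: hhess_d2. Qed.

Lemma affine_majorant_normal F p0 r0 xi0 A0 :
  degenerate_elliptic F -> monotone_in_r F -> operator_concave F -> sym_mx A0 ->
  exists a (b : 'rV[R]_3) (c : R) (d w1 w2 : 'rV[R]_2), [/\ 0 <= c,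
    forall p r xi A, sym_mx A ->
      F p r xi A <= a + dot b p + c * r + dot d xi - qform A w1 - qform A w2 &
    F p0 r0 xi0 A0 = a + dot b p0 + c * r0 + dot d xi0 - qform A0 w1 - qform A0 w2].
Proof.
move=> HE HM HC S0.
have [b [c [d [w1 [w2 [c0 H]]]]]] := affine_majorant p0 r0 xi0 HE HM HC S0.
exists (F p0 r0 xi0 A0 - dot b p0 - c * r0 - dot d xi0 + qform A0 w1 + qform A0 w2), b, c, d, w1, w2.
split=> //; last first.
  move: (F _ _ _ _) (dot b p0) (dot d xi0) (qform A0 w1) (qform A0 w2); clear => *; ring.
move=> p r xi A SA; have := H p r xi A SA; rewrite !dotB !qformB.
move: (F _ _ _ _) (F _ _ _ _) (dot b p0) (dot d xi0) (qform A0 w1) (qform A0 w2).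
move: (dot b p) (dot d xi) (qform A w1) (qform A w2); clear => *; lra.
Qed.

Lemma row2_neq0 (w : 'rV[R]_2) : w != 0 -> w 0 0 != 0 \/ w 0 1 != 0.
Proof.
move=> w0; have [e0|] := eqVneq (w 0 0) 0; last by left.
right; apply: contra_neq w0 => e1; apply: row2P; by rewrite ?e0 ?e1 mxE.
Qed.

Lemma explode_exists (a c : R) (b : 'rV[R]_3) (d w1 w2 : 'rV[R]_2) : 0 <= c ->
  [|| d != 0, w1 != 0 | w2 != 0] -> explodes (fun p => a + dot b p) c d w1 w2.
Proof.
move=> c0 nz; pose Q0 := `|a| + `|b 0 0| + `|b 0 1| + `|b 0 2|.
have Q00 : 0 <= Q0 by rewrite /Q0; do ?[done | apply: addr_ge0].
have fb p (h s : R) : 0 <= s -> 1 <= h -> `|p 0 0| <= (1 + s) * h -> `|p 0 1| <= (1 + s) * h ->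
    `|p 0 2| <= (1 + s) * h -> a + dot b p <= Q0 * ((1 + s) * h).
  move=> s0 h1; have sh : 1 <= (1 + s) * h by rewrite mulr_ege1 // lerDl.
  move: ((1 + s) * h) sh => M M1 h2 h3 h4.
  have K (e z : R) : `|z| <= M -> e * z <= `|e| * M.
    by move=> zM; apply: le_trans (ler_norm _) _; rewrite normrM ler_wpM2l.
  have k0 : a <= `|a| * M by have := K a 1; rewrite mulr1; apply; rewrite normr1.
  by rewrite /dot sum3 /Q0 3!mulrDl !addrA !lerD // K.
pose x (p : 'rV[R]_3) : R := p 0 0; pose y (p : 'rV[R]_3) : R := p 0 1.
pose zx (p : 'rV[R]_3) := p 0 2 + (- 2^-1) * (p 0 0 * p 0 1).
pose zy (p : 'rV[R]_3) := - (p 0 2 + 2^-1 * (p 0 0 * p 0 1)).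
pose ex (eta : 'rV[R]_2) : R := eta 0 0; pose ey (eta : 'rV[R]_2) : R := eta 0 1.
have Cc i : class_C 2 (fun p : 'rV[R]_3 => p 0 i) := @class_C_coord R 2 i.
have Czx : class_C 2 zx by exact: class_CD (Cc 2) (class_CZ _ (class_CM (Cc 0) (Cc 1))).
have Czy : class_C 2 zy by exact: class_CN (class_CD (Cc 2) (class_CZ _ (class_CM (Cc 0) (Cc 1)))).
have lineE p eta (t : R) : [/\ (p + t *: hvec p eta) 0 0 = p 0 0 + t * eta 0 0,
   (p + t *: hvec p eta) 0 1 = p 0 1 + t * eta 0 1 &
   (p + t *: hvec p eta) 0 2 = p 0 2 + t * ((p 0 0 * eta 0 1 - p 0 1 * eta 0 0) / 2)].
  by split; rewrite /hvec !mxE.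
have xl p eta (t : R) : x (p + t *: hvec p eta) = x p + t * ex eta by case: (lineE p eta t).
have yl p eta (t : R) : y (p + t *: hvec p eta) = y p + t * ey eta by case: (lineE p eta t).
have zxl p eta t : zx (p + t *: hvec p eta) =
    zx p - ex eta * (y p * t + ey eta * t ^+ 2 / 2).
  rewrite /zx /ex /ey /y; have [-> -> ->] := lineE p eta t.
  by move: (p 0 0) (p 0 1) (p 0 2) (eta 0 0) (eta 0 1) => *; field.
have zyl p eta t : zy (p + t *: hvec p eta) =
    zy p - ey eta * (x p * t + ex eta * t ^+ 2 / 2).
  rewrite /zy /ex /ey /x; have [-> -> ->] := lineE p eta t.
  by move: (p 0 0) (p 0 1) (p 0 2) (eta 0 0) (eta 0 1) => *; field.
have xo e : exists p, x p = e by exists (row3 e 0 0); rewrite /x row3E.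
have yo e : exists p, y p = e by exists (row3 0 e 0); rewrite /y row3E.
have T (t : R) : `|t| <= 1 + t ^+ 2.
  by rewrite -(real_normK (num_real t)); move: (`|t|) => u; have := sqr_ge0 (u - 1); nra.
have bx p : a + dot b p <= Q0 * ((1 + `|x p|) * hgt y zx p).
  apply: fb => //; first exact: hgt_ge1.
  - rewrite /x; have := hgt_ge1 y zx p; move: (hgt _ _ _) (`|_|) (normr_ge0 (p 0 0)) => *; nra.
  - apply: (@le_trans _ _ (hgt y zx p)).
      by apply: le_trans (T (y p)) _; rewrite /hgt lerDl sqr_ge0.
    by rewrite ler_peMl ?(le_trans _ (hgt_ge1 y zx p)) // lerDl.
  - have -> : p 0 2 = zx p + 2^-1 * (x p * y p) by rewrite /zx /x /y; ring.
    apply: le_trans (ler_normD _ _) _; rewrite [leRHS]mulrDl mul1r; apply: lerD.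
      by apply: le_trans (T (zx p)) _; rewrite /hgt; have := sqr_ge0 (y p); lra.
    rewrite normrM gtr0_norm ?invr_gt0 // normrM.
    apply: (@le_trans _ _ (`|x p| * `|y p|)); first by rewrite ler_piMl ?mulr_ge0 // invf_le1 // ler1n.
    apply: ler_wpM2l => //; apply: le_trans (T (y p)) _; by rewrite /hgt lerDl sqr_ge0.
have by_ p : a + dot b p <= Q0 * ((1 + `|y p|) * hgt x zy p).
  apply: fb => //; first exact: hgt_ge1.
  - apply: (@le_trans _ _ (hgt x zy p)).
      by apply: le_trans (T (x p)) _; rewrite /hgt lerDl sqr_ge0.
    by rewrite ler_peMl ?(le_trans _ (hgt_ge1 x zy p)) // lerDl.
  - rewrite /y; have := hgt_ge1 x zy p; move: (hgt _ _ _) (`|_|) (normr_ge0 (p 0 1)) => *; nra.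
  - have -> : p 0 2 = - zy p - 2^-1 * (y p * x p) by rewrite /zy /x /y; ring.
    apply: le_trans (ler_normB _ _) _; rewrite normrN [leRHS]mulrDl mul1r; apply: lerD.
      by apply: le_trans (T (zy p)) _; rewrite /hgt; have := sqr_ge0 (x p); lra.
    rewrite normrM gtr0_norm ?invr_gt0 // normrM.
    apply: (@le_trans _ _ (`|y p| * `|x p|)); first by rewrite ler_piMl ?mulr_ge0 // invf_le1 // ler1n.
    apply: ler_wpM2l => //; apply: le_trans (T (x p)) _; by rewrite /hgt lerDl sqr_ge0.
have [w0|w0] := boolP ((w1 != 0) || (w2 != 0)).
  have [h|h] : (ex w1 != 0 \/ ex w2 != 0) \/ (ey w1 != 0 \/ ey w2 != 0).
    by case/orP: w0 => /row2_neq0[]; auto.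
  - exact: (explode_diffusion (Cc 0) (Cc 1) Czx xl yl zxl xo d Q00 c0 bx h).
  - exact: (explode_diffusion (Cc 1) (Cc 0) Czy yl xl zyl yo d Q00 c0 by_ h).
move: w0; rewrite negb_or !negbK => /andP[/eqP w10 /eqP w20].
move: nz; rewrite w10 w20 eqxx !orbF => /row2_neq0[h|h].
- by apply: (explode_transport (Cc 0) (Cc 1) Czx xl yl zxl xo Q00 c0 bx) => //; rewrite /ex /ey mxE.
- by apply: (explode_transport (Cc 1) (Cc 0) Czy yl xl zyl yo Q00 c0 by_) => //; rewrite /ex /ey mxE.
Qed.

Lemma smooth_subsolution F (Phi : 'rV[R]_3 -> R) : degenerate_elliptic F ->
  class_C 2 Phi -> (forall p, F p (Phi p) (hgrad Phi p) (hhess Phi p) <= 0) ->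
  viscosity_subsolution F Phi.
Proof.
move=> HE C H; have cPhi := class_C_cont C; split.
- exact: continuous_locally_bounded.
- by apply: continuous_lsc => x; apply: continuousN; exact: cPhi.
- move=> phi p0 Cphi touch; have [T1 T2] := touch_above C Cphi touch.
  rewrite -(hgrad_eq T1); apply: le_trans (H p0).
  by apply: HE; [exact: sym_hhess|exact: sym_hhess|exact: mx_ge_hhess].
Qed.

Lemma comparison_forces_zeroth_order F w :
  degenerate_elliptic F -> monotone_in_r F -> operator_concave F ->
  comparison_principle F -> viscosity_supersolution F w ->
  forall p0 r0 xi0 A0, sym_mx A0 -> exists a (b : 'rV[R]_3) (c : R), [/\ 0 <= c,
    forall p r xi A, sym_mx A -> F p r xi A <= a + dot b p + c * r &
    F p0 r0 xi0 A0 = a + dot b p0 + c * r0].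
Proof.
move=> HE HM HC HP Hw p0 r0 xi0 A0 S0.
have [a [b [c [d [w1 [w2 [c0 H E]]]]]]] := affine_majorant_normal p0 r0 xi0 HE HM HC S0.
have [nz|] := boolP [|| d != 0, w1 != 0 | w2 != 0]; last first.
  rewrite !negb_or !negbK => /and3P[/eqP d0 /eqP w10 /eqP w20].
  have q0 (A : 'M[R]_2) : qform A 0 = 0 by rewrite /qform mul0mx mul0mx mxE.
  have d00 (xi : 'rV[R]_2) : dot 0 xi = 0.
    by rewrite /dot big1 // => i _; rewrite mxE mul0r.
  exists a, b, c; split => //; last by rewrite E d0 w10 w20 d00 !q0 addr0 !subr0.
  by move=> p r xi A SA; have := H p r xi A SA; rewrite d0 w10 w20 d00 !q0 addr0 !subr0.
have [x0 Hx0] := explode_exists a b c0 nz.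
have N1 : 1 <= `|w x0| + 1 by rewrite lerDr.
have [Phi [CPhi LPhi NPhi]] := Hx0 _ N1.
have sub : viscosity_subsolution F Phi.
  apply: smooth_subsolution => // p.
  apply: le_trans (H p (Phi p) (hgrad Phi p) (hhess Phi p) (sym_hhess _ _)) _.
  by rewrite dot_hgrad !qform_hhess.
have := HP Phi w sub Hw x0; have := ler_norm (w x0).
by move: NPhi; move: (Phi x0) (w x0) (`|w x0|); clear => *; lra.
Qed.

Lemma comparison_first_order_free F w :
  degenerate_elliptic F -> monotone_in_r F -> operator_concave F ->
  comparison_principle F -> viscosity_supersolution F w ->
  forall p r xi A xi' A', sym_mx A -> sym_mx A' -> F p r xi A <= F p r xi' A'.
Proof.
move=> HE HM HC HP Hw p r xi A xi' A' SA SA'.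
have [a [b [c [c0 H ->]]]] := comparison_forces_zeroth_order HE HM HC HP Hw p r xi' SA'.
exact: H.
Qed.

Lemma sym_mx0 : sym_mx (0 : 'M[R]_2).
Proof. by rewrite /sym_mx trmx0. Qed.

Lemma solution_convex F w :
  degenerate_elliptic F -> monotone_in_r F -> operator_concave F ->
  comparison_principle F -> viscosity_solution F w ->
  forall x y t, 0 <= t <= 1 -> w (t *: x + (1 - t) *: y) <= t * w x + (1 - t) * w y.
Proof.
move=> HE HM HC HP [cw sub super] x y t t01.
have free p r xi A : sym_mx A -> F p r 0 0 <= F p r xi A /\ F p r xi A <= F p r 0 0.
  move=> SA; split;
  apply: (comparison_first_order_free HE HM HC HP super) => //; exact: sym_mx0.
have neq_near (p0 q : 'rV[R]_3) : q != p0 -> exists2 e : R, 0 < e & forall z, `|z - q| < e -> z != p0.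
  move=> qp; exists `|p0 - q|; first by rewrite normr_gt0 subr_eq0 eq_sym.
  by move=> z; apply: contraTneq => ->; rewrite ltxx.
have Fw p : 0 <= F p (w p) 0 0.
  rewrite leNgt; apply/negP => neg.
  have [a [b [c [c0 H E]]]] := comparison_forces_zeroth_order HE HM HC HP super p (w p) 0 sym_mx0.
  pose e := - F p (w p) 0 0 / (c + 1).
  have c1 : 0 < c + 1 by rewrite ltr_wpDl.
  have e0 : 0 < e by rewrite divr_gt0 // oppr_gt0.
  have Fe xi A : sym_mx A -> F p (w p + e) xi A <= 0.
    move=> SA; apply: le_trans (H _ _ _ _ SA) _; rewrite mulrDr addrA -E.
    have : c * e <= (c + 1) * e by rewrite ler_wpM2r ?lerDl // ltW.
    by rewrite [(c + 1) * e]mulrC divfK ?lt0r_neq0 // => h; rewrite addrC -lerBrDr sub0r.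
  pose v q := if q == p then w p + e else w q.
  have vw q : w q <= v q by rewrite /v; case: eqP => [->|_]; rewrite // lerDl ltW.
  have vsub : viscosity_subsolution F v.
    split.
    - move=> q; have := continuous_locally_bounded cw q; rewrite /bounded_near => Hb.
      near=> M; have : nbhs q [set z | `|w z| <= M - e].
        near: M; case: Hb => M0 [M0r HM0]; exists (M0 + e); split; first exact: num_real.
        by move=> z; rewrite -ltrBrDr; exact: HM0.
      apply: filterS => z /= h; rewrite /v; case: eqP => [zp|_]; last first.
        by apply: le_trans h _; rewrite gerBl ltW.
      apply: le_trans (ler_normD _ _) _; rewrite (gtr0_norm e0) -lerBrDr.
      by rewrite -zp.
    - apply/lscP => q z; rewrite /v; have [->|qp] := eqVneq q p.
        move=> zq; have ze : 0 < - (w p + e) - z by rewrite subr_gt0.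
        have [dl dl0 Hd] := continuous_eps (cw p) ze.
        exists dl => // k kp; case: eqP => [//|_].
        have := Hd k kp; rewrite ltr_norml => /andP[_]; move: e0; move: (w k) (w p) (e); clear => *; lra.
      move=> zq; have ze : 0 < - w q - z by rewrite subr_gt0.
      have [dl dl0 Hd] := continuous_eps (cw q) ze; have [dm dm0 Hm] := neq_near p q qp.
      exists (Num.min dl dm); first by rewrite lt_min dl0.
      move=> k; rewrite lt_min => /andP[/Hd kd /Hm kp]; rewrite (negbTE kp).
      by move: kd; rewrite ltr_norml => /andP[_]; move: (w k) (w q); clear => *; lra.
    - move=> phi p0 Cphi touch; rewrite /v; have [->|pp] := eqVneq p0 p.
        by apply: Fe; exact: sym_hhess.
      have [_ _ Hsub] := sub; apply: Hsub => // q.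
      have := touch q; rewrite {2}/v (negbTE pp); apply: le_trans.
      by rewrite lerD2r.
  have := HP v w vsub super p; rewrite /v eqxx.
  by rewrite gerDl leNgt e0.
set p := t *: x + (1 - t) *: y; set s := t * w x + (1 - t) * w y.
have Fs : 0 <= F p s 0 0.
  have := operator_concave2 HC x (w x) 0 y (w y) 0 t01 sym_mx0 sym_mx0.
  rewrite !scaler0 !addr0 -/p -/s; apply: le_trans.
  by case/andP: t01 => t0 t1; rewrite addr_ge0 // mulr_ge0 // subr_ge0.
rewrite leNgt; apply/negP => lt_s.
pose v q := if q == p then s else w q.
have vw q : v q <= w q by rewrite /v; case: eqP => [->|_] //; exact: ltW.
have vsuper : viscosity_supersolution F v.
  split.
  - move=> q; have := continuous_locally_bounded cw q; rewrite /bounded_near => Hb.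
    near=> M; have hM : nbhs q [set z | `|w z| <= M] by near: M.
    have sM : `|s| <= M by near: M; apply: nbhs_pinfty_ge; exact: num_real.
    by apply: filterS hM => z /= h; rewrite /v; case: eqP.
  - apply/lscP => q z; rewrite /v; have [->|qp] := eqVneq q p.
      move=> zs; have ze : 0 < w p - z by rewrite subr_gt0; exact: lt_trans zs lt_s.
      have [dl dl0 Hd] := continuous_eps (cw p) ze.
      exists dl => // k kp; case: eqP => [//|_].
      have := Hd k kp; rewrite ltr_norml => /andP[+ _]; move: (w k) (w p); clear => *; lra.
    move=> zq; have ze : 0 < w q - z by rewrite subr_gt0.
    have [dl dl0 Hd] := continuous_eps (cw q) ze; have [dm dm0 Hm] := neq_near p q qp.
    exists (Num.min dl dm); first by rewrite lt_min dl0.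
    move=> k; rewrite lt_min => /andP[/Hd kd /Hm kp]; rewrite (negbTE kp).
    by move: kd; rewrite ltr_norml => /andP[+ _]; move: (w k) (w q); clear => *; lra.
  - move=> phi p0 Cphi touch; rewrite /v; have [->|pp] := eqVneq p0 p.
      have [h _] := free p s (hgrad phi p) (hhess phi p) (sym_hhess phi p).
      exact: le_trans Fs h.
    have [_ _ Hsup] := super; apply: Hsup => // q.
    have := touch q; rewrite {1}/v (negbTE pp) => /le_trans; apply.
    by rewrite lerD2r.
have := HP w v sub vsuper p; rewrite /v eqxx.
by rewrite leNgt lt_s.
Unshelve. all: by end_near. Qed.

Lemma envelope_supersolution F u :
  degenerate_elliptic F -> monotone_in_r F -> operator_concave F ->
  viscosity_supersolution F u -> coercive u ->
  viscosity_supersolution F (convex_envelope u).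
Proof.
move=> HE HM HC [lbu lu Hu] Hco.
have coer K : 0 <= K -> exists2 rho, 0 < rho & forall p, rho <= `|p| -> K * `|p| <= u p.
  by move=> K0; exact: coercive_linear.
have [C uC] : exists C, forall p, - C <= u p.
  have [rho rho0 Hr] := coer 0 (lexx 0).
  have [B B0 HB] := bounded_on_ball rho lbu.
  exists B => p; have [pr|pr] := leP `|p| rho.
    by have := HB p pr; rewrite ler_norml => /andP[].
  by apply: (@le_trans _ _ 0); [rewrite oppr_le0 ltW|have := Hr p (ltW pr); rewrite mul0r].
split; [exact: envelope_locally_bounded uC lbu|exact: envelope_lsc uC lbu|].
move=> phi p0 Cphi touch.
have [a [b [c [d [w1 [w2 [c0 H E]]]]]]] := affine_majorant_normal p0 (convex_envelope u p0)
  (hgrad phi p0) HE HM HC (sym_hhess phi p0).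
rewrite E dot_hgrad !qform_hhess //.
apply: (@envelope_linear_super R u (fun p => a + dot b p) a b) => //.
move=> psi q Cpsi tq; apply: le_trans (Hu psi q Cpsi tq) _.
by rewrite -!qform_hhess // -dot_hgrad; apply: H; exact: sym_hhess.
Qed.

End Supersolutions.

Unset Implicit Arguments.

Theorem theorem5p13 (R : realType) (F : operator R)
    (F_continuous : operator_continuous F)
    (A1 : degenerate_elliptic F)
    (A2 : monotone_in_r F)
    (A3' : operator_concave F)
    (u : 'rV[R]_3 -> R)
    (u_super : viscosity_supersolution F u)
    (u_coercive : coercive u) :
  viscosity_supersolution F (convex_envelope u) /\
  (comparison_principle F ->
   forall w : 'rV[R]_3 -> R, viscosity_solution F w ->
     (forall w' : 'rV[R]_3 -> R, viscosity_solution F w' -> w' = w) /\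
     convex_function [set: 'rV[R]_3] w).
Proof.
split; first exact: envelope_supersolution.
move=> HP w Hw; split=> [w' [_ sub' super']|t x y _ _].
  have [_ sub super] := Hw; apply/funext => p.
  by apply/eqP; rewrite eq_le (HP w' w sub' super) (HP w w' sub super').
have t01 : 0 <= t%:num <= 1 by rewrite ge0 le1.
exact: (solution_convex A1 A2 A3' HP Hw x y t01).
Qed.
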